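(* Let $k\in\mathbb N$. Then there exists $c>0$ such that, as $n\to\infty$ (with $r=r(n)$), $$\mathrm{Var}[S'_{n,k}]=\mathbb E[S'_{n,k}]\big(1+O(e^{-cnr^d})\big)=I_{n,k}\big(1+O(e^{-cnr^d})\big).$$
   Context: Setting. Let $d\in\mathbb N$; $\mathrm{Vol}$ is Lebesgue measure, $\theta$ is the volume of the unit-radius ball in $\mathbb R^d$. Let $A\subset\mathbb R^d$ be compact with $\mathrm{Vol}(A)>0$. If $d\ge2$, $A$ has a $C^{1,1}$ boundary: for each $x\in\partial A$ there are a neighbourhood $U$ of $x$ and a real-valued function $\phi$, defined on an open set in $\mathbb R^{d-1}$ and differentiable with Lipschitz continuous partial derivatives, such that $\partial A\cap U$, after a rotation, is the graph of $\phi$. If $d=1$, $A$ is an interval. Let $X_1,X_2,\ldots$ be i.i.d. random vectors in $\mathbb R^d$ with distribution $\nu$ having density $f$ and support $A$, with $f$ continuous on $A$. Put $f_0=\inf_Af$, $f_1=\inf_{\partial A}f$, and assume $f_0>0$. For real $n>0$ let $Z_n$ be Poisson with mean $n$, independent of $(X_i)$, and $\mathcal P_n=\{X_1,\ldots,X_{Z_n}\}$ (a Poisson process with intensity $nf$). For finite $\mathcal X\subset\mathbb R^d$ and $r>0$, $G(\mathcal X,r)$ is the graph on $\mathcal X$ with an edge between each pair of distinct points at Euclidean distance at most $r$, and $K_{k,r}(\mathcal X)$ is the number of connected components of $G(\mathcal X,r)$ with exactly $k$ vertices. Put $S'_{n,k}=K_{k,r(n)}(\mathcal P_n)$, $I_{n,k}=\mathbb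 E[S'_{n,k}]$. The sequence $r=r(n)>0$ satisfies $\lim_{n\to\infty}nr(n)^d=\infty$ and $\limsup_{n\to\infty}\frac{\theta nr(n)^d}{\log n}<\frac1{\max(f_0,\,d(f_0-f_1/2))}$. *)

(* Defs.v *)
From HB Require Import structures.
From mathcomp Require Import all_boot all_order all_algebra finmap.
From mathcomp Require Import all_classical all_reals all_analysis.
From mathcomp Require Import measurable_realfun.

Set Implicit Arguments.
Unset Strict Implicit.
Unset Printing Implicit Defensive.

Import Order.TTheory GRing.Theory Num.Theory numFieldNormedType.Exports.

Local Open Scope classical_set_scope.
Local Open Scope ring_scope.

Definition rV_display : measure_display.
Proof. exact: default_measure_display. Qed.

(* The sigma-algebra on row vectors is the one generated by the coordinates; it
   coincides with the Borel sigma-algebra (measurable_rVE). *)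
Section measurable_rV.
Context {R : realType} {d : nat}.

Let coord (i : 'I_d) (x : 'rV[R]_d) : R := x 0 i.

Let rV_set0 : g_sigma_preimage coord set0.
Proof. exact: sigma_algebra0. Qed.

Let rV_setC A : g_sigma_preimage coord A -> g_sigma_preimage coord (~` A).
Proof. exact: sigma_algebraC. Qed.

Let rV_bigcup (F : (set 'rV[R]_d)^nat) :
  (forall i, g_sigma_preimage coord (F i)) ->
  g_sigma_preimage coord (\bigcup_i (F i)).
Proof. exact: sigma_algebra_bigcup. Qed.

HB.instance Definition _ := @isMeasurable.Build rV_display
  'rV[R]_d (g_sigma_preimage coord) rV_set0 rV_setC rV_bigcup.

Lemma measurable_rV_coord (i : 'I_d) :
  measurable_fun [set: 'rV[R]_d] (fun x : 'rV[R]_d => x 0 i).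
Proof.
move=> _ Y mY; rewrite setTI; apply: sub_sigma_algebra => /=.
rewrite -bigcup_seq/=; exists i => /=; first by rewrite mem_index_enum.
by exists Y => //; rewrite setTI.
Qed.

Lemma measurable_fun_rV d1 (T : measurableType d1) (g : T -> 'rV[R]_d) :
  (forall i, measurable_fun [set: T] (fun t => g t 0 i)) ->
  measurable_fun [set: T] g.
Proof.
move=> mg _ Y mY; rewrite setTI; move: Y mY.
apply: smallest_sub.
  split; first by rewrite /= preimage_set0.
  - by move=> A /= mA; rewrite setTD preimage_setC; exact: measurableC.
  - by move=> F mF /=; rewrite preimage_bigcup; exact: bigcup_measurable.
move=> A; rewrite -bigcup_seq /= => -[i _ [B mB <-]] /=.
by have := mg i measurableT _ mB; rewrite !setTI.
Qed.

End measurable_rV.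

Section lebesgue_measure_rV.
Context {R : realType}.

Definition rV_cons d (p : R * 'rV[R]_d) : 'rV[R]_d.+1 :=
  row_mx (const_mx p.1 : 'rV[R]_1) p.2.

Let rV_consl d (p : R * 'rV[R]_d) (j : 'I_1) :
  rV_cons p 0 (lshift d j) = p.1.
Proof. by rewrite [LHS]row_mxEl mxE. Qed.

Let rV_consr d (p : R * 'rV[R]_d) j : rV_cons p 0 (rshift 1 j) = p.2 0 j.
Proof. exact: row_mxEr. Qed.

Lemma measurable_rV_cons d : measurable_fun setT (@rV_cons d).
Proof.
apply: measurable_fun_rV => i.
case: (@split_ordP 1 d i) => j ->.
  rewrite [X in measurable_fun _ X](_ : _ = fst) //.
  by apply/funext => p; exact: rV_consl.
rewrite [X in measurable_fun _ X](_ : _ = (fun x : 'rV[R]_d => x 0 j) \o snd).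
  by apply: measurableT_comp => //; exact: measurable_rV_coord.
by apply/funext => p; exact: rV_consr.
Qed.

Section step.
Variables (d : nat) (m : {sigma_finite_measure set 'rV[R]_d -> \bar R}).

Definition lebesgue_rVS : set 'rV[R]_d.+1 -> \bar R :=
  pushforward (@lebesgue_measure R \x m)%E (@rV_cons d).

Let lebesgue_rVS0 : lebesgue_rVS set0 = 0%E.
Proof. by rewrite /lebesgue_rVS /pushforward preimage_set0 measure0. Qed.

Let lebesgue_rVS_ge0 A : (0 <= lebesgue_rVS A)%E.
Proof. by rewrite /lebesgue_rVS /pushforward; exact: measure_ge0. Qed.

Let lebesgue_rVS_sigma_additive : semi_sigma_additive lebesgue_rVS.
Proof.
move=> F mF tF mUF; rewrite /lebesgue_rVS /pushforward preimage_bigcup.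
apply: measure_semi_sigma_additive.
- by move=> n; rewrite -[X in measurable X]setTI; exact: measurable_rV_cons.
- apply/trivIsetP => /= i j _ _ ij; rewrite -preimage_setI.
  by move/trivIsetP : tF => /(_ _ _ _ _ ij) ->//; rewrite preimage_set0.
- rewrite -preimage_bigcup -[X in measurable X]setTI.
  exact: measurable_rV_cons.
Qed.

HB.instance Definition _ := isMeasure.Build _ _ _ lebesgue_rVS
  lebesgue_rVS0 lebesgue_rVS_ge0 lebesgue_rVS_sigma_additive.

Let lebesgue_rVS_sigma_finite : sigma_finite setT lebesgue_rVS.
Proof.
have /sigma_finiteP[F [TF ndF Foo]] := sigma_finiteT (@lebesgue_measure R).
have /sigma_finiteP[G [TG ndG Goo]] := sigma_finiteT m.
pose g (x : 'rV[R]_d.+1) : R * 'rV[R]_d := (x 0 0, rsubmx (x : 'rV_(1 + d))).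
have gK : cancel (@rV_cons d) g.
  move=> [a v]; rewrite /g /rV_cons; congr (_, _); last exact: row_mxKr.
  have <- : lshift d (0 : 'I_1) = 0 :> 'I_d.+1 by exact/val_inj.
  exact: rV_consl.
have mg : measurable_fun setT g.
  apply/measurable_fun_pairP; split => /=; first exact: measurable_rV_coord.
  apply: measurable_fun_rV => i /=.
  rewrite [X in measurable_fun _ X](_ : _ = fun x : 'rV[R]_d.+1 =>
    x 0 (rshift 1 i)); first exact: measurable_rV_coord.
  by apply/funext => x; rewrite !mxE.
exists (fun n => g @^-1` (F n `*` G n)).
  rewrite -preimage_bigcup [X in _ @^-1` X](_ : _ = setT) ?preimage_setT//.
  apply/seteqP; split=> // -[a v] _.
  have [i _ Fia] : (\bigcup_k F k) a by rewrite -TF.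
  have [j _ Gjv] : (\bigcup_k G k) v by rewrite -TG.
  exists (maxn i j) => //; split => /=.
  - by move: a Fia; exact/subsetPset/ndF/leq_maxl.
  - by move: v Gjv; exact/subsetPset/ndG/leq_maxr.
move=> n; have [? ?] := Foo n; have [? ?] := Goo n; split.
  by rewrite -[X in measurable X]setTI; apply: mg => //; exact: measurableX.
rewrite /lebesgue_rVS /pushforward -comp_preimage.
rewrite [X in X @^-1` _](_ : _ = id); last by apply/funext => p; exact: gK.
by rewrite product_measure1E// lte_mul_pinfty// ge0_fin_numE.
Qed.

HB.instance Definition _ := Measure_isSigmaFinite.Build _ _ _ lebesgue_rVS
  lebesgue_rVS_sigma_finite.

End step.

(* The d-fold product of the Lebesgue measure on R; see lebesgue_rV_box. *)
Fixpoint lebesgue_rV (d : nat) :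
    {sigma_finite_measure set 'rV[R]_d -> \bar R} :=
  match d with
  | 0%N => \d_ (0 : 'rV[R]_0)
  | d'.+1 => lebesgue_rVS (lebesgue_rV d')
  end.

End lebesgue_measure_rV.

Lemma lebesgue_rV_box (R : realType) (d : nat)
    (B : 'I_d -> set (measurableTypeR R)) :
  (forall i, measurable (B i)) ->
  lebesgue_rV d [set x : 'rV[R]_d | forall i, B i (x 0 i)] =
  (\prod_(i < d) lebesgue_measure (B i))%E.
Proof.
elim: d B => [|d IH] B mB.
  rewrite big_ord0 /= diracE mem_set //= => -[].
  by [].
rewrite big_ord_recl -IH; last by move=> i.
rewrite /= -product_measure1E//; last first.
  rewrite [X in measurable X](_ : _ = \bigcap_(i in [set: 'I_d])
    (fun x : 'rV[R]_d => x 0 i) @^-1` B (lift ord0 i)); last first.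
    by apply/seteqP; split => x /= h i; [move=> _|]; exact: h.
  apply: fin_bigcap_measurable => [|i _]; first exact: finite_finset.
  rewrite -[X in measurable X]setTI.
  by apply: measurable_rV_coord => //; exact: mB.
rewrite /lebesgue_rVS /pushforward; congr product_measure1.
have e0 : lshift d (0 : 'I_1) = ord0 :> 'I_d.+1 by exact/val_inj.
have eS (i : 'I_d) : rshift 1 i = lift ord0 i :> 'I_d.+1 by exact/val_inj.
apply/seteqP; split => [[a v]/= h|[a v] /= [h0 h] i].
  split; first by have := h ord0; rewrite -e0 [rV_cons _ _ _]row_mxEl mxE.
  by move=> i; have := h (lift ord0 i); rewrite -eS [rV_cons _ _ _]row_mxEr.
case: (unliftP ord0 i) => [j|] ->.
  by rewrite -eS [rV_cons _ _ _]row_mxEr eS; exact: h.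
by rewrite -e0 [rV_cons _ _ _]row_mxEl mxE e0.
Qed.

Lemma open_rV_measurable (R : realType) (d : nat) (U : set 'rV[R]_d) :
  open U -> measurable U.
Proof.
move=> oU.
have mball (x : 'rV[R]_d) (e : R) : 0 < e -> measurable (ball x e).
  move=> e0; rewrite [X in measurable X](_ : _ = \bigcap_(i in [set: 'I_d])
    (fun y : 'rV[R]_d => y 0 i) @^-1` (ball (x 0 i) e)); last first.
    apply/seteqP; split => [y [_ xy] i _ /=|y xy]; first exact: xy.
    by split => // i j; rewrite ord1; exact: (xy j I).
  apply: fin_bigcap_measurable => [|i _]; first exact: finite_finset.
  rewrite -[X in measurable X]setTI.
  by apply: measurable_rV_coord => //; apply: open_measurable; exact: ball_open.
pose c (q : 'rV[rat]_d) : 'rV[R]_d := map_mx ratr q.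
pose D (p : 'rV[rat]_d * nat) := ball (c p.1) (p.2.+1%:R^-1) `<=` U.
have -> : U = \bigcup_(p in D) ball (c p.1) (p.2.+1%:R^-1).
  apply/seteqP; split => [x Ux|x [p Dp]]; last exact: Dp.
  have /nbhs_ballP[e /= e0 xeU] : nbhs x U by exact: open_nbhs_nbhs.
  have [n ne] : exists n : nat, n.+1%:R^-1 + n.+1%:R^-1 < e.
    have e2 : 0 < e / 2 by rewrite divr_gt0.
    have [n] := ltr_add_invr e2.
    rewrite add0r => ne; exists n.
    by rewrite [e]splitr ltrD.
  have n0 : 0 < n.+1%:R^-1 :> R by rewrite invr_gt0.
  have /choice[q qx] i : exists q : rat, `|x 0 i - ratr q| < n.+1%:R^-1.
    have /rat_in_itvoo[q] : x 0 i - n.+1%:R^-1 < x 0 i + n.+1%:R^-1.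
      by rewrite ltrD2l gtrN.
    rewrite in_itv/= => qx; exists q.
    by rewrite distrC ltr_distl.
  have cx : ball (c (\row_i q i)) n.+1%:R^-1 x.
    by split=> // i j; rewrite ord1 !mxE /ball/= distrC; exact: qx.
  exists (\row_i q i, n) => //= y cy; apply: xeU.
  apply: le_ball (ltW ne) _ _.
  exact: ball_triangle (ball_sym cx) cy.
rewrite bigcup_mkcond; apply: countable_bigcupT_measurable => // p.
by case: ifP => // _; apply: mball; rewrite invr_gt0.
Qed.

Lemma measurable_rVE (R : realType) (d : nat) :
  @measurable _ 'rV[R]_d = <<s @open 'rV[R]_d >>.
Proof.
apply/seteqP; split; last first.
  apply: smallest_sub; first exact: sigma_algebra_measurable.
  exact: open_rV_measurable.
apply: smallest_sub; first exact: smallest_sigma_algebra.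
move=> A; rewrite -bigcup_seq /= => -[i _ [B mB <-]] /=.

have [_ _ sB] := @smallest_sigma_algebra 'rV[R]_d setT open.
have : (@RGenOpens.G R).-sigma.-measurable B by rewrite -RGenOpens.measurableE.
move: B {mB}.
have sT : sigma_algebra [set: 'rV[R]_d] <<s @open 'rV[R]_d >>.
  exact: smallest_sigma_algebra.
apply: smallest_sub.
  have [s0 sD sU] := sT; split => /=.
  - by rewrite setTI preimage_set0.
  - move=> B /= /sD; rewrite !setTI !setTD.
    by rewrite preimage_setC.
  - by move=> F mF /=; rewrite setTI preimage_bigcup; apply: sU => j;
    by rewrite -[X in smallest _ _ X]setTI; exact: mF.
move=> _ [a [b ->]] /=; apply: sub_sigma_algebra; rewrite setTI.
apply: open_comp; last exact: interval_open.
by move=> x _; exact: coord_continuous.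
Qed.

Section geometry.
Context {R : realType} {d : nat}.

(* The Euclidean norm; the library norm `|x| on 'rV is the sup norm. *)
Definition enorm (x : 'rV[R]_d) : R := Num.sqrt (\sum_(i < d) x 0 i ^+ 2).

Definition boundary (A : set 'rV[R]_d) : set 'rV[R]_d :=
  closure A `\` interior A.

Definition rotation (Q : 'M[R]_d) : Prop := Q *m Q^T = 1%:M /\ \det Q = 1.

(* The graph, over the coordinates other than l, of phi restricted to V. *)
Definition graph_over (l : 'I_d) (V : set 'rV[R]_d.-1)
    (phi : 'rV[R]_d.-1 -> R) : set 'rV[R]_d :=
  [set x | V (col' l x) /\ x 0 l = phi (col' l x)].

End geometry.

Definition unit_ball_volume (R : realType) (d : nat) : R :=
  fine (lebesgue_rV d [set x : 'rV[R]_d | enorm x <= 1]).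

Definition C11_on (R : realType) (m : nat) (V : set 'rV[R]_m)
    (phi : 'rV[R]_m -> R) : Prop :=
  (forall u, V u -> differentiable phi u) /\
  (forall i : 'I_m, [lipschitz 'D_(delta_mx 0 i) phi u | u in V]).

Definition C11_boundary (R : realType) (d : nat) (A : set 'rV[R]_d) : Prop :=
  forall x, boundary A x ->
  exists2 U : set 'rV[R]_d, nbhs x U &
  exists (Q : 'M[R]_d) (l : 'I_d)
         (V : set 'rV[R]_d.-1) (phi : 'rV[R]_d.-1 -> R),
    [/\ rotation Q, l = d.-1 :> nat, open V, C11_on V phi &
        [set y *m Q | y in boundary A `&` U] = graph_over l V phi].

Section probability.
Local Open Scope ereal_scope.
Context {R : realType}.

Definition has_density (d : nat) (nu : set 'rV[R]_d -> \bar R)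
    (f : 'rV[R]_d -> R) : Prop :=
  [/\ measurable_fun setT f, (forall x, (0 <= f x)%R) &
    forall B, measurable B -> nu B = \int[lebesgue_rV d]_(x in B) (f x)%:E].

Definition measure_support (d : nat) (nu : set 'rV[R]_d -> \bar R) :
    set 'rV[R]_d :=
  [set x | forall U, open U -> U x -> 0 < nu U].

Context {disp disp' : measure_display} {Omega : measurableType disp}
  {T : measurableType disp'} (P : probability Omega R).

Definition mutually_independent (X : nat -> {RV P >-> T}) : Prop :=
  forall (J : {fset nat}) (B : nat -> set T), (forall j, measurable (B j)) ->
  P (\bigcap_(j in [set` J]) X j @^-1` B j) = \prod_(j <- J) P (X j @^-1` B j).

Definition iid (nu : set T -> \bar R) (X : nat -> {RV P >-> T}) : Prop :=
  mutually_independent X /\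
  forall i B, measurable B -> distribution P (X i) B = nu B.

Definition sigma_sequence (X : nat -> {RV P >-> T}) : set (set Omega) :=
  <<s \bigcup_i preimage_set_system setT (X i) measurable >>.

Definition independent_of_sequence (N : {RV P >-> nat})
    (X : nat -> {RV P >-> T}) : Prop :=
  forall (E : set Omega) (C : set nat), sigma_sequence X E ->
  P (E `&` N @^-1` C) = P E * P (N @^-1` C).

Definition is_poisson (lambda : R) (N : {RV P >-> nat}) : Prop :=
  forall j, P (N @^-1` [set j]) = (poisson_pmf lambda j)%:E.

End probability.

Section random_geometric_graph.
Context {R : realType} {d : nat}.

Definition geo_adj (S : {fset 'rV[R]_d}) (r : R) : rel S :=
  fun x y => (x != y) && (enorm (val x - val y) <= r).

Definition components (S : {fset 'rV[R]_d}) (r : R) : {set {set S}} :=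
  [set [set y | connect (geo_adj r) x y] | x : S]%SET.

Definition num_components (k : nat) (r : R) (S : {fset 'rV[R]_d}) : nat :=
  #|[set C in components S r | #|C| == k]%SET|.

Context {disp : measure_display} {Omega : measurableType disp}
  {P : probability Omega R}.

Definition sample (X : nat -> {RV P >-> 'rV[R]_d}) (N : {RV P >-> nat})
    (w : Omega) : {fset 'rV[R]_d} :=
  [fset X i w | i in iota 0 (N w)]%fset.

(* S'_{n,k} *)
Definition cluster_count (X : nat -> {RV P >-> 'rV[R]_d})
    (Z : R -> {RV P >-> nat}) (r : R -> R) (k : nat) (n : R) : Omega -> R :=
  fun w => (num_components k (r n) (sample X (Z n) w))%:R.

(* I_{n,k} *)
Definition mean_cluster_count (X : nat -> {RV P >-> 'rV[R]_d})
    (Z : R -> {RV P >-> nat}) (r : R -> R) (k : nat) (n : R) : \bar R :=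
  ('E_P[cluster_count X Z r k n])%E.

End random_geometric_graph.

(* Main.v *)
Require Import Defs.
From HB Require Import structures.
From mathcomp Require Import all_boot all_order all_algebra finmap.
From mathcomp Require Import all_classical all_reals all_analysis.
From mathcomp Require Import perm measurable_realfun ring lra.

Set Implicit Arguments.
Unset Strict Implicit.
Unset Printing Implicit Defensive.

Import Order.TTheory GRing.Theory Num.Theory numFieldNormedType.Exports.

Local Open Scope classical_set_scope.
Local Open Scope ring_scope.

(* The first two factorial moments of the number of [k]-clusters are given by the Mecke
   formula; the factorial second moment integrates over pairs of [k]-point clusters [x],
   [y] at distance more than [r] the weight [exp (- n nu (B x `|` B y))], where [B x] is
   the union of the [r]-balls around the points of [x]. For pairs at distance more than
   [2r] the sets [B x] and [B y] are disjoint and the weight factorizes, so that [Var S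
   - E S] only involves pairs of nearby clusters. For those, let [e] be an inner
   direction of [A] valid near the clusters: the point [z] of [x] and [y] which is
   highest in the direction [e] sees, around [z + (r/2) e], a small ball contained in
   [A], in [B_r(z)] and disjoint from the balls around the points of the other cluster.
   Hence [nu (B x `|` B y)] exceeds [nu (B x)] or [nu (B y)] by a constant times [r^d],
   which gains [exp (- c n r^d)], while the number of ways of placing the second cluster
   near the first one costs only [(n r^d)^k]. The inner direction comes from the
   boundary charts: near a boundary point [A] cannot reduce to the graph of the chart, a
   null set, because [A] is the support of [nu]. *)

(** * Sequences of independent points *)

(** No point process theory enters: given its size, the Poisson sample is an initial segment of an
    i.i.d. sequence, so the factorial moments are computed for [m] points by exchangeability and
    then mixed over [m], where the Poisson weights resum to an exponential. As clusters are made of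
    points and not of indices, coincidences between points are first discarded as a null event. The
    obstacle in the comparison is that no lower bound on the mean is at hand, so the error must come
    out as a multiple of the mean itself. Hence one cluster is kept with its full weight while the
    other is integrated out; when the gain is over the second cluster, the two blocks of coordinates
    are swapped, which preserves the law. The power [lam ^ k] of the rescaling and the factor of
    order [r ^ (d * k)] paid for the other cluster combine into a power of [lam * r ^ d], absorbed
    by half of the exponential gain. The geometric constants are uniform for [r] below a threshold,
    which is eventually met because the growth condition forces [r n] to tend to [0]. *)

Section sequence_space.
Context {disp : measure_display} {T : measurableType disp}.

(** Canonical space of the sequence: its elements can be permuted, cut and concatenated, operations
    that have no meaning on the abstract space [Omega]. *)
Definition seqspace := g_sigma_algebraType
  (\bigcup_i preimage_set_system [set: nat -> T] (fun x => x i) measurable).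

Lemma measurable_seq_coord i :
  measurable_fun [set: seqspace] (fun x : seqspace => x i : T).
Proof.
move=> _ Y mY; rewrite setTI; apply: sub_sigma_algebra => /=.
by exists i => //; exists Y => //; rewrite setTI.
Qed.

Lemma measurable_fun_seq d1 (S : measurableType d1) (g : S -> seqspace) :
  (forall i, measurable_fun [set: S] (fun s => g s i : T)) ->
  measurable_fun [set: S] g.
Proof.
move=> mg _ Y mY; rewrite setTI; move: Y mY.
apply: smallest_sub.
  split; first by rewrite /= preimage_set0.
  - by move=> A /= mA; rewrite setTD preimage_setC; exact: measurableC.
  - by move=> F mF /=; rewrite preimage_bigcup; exact: bigcup_measurable.
move=> A [i _ /= [B mB <-]] /=.
by have := mg i measurableT _ mB; rewrite !setTI.
Qed.

Definition box m (B : nat -> set T) : set seqspace :=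
  [set x | forall i, (i < m)%N -> B i (x i)].

Lemma measurable_box m B : (forall i, measurable (B i)) -> measurable (box m B).
Proof.
move=> mB; rewrite [X in measurable X](_ : _ = \bigcap_(i in `I_m)
   ((fun x : seqspace => x i : T) @^-1` B i)); last first.
  by apply/seteqP; split => x /= h i; exact: h.
apply: fin_bigcap_measurable => [|i _]; first exact: finite_II.
by rewrite -[X in measurable X]setTI; apply: measurable_seq_coord.
Qed.

Context {R : realType}.
Local Open Scope ereal_scope.

(** Arbitrary finite index sets, as in [mutually_independent]; reindexing tests the law on images of
    initial segments. *)
Definition iid_law (nu : probability T R)
    (mu : {measure set seqspace -> \bar R}) : Prop :=
  forall (J : {fset nat}) (B : nat -> set T), (forall j, measurable (B j)) ->
  mu [set x | forall j, j \in J -> B j (x j)] = \prod_(j <- J) nu (B j).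

Lemma iid_law_box nu mu m B : iid_law nu mu -> (forall j, measurable (B j)) ->
  mu (box m B) = \prod_(i < m) nu (B i).
Proof.
move=> H mB; have := H [fset i in iota 0 m]%fset B mB.
rewrite [X in mu X](_ : _ = box m B); last first.
  apply/seteqP; split => x h i.
    by move=> im; apply: h; rewrite !inE/= mem_iota.
  by rewrite !inE/= mem_iota add0n/= => im; exact: h.
move=> ->; rewrite big_imfset//=.
by rewrite -[RHS](big_mkord xpredT (fun i => nu (B i))) /index_iota subn0
  ?undup_id ?iota_uniq.
Qed.

(** Boxes generate the sigma-algebra and are stable under intersection once boxes of different
    lengths are padded with [setT]. *)
Lemma iid_law_unique nu mu (mu' : {measure set seqspace -> \bar R}) :
  iid_law nu mu ->
  (forall m B, (forall j, measurable (B j)) ->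
     mu' (box m B) = \prod_(i < m) nu (B i)) ->
  forall E, measurable E -> mu E = mu' E.
Proof.
move=> H H'.
pose G : set (set seqspace) :=
  [set E | exists m B, (forall i, measurable (B i)) /\ E = box m B].
have GT : G setT.
  by exists 0%N, (fun=> setT); split => //; apply/seteqP.
move=> E mE; apply: (@g_sigma_algebra_measure_unique _ R seqspace G _
  (fun=> setT)) => //.
- by move=> _ [m [B [mB ->]]]; exact: measurable_box.
- by apply/seteqP; split => // x _; exists 0%N.
- move=> _ _ [m [B [mB ->]]] [m' [B' [mB' ->]]].
  exists (maxn m m'), (fun i => (if (i < m)%N then B i else setT) `&`
                            (if (i < m')%N then B' i else setT)); split.
    by move=> i; apply: measurableI; case: ifP.
  apply/seteqP; split => x /=.
    move=> [h h'] i _; split.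
      by case: ifPn => // im; exact: h.
    by case: ifPn => // im; exact: h'.
  move=> h; split=> i im.
    by have [] := h i (leq_trans im (leq_maxl _ _)); rewrite im.
  by have [_] := h i (leq_trans im (leq_maxr _ _)); rewrite im.
- by move=> _ [m [B [mB ->]]]; rewrite (iid_law_box m H)// H'.
- move=> _; rewrite [X in mu X](_ : _ = box 0 (fun=> setT)).
    by rewrite (iid_law_box _ H)// big_ord0 ltry.
  by apply/seteqP.
- move: E mE; apply: smallest_sub; first exact: smallest_sigma_algebra.
  move=> _ [i _ [B mB <-]]; apply: sub_sigma_algebra.
  exists i.+1, (fun j => if j == i then B else setT); split.
    by move=> j; case: ifP.
  apply/seteqP; split => x /=.
    by move=> [_ Bx] j _; case: eqP => // ->.
  by move=> /(_ i (leqnn _)); rewrite eqxx.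
Qed.

Definition reindex_seq (s : nat -> nat) (x : seqspace) : seqspace :=
  fun i => x (s i).

Lemma measurable_reindex_seq s : measurable_fun setT (reindex_seq s).
Proof. by apply: measurable_fun_seq => i; exact: measurable_seq_coord. Qed.

Definition concat_seq j (p : seqspace * seqspace) : seqspace :=
  fun i => if (i < j)%N then p.1 i else p.2 (i - j)%N.

Lemma measurable_concat_seq j : measurable_fun setT (concat_seq j).
Proof.
apply: measurable_fun_seq => i; rewrite /concat_seq; case: (i < j)%N.
  exact: (measurableT_comp (measurable_seq_coord i)
    (@measurable_fst _ _ seqspace seqspace)).
exact: (measurableT_comp (measurable_seq_coord (i - j))
  (@measurable_snd _ _ seqspace seqspace)).
Qed.

Section laws.
Variables (nu : probability T R) (mu : probability seqspace R).
Hypothesis H : iid_law nu mu.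

HB.instance Definition _ s := isMeasurableFun.Build _ _ _ _ (reindex_seq s)
   (measurable_reindex_seq s).
HB.instance Definition _ s := isMeasurableFun.Build _ _ _ _ (concat_seq s)
   (measurable_concat_seq s).

(** An injection is enough: the law is tested on the image of a segment, the sets being carried
    there by the left inverse [t]. *)
Lemma iid_law_reindex s t : cancel s t ->
  forall E, measurable E -> mu (reindex_seq s @^-1` E) = mu E.
Proof.
move=> st E mE; symmetry.
apply: (@iid_law_unique nu mu (pushforward mu (reindex_seq s)) H) => // m B mB.
rewrite /pushforward.
have := H [fset s i | i in iota 0 m]%fset (fun j => mB (t j)).
rewrite [X in _ X = _ -> _](_ : _ = reindex_seq s @^-1` box m B); last first.
  apply/seteqP; split => x /=.
    move=> h i im; have := h (s i); rewrite st; apply.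
    by apply/imfsetP; exists i => //=; rewrite mem_iota.
  move=> h _ /imfsetP[i/= im ->]; rewrite st; apply: h.
  by move: im; rewrite mem_iota.
move=> muE; rewrite [LHS]muE big_imfset/=; last by move=> i j _ _; exact: can_inj st _ _.
rewrite -[RHS](big_mkord xpredT (fun i => nu (B i))) /index_iota subn0.
rewrite undup_id ?iota_uniq//.
by apply: eq_bigr => i _; rewrite st.
Qed.

(** Restarting with a fresh copy after [j] terms keeps the law. Together with Fubini this replaces
    conditioning on the first [j] points. *)
Lemma iid_law_concat j : forall E, measurable E ->
  (mu \x mu) (concat_seq j @^-1` E) = mu E.
Proof.
move=> E mE; symmetry.
apply: (@iid_law_unique nu mu (pushforward (mu \x mu) (concat_seq j)) H) => //.
move=> m B mB; rewrite /pushforward.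
(* Padding beyond [m] treats [m <= j] and [j < m] at once; the extra factors are equal to [1]. *)
pose B' i := if (i < m)%N then B i else setT.
have mB' i : measurable (B' i) by rewrite /B'; case: ifP.
have catE : concat_seq j @^-1` box m B =
    box j B' `*` box m (fun i => B' (j + i)%N).
  apply/seteqP; split => -[x y] /=; rewrite /box/=.
    move=> h; split => i ij.
      by rewrite /B'; case: ifPn => // im; have := h i im; rewrite /concat_seq ij.
    rewrite /B'; case: ifPn => // im; have := h _ im.
    by rewrite /concat_seq ltnNge leq_addr/= addKn.
  move=> [h1 h2] i im; rewrite /concat_seq/=; case: ifPn => ij.
    by have := h1 i ij; rewrite /B' im.
  rewrite -leqNgt in ij; have := h2 (i - j)%N.
  rewrite /B' subnKC// im; apply.
  by rewrite (leq_ltn_trans _ im)// leq_subr.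
transitivity ((mu \x mu) (box j B' `*` box m (fun i => B' (j + i)%N))).
  by rewrite -catE.
rewrite product_measure1E//; [|exact: measurable_box|exact: measurable_box].
rewrite (iid_law_box _ H)// (iid_law_box _ H)//.
transitivity (\prod_(i < j + m) nu (B' i)).
  by rewrite big_split_ord.
rewrite addnC big_split_ord/= [X in _ * X]big1 ?mule1.
  by apply: eq_bigr => i _; rewrite /B' ltn_ord.
by move=> i _; rewrite /B' ltnNge leq_addr/= probability_setT.
Qed.

Lemma integral_reindex s t (G : seqspace -> \bar R) : cancel s t ->
  measurable_fun setT G -> (forall x, 0 <= G x) ->
  \int[mu]_x G (reindex_seq s x) = \int[mu]_x G x.
Proof.
move=> st mG G0.
rewrite -(ge0_integral_pushforward (measurable_reindex_seq s) mu measurableT)//.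
apply: eq_measure_integral => A mA _; exact: (iid_law_reindex st).
Qed.

Lemma integral_concat j (G : seqspace -> \bar R) :
  measurable_fun setT G -> (forall x, 0 <= G x) ->
  \int[mu]_x G x = \int[mu]_x \int[mu]_y G (concat_seq j (x, y)).
Proof.
move=> mG G0; transitivity (\int[mu \x mu]_p G (concat_seq j p)).
  rewrite -(ge0_integral_pushforward (measurable_concat_seq j) (mu \x mu) measurableT)//.
  by apply: eq_measure_integral => A mA _; exact/esym/iid_law_concat.
rewrite fubini_tonelli1//.
exact: (measurableT_comp mG (measurable_concat_seq j)).
Qed.

End laws.
End sequence_space.

(** * Connected components *)

Section graph_components.

(** [components] for a relation on any finite type, so that the graph on points can be compared with
    the graph on indices. *)
Definition comps (V : finType) (e : rel V) : {set {set V}} :=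
  [set [set y | connect e x y] | x : V]%SET.

Lemma connect_homo (V W : finType) (f : V -> W) (e : rel V) (e' : rel W) :
  (forall x y, e x y -> e' (f x) (f y)) ->
  forall x y, connect e x y -> connect e' (f x) (f y).
Proof.
move=> ef x y /connectP[p ep ->] {y}; elim: p x ep => //= z p IH x /andP[xz zp].
by apply: connect_trans (IH _ zp); exact/connect1/ef.
Qed.

Lemma connect_iso (V W : finType) (f : V -> W) (e : rel V) (e' : rel W) :
  bijective f -> (forall x y, e' (f x) (f y) = e x y) ->
  forall x y, connect e' (f x) (f y) = connect e x y.
Proof.
move=> [g fK gK] ef x y; apply/idP/idP; last first.
  by apply: connect_homo => a b; rewrite ef.
rewrite -{2}(fK x) -{2}(fK y); apply: connect_homo => a b.
by rewrite -ef !gK.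
Qed.

Lemma imset_comps (V W : finType) (f : V -> W) (e : rel V) (e' : rel W) :
  bijective f -> (forall x y, e' (f x) (f y) = e x y) ->
  forall C : {set V}, (f @: C \in comps e') = (C \in comps e).
Proof.
move=> fbij ef C; have [g fK gK] := fbij.
have imE x : (f @: [set y | connect e x y] = [set y | connect e' (f x) y])%SET.
  apply/setP => w; rewrite -(gK w) mem_imset; last exact: can_inj fK.
  by rewrite !inE (connect_iso fbij ef).
apply/imsetP/imsetP => -[x _ Cx].
  exists (g x) => //; apply: (imset_inj (can_inj fK)).
  by rewrite imE gK.
by exists (f x) => //; rewrite Cx imE.
Qed.

Lemma card_comps (V W : finType) (f : V -> W) (e : rel V) (e' : rel W) k :
  bijective f -> (forall x y, e' (f x) (f y) = e x y) ->
  #|[set C in comps e' | #|C| == k]%SET| = #|[set C in comps e | #|C| == k]%SET|.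
Proof.
move=> fbij ef; have finj := bij_inj fbij.
rewrite -(card_imset _ (imset_inj finj)); congr #|pred_of_set _|.
apply/setP => D; have [g fK gK] := fbij.
have -> : D = f @: (g @: D).
  by rewrite -imset_comp (eq_imset _ (g := id)) ?imset_id// => w; exact: gK.
rewrite mem_imset; last exact: imset_inj.
by rewrite !inE (imset_comps fbij ef) card_imset.
Qed.

Lemma comps_eq (V : finType) (e : rel V) (C D : {set V}) : symmetric e ->
  C \in comps e -> D \in comps e -> forall x, x \in C -> x \in D -> C = D.
Proof.
move=> /sym_connect_sym es /imsetP[a _ ->] /imsetP[b _ ->] x; rewrite !inE => ax bx.
apply/setP => y; rewrite !inE (same_connect es ax).
by rewrite (same_connect es bx).
Qed.

(** A path of the large graph issued from the image of [f] cannot leave it, either because a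
    component is closed under adjacency or because no edge goes out; connectivity can thus be tested
    inside [V]. *)
Lemma codom_comps (V W : finType) (f : V -> W) (e : rel V) (e' : rel W) :
  injective f -> symmetric e' -> (forall x y, e' (f x) (f y) = e x y) ->
  (f @: [set: V]%SET \in comps e') =
  [&& (0 < #|V|)%N, [forall x, forall y, connect e x y] &
      [forall x, forall w, (w \notin f @: [set: V]%SET) ==> ~~ e' (f x) w]].
Proof.
move=> finj e's ef; apply/idP/and3P => [/imsetP[w _ fVw]|[V0 /forallP co /forallP iso]].
  have conE u : (u \in f @: [set: V]%SET) = connect e' w u by rewrite fVw inE.
  have [x0 _ wE] : exists2 x0, x0 \in [set: V]%SET & w = f x0.
    by apply/imsetP; rewrite conE connect0.
  split.
  - by apply/card_gt0P; exists x0.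
  - apply/forallP => x; apply/forallP => y.
    have /connectP[p] : connect e' (f x) (f y).
      apply: (@connect_trans _ _ w).
        by rewrite (sym_connect_sym e's) -conE imset_f.
      by rewrite -conE imset_f.
    elim: p x => [|u p IH] x /=; first by move=> _ /finj ->; exact: connect0.
    move=> /andP[xu up] yE.
    have [z _ uE] : exists2 z, z \in [set: V]%SET & u = f z.
      apply/imsetP; rewrite conE; apply: (@connect_trans _ _ (f x)).
        by rewrite -conE imset_f.
      exact: connect1.
    rewrite uE ef in xu; rewrite uE in up yE.
    exact: connect_trans (connect1 xu) (IH _ up yE).
  - apply/forallP => x; apply/forallP => u; apply/implyP; apply: contraNN => xu.
    rewrite conE; apply: (@connect_trans _ _ (f x)).
      by rewrite -conE imset_f.
    exact: connect1.
have /card_gt0P[x0 _] := V0.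
apply/imsetP; exists (f x0) => //; apply/setP => u; rewrite inE.
apply/imsetP/idP => [[y _ ->]|].
  apply: connect_homo; last by have /forallP := co x0; exact.
  by move=> a b; rewrite ef.
move=> /connectP[p]; elim: p x0 => [|v p IH] x /=.
  by move=> _ ->; exists x.
move=> /andP[xv vp] uE.
have [/imsetP[z _ vE]|vV] := boolP (v \in f @: [set: V]%SET).
  by apply: (IH z); rewrite -vE.
by have /forallP/(_ v)/implyP/(_ vV) := iso x; rewrite xv.
Qed.

End graph_components.

Section index_graph.
Context {R : realType} {d : nat}.
Implicit Types (x y : nat -> 'rV[R]_d) (r : R).

(** For [0 <= r], two indices carrying the same point are adjacent vertices here but a single vertex
    of [G(X, r)]; the two graphs agree on sequences with distinct terms. *)
Definition adj m r x : rel 'I_m :=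
  fun i l => (i != l) && (enorm (x i - x l) <= r).

Lemma enormN (u : 'rV[R]_d) : enorm (- u) = enorm u.
Proof.
by rewrite /enorm; congr Num.sqrt; apply: eq_bigr => i _; rewrite mxE sqrrN.
Qed.

Lemma enormB (u v : 'rV[R]_d) : enorm (u - v) = enorm (v - u).
Proof. by rewrite -enormN opprB. Qed.

Lemma adj_sym m r x : symmetric (adj r x : rel 'I_m).
Proof. by move=> i l; rewrite /adj eq_sym enormB. Qed.

Definition clustered k r x :=
  [forall i : 'I_k, forall l : 'I_k, connect (adj r x) i l].

Definition isolated j m r x :=
  [forall i : 'I_j, forall l : 'I_m, (j <= l)%N ==> (r < enorm (x i - x l))].

Definition points m x : {fset 'rV[R]_d} := [fset x i | i in iota 0 m]%fset.

Lemma pointsP m x (i : 'I_m) : x i \in points m x.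
Proof. by apply/imfsetP; exists (i : nat) => //=; rewrite mem_iota/=. Qed.

Lemma num_components_index k r m x : {in `I_m &, injective x} ->
  num_components k r (points m x) =
  #|[set C in comps (adj r x : rel 'I_m) | #|C| == k]%SET|.
Proof.
move=> xinj; pose f (i : 'I_m) : points m x := [` pointsP x i]%fset.
have finj : injective f.
  move=> i j /(congr1 val)/= /xinj h; apply/val_inj/h;
  by rewrite inE/= ltn_ord.
apply: (@card_comps _ _ f).
  apply: inj_card_bij => //; rewrite card_ord -cardfE.
  apply: leq_trans (leq_imfset_card _ _ _) _ => /=.
  by rewrite (leq_trans (size_undup _))// size_iota.
by move=> i l; rewrite /geo_adj /adj (inj_eq finj).
Qed.

(** No injectivity here: the count depends on finitely many comparisons of distances, coincidences
    included. This gives measurability everywhere and not just almost everywhere. *)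
Lemma num_components_eq k r m x y :
  (forall i l : 'I_m, (x i == x l) = (y i == y l)) ->
  (forall i l : 'I_m, (enorm (x i - x l) <= r) = (enorm (y i - y l) <= r)) ->
  num_components k r (points m x) = num_components k r (points m y).
Proof.
move=> eqE nearE.
have idx z (u : points m z) : exists i : 'I_m, val u = z i.
  have /imfsetP[i/=] := valP u; rewrite mem_iota/= add0n => im uE.
  by exists (Ordinal im).
have /choice[ix ixE] := idx x; have /choice[iy iyE] := idx y.
symmetry; apply: (@card_comps _ _ (fun u => [` pointsP y (ix u)]%fset)).
  exists (fun v => [` pointsP x (iy v)]%fset) => u; apply/val_inj => /=.
    apply/esym; rewrite ixE; apply/eqP; rewrite eqE.
    by rewrite -iyE.
  apply/esym; rewrite iyE; apply/eqP; rewrite -eqE.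
  by rewrite -ixE.
move=> u v; rewrite /geo_adj/= -nearE -!ixE; congr (~~ _ && _).
by rewrite -(inj_eq val_inj)/= -eqE -!ixE (inj_eq val_inj).
Qed.

Lemma prefix_comps k m r x : (0 < k <= m)%N ->
  ([set i : 'I_m | (i < k)%N]%SET \in comps (adj r x : rel 'I_m)) =
  clustered k r x && isolated k m r x.
Proof.
move=> /andP[k0 km]; pose f := widen_ord km.
have finj : injective f by move=> i j /(congr1 val)/= /val_inj.
have fE : [set i : 'I_m | (i < k)%N]%SET = (f @: [set: 'I_k]%SET)%SET.
  apply/setP => i; rewrite inE; apply/idP/imsetP => [ik|[j _ ->]//=].
  by exists (Ordinal ik) => //; exact/val_inj.
rewrite fE (@codom_comps _ _ _ (adj r x : rel 'I_k)) ?card_ord ?k0 -?fE//=.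
- congr (_ && _); apply: eq_forallb => i; apply: eq_forallb => l.
  rewrite inE -leqNgt; case: leqP => //= kl.
  rewrite /adj negb_and negbK -ltNge/= (_ : (_ == l) = false)//.
  by apply/negP => /eqP/(congr1 val)/= ilE; rewrite -ilE leqNgt ltn_ord in kl.
- exact: adj_sym.
Qed.

Definition shift_seq (T : Type) k (x : nat -> T) : nat -> T := fun i => x (k + i)%N.

(** The isolation conditions of the two blocks are regrouped: the blocks are far from each other,
    and their union is far from all later points. The last condition alone involves the later
    points, which can then be integrated out. *)
Lemma two_comps k m r x : (0 < k)%N -> (k + k <= m)%N ->
  ([set i : 'I_m | (i < k)%N]%SET \in comps (adj r x : rel 'I_m)) &&
  ([set i : 'I_m | (k <= i < k + k)%N]%SET \in comps (adj r x : rel 'I_m)) =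
  [&& clustered k r x, clustered k r (shift_seq k x),
      isolated k (k + k) r x & isolated (k + k) m r x].
Proof.
move=> k0 kkm; have km : (k <= m)%N := leq_trans (leq_addl k k) kkm.
rewrite prefix_comps ?k0//.
have gP (i : 'I_k) : (k + i < m)%N by rewrite (leq_trans _ kkm)// ltn_add2l.
pose g (i : 'I_k) := Ordinal (gP i).
have ginj : injective g by move=> i j /(congr1 val)/= /addnI/val_inj.
have gE : [set i : 'I_m | (k <= i < k + k)%N]%SET = (g @: [set: 'I_k]%SET)%SET.
  apply/setP => i; rewrite inE; apply/idP/imsetP => [/andP[ki ikk]|[j _ ->]/=].
    have ik : (i - k < k)%N by rewrite ltn_subLR.
    by exists (Ordinal ik) => //; apply/val_inj; rewrite /= subnKC.
  by rewrite leq_addr ltn_add2l ltn_ord.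
rewrite gE (@codom_comps _ _ _ (adj r (shift_seq k x) : rel 'I_k))//; last 2 first.
- exact: adj_sym.
- move=> i l; rewrite /adj /shift_seq/=; congr (~~ _ && _).
  by rewrite -!(inj_eq val_inj)/= eqn_add2l.
rewrite card_ord k0/= -/(clustered _ _ _) -gE.
rewrite -!andbA; congr (_ && _); rewrite andbCA; congr (_ && _).
apply/andP/andP => -[/forallP h1 /forallP h2]; split.
- apply/forallP => i; apply/forallP => l; apply/implyP => kl.
  have lm : (l < m)%N := leq_trans (ltn_ord l) kkm.
  by have /forallP/(_ (Ordinal lm))/implyP := h1 i; exact.
- apply/forallP => i; apply/forallP => l; apply/implyP => kkl.
  have [ik|ki] := ltnP i k.
    have /forallP/(_ l)/implyP := h1 (Ordinal ik); apply => /=.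
    exact: leq_trans (leq_addl k k) kkl.
  have ikk : (i - k < k)%N by rewrite ltn_subLR.
  have /forallP/(_ l) := h2 (Ordinal ikk).
  rewrite inE negb_and -leqNgt -ltnNge kkl orbT /= /adj negb_and negbK -ltNge.
  rewrite /= subnKC// => /orP[/eqP/(congr1 val)/=|//].
  by rewrite subnKC// => ilE; move: kkl; rewrite -ilE leqNgt ltn_ord.
- apply/forallP => i; apply/forallP => l; apply/implyP => kl.
  have [lkk|kkl] := ltnP l (k + k).
    by have /forallP/(_ (Ordinal lkk))/implyP := h1 i; exact.
  have ikk : (i < k + k)%N := leq_trans (ltn_ord i) (leq_addl k k).
  by have /forallP/(_ l)/implyP := h2 (Ordinal ikk); exact.
- apply/forallP => i; apply/forallP => l; apply/implyP.
  rewrite inE negb_and -leqNgt -ltnNge => /orP[lk|kkl]; rewrite /adj negb_and -ltNge;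
    apply/orP; right => /=.
    have /forallP := h1 (Ordinal lk).
    have ikk : (k + i < k + k)%N by rewrite ltn_add2l.
    by move=> /(_ (Ordinal ikk))/implyP/=; rewrite leq_addr enormB; exact.
  have ikk : (k + i < k + k)%N by rewrite ltn_add2l.
  by have /forallP/(_ l)/implyP := h2 (Ordinal ikk); exact.
Qed.

End index_graph.

(** * Moving disjoint index sets to consecutive blocks *)

Section extend_perm.
Variable m : nat.

(** The extension by the identity acts on infinite sequences, as [reindex_seq] requires. *)
Definition perm_nat (s : {perm 'I_m}) (i : nat) : nat :=
  if insub i is Some j then s j : nat else i.

Lemma perm_nat_ord s (i : 'I_m) : perm_nat s i = s i.
Proof. by rewrite /perm_nat insubT ?ltn_ord// => p; congr (nat_of_ord (s _));
  exact/val_inj. Qed.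

Lemma perm_natK s : cancel (perm_nat s) (perm_nat s^-1%g).
Proof.
move=> i; have [im|im] := ltnP i m.
  by rewrite -[i]/(nat_of_ord (Ordinal im)) !perm_nat_ord permK.
by rewrite /perm_nat !insubF// ltnNge im.
Qed.

Lemma block_perm (A B : {set 'I_m}) : (A :&: B)%SET = finset.set0 ->
  exists s : {perm 'I_m},
    s @: [set i : 'I_m | (i < #|A|)%N]%SET = A /\
    s @: [set i : 'I_m | (#|A| <= i < #|A| + #|B|)%N]%SET = B.
Proof.
move=> AB0; have AB : fintype.disjoint (mem A) (mem B) by rewrite -setI_eq0 AB0.
(* The permutation reads this list, which enumerates all indices, [A] first and then [B]. *)
pose t := enum A ++ enum B ++ enum (~: (A :|: B))%SET.
have tu : uniq t.
  rewrite !cat_uniq !enum_uniq/= andbT; apply/andP; split.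
    apply/hasPn => i; rewrite mem_cat !mem_enum !inE => /orP[iB|].
      by apply: contraL iB => iA; rewrite (disjointFr AB).
    by rewrite negb_or => /andP[].
  apply/hasPn => i; rewrite !mem_enum !inE.
  by rewrite negb_or => /andP[].
have ts : size t = m.
  apply/eqP; rewrite -[X in _ == X]card_ord -(card_uniqP tu).
  apply/eqP/eq_card => i; rewrite !inE !mem_cat !mem_enum !inE.
  by case: (i \in A) => //=; case: (i \in B).
have nti (i : 'I_m) : (i < size t)%N by rewrite ts.
pose f (i : 'I_m) : 'I_m := nth i t i.
have fE (i j : 'I_m) : f i = nth j t i by exact: set_nth_default.
have finj : injective f.
  move=> i j; rewrite (fE i j) => /eqP.
  by rewrite /f nth_uniq// => /eqP/val_inj.
have cA : size (enum A) = #|A| by rewrite cardE.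
have cB : size (enum B) = #|B| by rewrite cardE.
exists (perm finj).
have sub (C D : {set 'I_m}) : #|C| = #|D| ->
    (forall i, i \in C -> f i \in D) -> perm finj @: C = D.
  move=> cCD CD; apply/eqP; rewrite eqEcard card_imset; last exact: perm_inj.
  rewrite cCD leqnn andbT; apply/fintype.subsetP => _ /imsetP[i iC ->].
  by rewrite permE; exact: CD.
have cAB : (#|A| + #|B| <= m)%N.
  have := max_card (mem (A :|: B)%SET); rewrite card_ord cardsU.
  by rewrite AB0 cards0 subn0.
have cI a b : (a <= b <= m)%N -> #|[set i : 'I_m | (a <= i < b)%N]%SET| = (b - a)%N.
  move=> /andP[ab bm].
  have hP (i : 'I_(b - a)) : (a + i < m)%N.
    by rewrite (leq_trans _ bm)// -ltn_subRL ltn_ord.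
  pose h (i : 'I_(b - a)) := Ordinal (hP i).
  have hinj : injective h by move=> i j /(congr1 val)/= /addnI/val_inj.
  rewrite -[RHS]card_ord -cardsT -(card_imset _ hinj); congr #|pred_of_set _|.
  apply/setP => i; rewrite inE; apply/idP/imsetP => [/andP[ai ib]|[j _ ->]/=].
    have ia : (i - a < b - a)%N by rewrite ltn_sub2r// (leq_ltn_trans ai).
    by exists (Ordinal ia) => //; apply/val_inj; rewrite /= subnKC.
  by rewrite leq_addr -ltn_subRL ltn_ord.
split; apply: sub.
- rewrite -[RHS]subn0 -cI ?(leq_trans (leq_addr _ _) cAB)//.
- move=> i; rewrite inE => iA; rewrite /f nth_cat cA iA -mem_enum mem_nth// cA//.
- by rewrite cI ?leq_addr// addKn.
- move=> i; rewrite inE => /andP[Ai iB].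
  rewrite /f nth_cat cA ltnNge Ai/= nth_cat cB ltn_subLR// iB -mem_enum mem_nth//.
  by rewrite cB ltn_subLR.
Qed.

Lemma comps_perm (R : realType) (d : nat) (x : nat -> 'rV[R]_d) r
    (s : {perm 'I_m}) (C : {set 'I_m}) :
  (s @: C \in comps (adj r x : rel 'I_m)) =
  (C \in comps (adj r (x \o perm_nat s) : rel 'I_m)).
Proof.
apply: imset_comps; first by exists (s^-1%g) => i; rewrite ?permK ?permKV.
by move=> i l; rewrite /adj /= !perm_nat_ord (inj_eq perm_inj).
Qed.

End extend_perm.

(** * Integrals over independent sequences *)

Section measurable_bool.
Context {disp : measure_display} {S : measurableType disp}.

(** [Q] is arbitrary: a preimage is a finite union, over the truth tables, of finite intersections.
    Connectivity and component counts need no finer analysis. *)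
Lemma measurable_fun_finite d' (S' : measurableType d') (I : finType)
    (g : I -> S -> bool) (Q : (I -> bool) -> S') :
  (forall i, measurable_fun [set: S] (g i)) ->
  measurable_fun [set: S] (fun x => Q (g ^~ x)).
Proof.
move=> mg _ Y _; rewrite setTI.
rewrite [X in measurable X](_ : _ = \bigcup_(D in [set D : {ffun I -> bool} | Y (Q D)])
   \bigcap_(i in [set: I]) (g i @^-1` [set D i])); last first.
  apply/seteqP; split => [x Yx|x [D YD Dx]] /=.
    exists [ffun i => g i x] => /=; last by move=> i _; rewrite ffunE.
    suff -> : [ffun i => g i x] = g ^~ x :> (I -> bool) by [].
    by apply/funext => i; rewrite ffunE.
  suff -> : g ^~ x = D by [].
  by apply/funext => i; exact: Dx.
apply: fin_bigcup_measurable; first exact: finite_finset.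
move=> D _; apply: fin_bigcap_measurable; first exact: finite_finset.
by move=> i _; rewrite -[X in measurable X]setTI; exact: mg.
Qed.

Lemma measurable_forallb (I : finType) (g : I -> S -> bool) :
  (forall i, measurable_fun [set: S] (g i)) ->
  measurable_fun [set: S] (fun x => [forall i, g i x]).
Proof. exact: (measurable_fun_finite (fun h : I -> bool => [forall i, h i])). Qed.

Lemma measurable_implyb (b : bool) (g : S -> bool) :
  measurable_fun [set: S] g -> measurable_fun [set: S] (fun x => b ==> g x).
Proof. by case: b. Qed.

Lemma measurable_set_bool (g : S -> bool) :
  measurable_fun [set: S] g -> measurable [set x | g x].
Proof.
move=> mg; have := mg measurableT [set true]; rewrite setTI; exact.
Qed.

Lemma measurable_bool_EFin (R : realType) (g : S -> bool) :
  measurable_fun [set: S] g ->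
  measurable_fun [set: S] (fun x => (g x)%:R%:E : \bar R).
Proof.
move=> mg; apply/measurable_EFinP.
apply: (@measurableT_comp _ _ _ _ _ _ (fun b : bool => b%:R : R)) => //.
Qed.

Lemma measurable_bool_real (R : realType) (g : S -> bool) :
  measurable_fun [set: S] g -> measurable_fun [set: S] (fun x => (g x)%:R : R).
Proof. by move=> mg; apply/measurable_EFinP; exact: measurable_bool_EFin. Qed.

Lemma integral_bool (R : realType) (mu : {measure set S -> \bar R}) (g : S -> bool) :
  measurable_fun [set: S] g ->
  (\int[mu]_x (g x)%:R%:E = mu [set x | g x])%E.
Proof.
move=> mg; rewrite -[X in mu X]setIT -integral_indic//; last exact: measurable_set_bool.
apply: eq_integral => x _; rewrite indicE; congr (_%:R%:E).
by apply/esym; congr nat_of_bool; apply/idP/idP; rewrite inE.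
Qed.

End measurable_bool.

Section conditional_product.
Context {disp : measure_display} {T : measurableType disp} {R : realType}.
Variables (nu : probability T R) (mu : probability (@seqspace _ T) R).
Hypothesis mu_iid : iid_law nu mu.
Local Open Scope ereal_scope.
Local Notation X := (@seqspace _ T).

Definition prob_of (W : X -> T -> bool) (x : X) : R := fine (nu [set z | W x z]).

Section section_prob.
Variable W : X -> T -> bool.
Hypothesis mW : measurable_fun [set: X * T] (fun p => W p.1 p.2).

Lemma measurable_section x : measurable [set z | W x z].
Proof.
apply: measurable_set_bool.
exact: (measurableT_comp mW (pair1_measurable x)).
Qed.

Lemma prob_ofE x : (prob_of W x)%:E = nu [set z | W x z].
Proof. by rewrite fineK// fin_num_measure//; exact: measurable_section. Qed.

Lemma prob_of_ge0 x : (0 <= prob_of W x)%R.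
Proof. by rewrite fine_ge0. Qed.

Lemma prob_of_le1 x : (prob_of W x <= 1)%R.
Proof. by rewrite -lee_fin prob_ofE probability_le1//; exact: measurable_section. Qed.

Lemma measurable_prob_of : measurable_fun [set: X] (prob_of W).
Proof.
apply/measurable_EFinP.
rewrite (_ : _ \o _ = nu \o xsection [set p | W p.1 p.2]).
  by apply: measurable_fun_xsection; exact: measurable_set_bool.
apply/funext => x /=; rewrite prob_ofE; congr (nu _).
by apply/seteqP; split => z /=; rewrite /xsection/= ?inE.
Qed.

End section_prob.

Lemma measurable_all_later (W : X -> T -> bool) j m :
  measurable_fun [set: X * T] (fun p => W p.1 p.2) ->
  measurable_fun [set: X] (fun x => [forall l : 'I_m, (j <= l)%N ==> W x (x l)]).
Proof.
move=> mW; apply: measurable_forallb => l; apply: measurable_implyb.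
apply: (measurableT_comp mW (g := fun x : X => (x, x l))).
by apply: measurable_fun_pair => //; exact: measurable_seq_coord.
Qed.

(** Given the first [j] points, on which alone [phi] and [W] depend, the [m - j] others are
    independent and each passes the test with probability [prob_of W x]. *)
Lemma integral_all_later (W : X -> T -> bool) j m (phi : X -> R) :
  (j <= m)%N ->
  measurable_fun [set: X * T] (fun p => W p.1 p.2) ->
  (forall x y, (forall i, (i < j)%N -> x i = y i) -> W x = W y) ->
  measurable_fun [set: X] phi -> (forall x, (0 <= phi x)%R) ->
  (forall x y, (forall i, (i < j)%N -> x i = y i) -> phi x = phi y) ->
  \int[mu]_x (phi x * [forall l : 'I_m, (j <= l)%N ==> W x (x l)]%:R)%:E =
  \int[mu]_x (phi x * prob_of W x ^+ (m - j))%:E.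
Proof.
move=> jm mW Wj mphi phi0 phij.
have mI := measurable_all_later j m mW.
rewrite (integral_concat mu_iid j); last 2 first.
- apply/measurable_EFinP; apply: measurable_funM => //.
  exact/measurable_EFinP/measurable_bool_EFin.
- by move=> x; rewrite lee_fin mulr_ge0.
apply: eq_integral => x _.
have cj y i : (i < j)%N -> concat_seq j (x, y) i = x i by rewrite /concat_seq => ->.
pose B (i : nat) : set T := [set z | W x z].
transitivity (\int[mu]_y ((phi x)%:E *
  ([forall i : 'I_(m - j), W x (y i)] : bool)%:R%:E)).
  apply: eq_integral => y _; rewrite (phij _ x) ?(Wj _ x) -?EFinM; try exact: cj.
  congr (_ * _%:R)%:E; congr nat_of_bool.
  apply/forallP/forallP => h.
    move=> i; have im : (j + i < m)%N by rewrite -ltn_subRL.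
    have := h (Ordinal im); rewrite /= leq_addr /= /concat_seq.
    by rewrite ltnNge leq_addr/= addKn.
  move=> l; apply/implyP => jl.
  have lm : (l - j < m - j)%N by rewrite ltn_sub2r// (leq_ltn_trans jl).
  by have := h (Ordinal lm); rewrite /= /concat_seq ltnNge jl.
have mWx : measurable_fun [set: X] (fun y : X => [forall i : 'I_(m - j), W x (y i)]).
  apply: measurable_forallb => i.
  apply: (@measurableT_comp _ _ _ _ _ _ (W x) _ (fun y : X => y i)).
    exact: (measurableT_comp mW (pair1_measurable x)).
  exact: measurable_seq_coord.
rewrite ge0_integralZl//; last 2 first.
- exact: (measurable_bool_EFin mWx).
- by rewrite lee_fin.
rewrite integral_bool// EFinM; congr (_ * _).
rewrite (_ : [set x | _] = box (m - j) B); last first.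
  apply/seteqP; split => y /=.
    by move=> /forallP h i im; exact: (h (Ordinal im)).
  by move=> h; apply/forallP => i; exact: h.
rewrite (iid_law_box _ mu_iid); last by move=> i; exact: measurable_section.
rewrite (eq_bigr (fun=> (prob_of W x)%:E)); last by move=> i _; rewrite prob_ofE.
by rewrite big_const_ord iter_mule mule1 EFin_expe.
Qed.

End conditional_product.

Section poisson_mixture.
Context {R : realType}.
Local Open Scope ereal_scope.
Variables (lam : R) (j : nat) (kap : R) (c : nat -> R).
Hypotheses (lam0 : (0 < lam)%R) (c_lt : forall m, (m < j)%N -> c m = 0%R)
  (c_ge0 : forall m, (0 <= c m)%R)
  (cE : forall m, (j <= m)%N -> (c m * (m - j)`!%:R = kap * m`!%:R)%R).

(** The coefficient [c m] turns [1 / m!] into [kap / (m - j)!], so the series shifted by [j] is the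
    exponential series at [lam * t]. It will be ['C(m, k)], or the number of disjoint pairs of
    [k]-subsets. *)
Lemma poisson_series (t : R) : (0 <= t)%R ->
  \sum_(m <oo) (poisson_pmf lam m * c m * t ^+ (m - j))%:E =
  (kap * lam ^+ j * expR (- (lam * (1 - t))))%:E.
Proof.
move=> t0.
have pos m : 0 <= (poisson_pmf lam m * c m * t ^+ (m - j))%:E.
  by rewrite lee_fin !mulr_ge0 ?poisson_pmf_ge0 ?exprn_ge0.
rewrite (nneseries_split 0 j)//.
rewrite add0n big1_seq ?add0e; last first.
  by move=> i /=; rewrite mem_index_iota => /c_lt ->; rewrite mulr0 mul0r.
rewrite -nneseries_addn//.
have -> : (fun n => \sum_(0 <= i < n)
    (poisson_pmf lam (i + j) * c (i + j)%N * t ^+ (i + j - j))%:E) =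
  EFin \o (fun n => (kap * lam ^+ j * expR (- lam)) * series (exp_coeff (lam * t)) n)%R.
  apply/funext => n /=; rewrite sumEFin; congr EFin.
  rewrite /series/= mulr_sumr; apply: eq_bigr => i _.
  have := cE (leq_addl i j); rewrite addnK /poisson_pmf lam0 /exp_coeff/= => ci.
  have f0 q : (q`!%:R != 0 :> R)%R by rewrite pnatr_eq0 -lt0n fact_gt0.
  have -> : c (i + j)%N = (kap * (i + j)`!%:R / i`!%:R)%R by rewrite -ci mulfK.
  rewrite exprD exprMn; field; rewrite ?f0//.
have cv : (fun n => kap * lam ^+ j * expR (- lam) * series (exp_coeff (lam * t)) n)%R
    @ \oo --> (kap * lam ^+ j * expR (- lam) * expR (lam * t))%R.
  apply: cvgM; first exact: cvg_cst.
  exact: is_cvg_series_exp_coeff.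
rewrite EFin_lim; last by apply/cvg_ex; eexists; exact: cv.
rewrite (cvg_lim _ cv)// -mulrA -expRD; congr ((_ * expR _)%:E)%R.
by ring.
Qed.

Lemma poisson_mixture d (X : measurableType d) (mu : {measure set X -> \bar R})
    (phi t : X -> R) :
  measurable_fun setT phi -> measurable_fun setT t ->
  (forall x, (0 <= phi x)%R) -> (forall x, (0 <= t x)%R) ->
  \sum_(m <oo) (poisson_pmf lam m * c m)%:E * \int[mu]_x (phi x * t x ^+ (m - j))%:E =
  (kap * lam ^+ j)%:E * \int[mu]_x (phi x * expR (- (lam * (1 - t x))))%:E.
Proof.
move=> mphi mt phi0 t0.
have kap0 : (0 <= kap)%R.
  have := cE (leqnn j); rewrite subnn fact0 mulr1 => cjE.
  by rewrite -(pmulr_lge0 kap (_ : 0 < j`!%:R)%R) -?cjE// ltr0n fact_gt0.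
have mf m : measurable_fun setT (fun x => (phi x * t x ^+ m)%:E).
  by apply/measurable_EFinP; apply: measurable_funM => //; exact: measurable_funX.
rewrite -ge0_integralZl//; last 3 first.
- apply/measurable_EFinP; apply: measurable_funM => //.
  apply: measurableT_comp => //; apply: measurable_funN.
  by apply: measurable_funM => //; exact: measurable_funB.
- by move=> x _; rewrite lee_fin mulr_ge0 ?expR_ge0.
- by rewrite lee_fin; apply: mulr_ge0 => //; exact/exprn_ge0/ltW.
transitivity (\sum_(m <oo) \int[mu]_x
    ((poisson_pmf lam m * c m)%:E * (phi x * t x ^+ (m - j))%:E)).
  apply: eq_eseriesr => m _; rewrite ge0_integralZl//.
    by move=> x _; rewrite lee_fin mulr_ge0 ?exprn_ge0.
  by rewrite lee_fin mulr_ge0 ?poisson_pmf_ge0.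
rewrite -integral_nneseries//; last 2 first.
- by move=> m; exact: emeasurable_funM.
- by move=> m x _; rewrite -EFinM lee_fin !mulr_ge0 ?exprn_ge0 ?poisson_pmf_ge0.
apply: eq_integral => x _.
rewrite -EFinM mulrCA EFinM -poisson_series//.
rewrite -nneseriesZl; last first.
  by move=> m _; rewrite lee_fin !mulr_ge0 ?exprn_ge0 ?poisson_pmf_ge0.
by apply: eq_eseriesr => m _; rewrite -!EFinM mulrCA.
Qed.

End poisson_mixture.

(** * Moments of the number of clusters *)

Section count_clusters.
Variables (m k : nat).
Local Notation V := {set 'I_m}.

Definition disjoint_pairs : {set V * V} :=
  [set p : V * V | [&& #|p.1| == k, #|p.2| == k & (p.1 :&: p.2 == finset.set0)%SET]]%SET.

Lemma card_disjoint_pairs : #|disjoint_pairs| = ('C(m, k) * 'C(m - k, k))%N.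
Proof.
rewrite -sum1_card (eq_bigl (fun p : V * V => (#|p.1| == k) &&
    ((p.2 \subset ~: p.1)%SET && (#|p.2| == k)))); last first.
  move=> [I J]; rewrite inE/= -finset.disjoints_subset -finset.setI_eq0 finset.setIC.
  by congr (_ && _); rewrite andbC.
rewrite -(pair_big_dep (fun I : V => #|I| == k)
  (fun I J : V => (J \subset ~: I)%SET && (#|J| == k)) (fun _ _ => 1%N))/=.
rewrite (eq_bigr (fun=> 'C(m - k, k))) => [|I /eqP Ik].
  by rewrite sum_nat_const -cardsE card_draws card_ord.
by rewrite sum1_card -cardsE cards_draws cardsCs finset.setCK card_ord Ik.
Qed.

Lemma card_sqr (W : finType) (K : {set W}) : (#|K| ^ 2 =
  #|K| + #|[set p : W * W | [&& p.1 \in K, p.2 \in K & p.1 != p.2]]%SET|)%N.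
Proof.
rewrite -mulnn -cardsX -(cardsID [set p : W * W | p.1 == p.2]%SET (finset.setX K K)).
congr (_ + _)%N.
  rewrite -(card_imset K (f := fun w => (w, w))); last by move=> a b [].
  apply: eq_card => -[a b]; rewrite !inE/=; apply/idP/imsetP => [|[c cK [-> ->]]].
    by move=> /andP[/andP[aK _] /eqP ab]; exists a => //; rewrite -ab.
  by rewrite cK eqxx.
apply: eq_card => -[a b]; rewrite !inE/=.
by rewrite andbC andbA.
Qed.

(** Equal pairs give the count; distinct components are disjoint. Conversely a disjoint pair is a
    pair of distinct sets, since [0 < k] excludes two copies of the empty set. *)
Lemma sqr_card_comps (e : rel 'I_m) : symmetric e -> (0 < k)%N ->
  (#|[set C in comps e | #|C| == k]%SET| ^ 2 =
   #|[set C in comps e | #|C| == k]%SET| +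
   \sum_(p in disjoint_pairs) ((p.1 \in comps e) && (p.2 \in comps e)))%N.
Proof.
move=> es k0; rewrite card_sqr; congr (_ + _)%N.
rewrite -big_mkcondr/= sum1_card; apply: eq_card => -[I J]; rewrite [RHS]/in_mem/= !inE/=.
apply/idP/idP.
  move=> /and3P[/andP[Ie Ik] /andP[Je Jk] IJ].
  rewrite Ie Je Ik Jk /= andbT; apply/negPn/negP => /finset.set0Pn[i].
  rewrite inE => /andP[iI iJ]; move/eqP: IJ; apply.
  exact: comps_eq es Ie Je i iI iJ.
move=> /andP[/and3P[Ik Jk IJ0] /andP[Ie Je]].
rewrite Ie Je Ik Jk /=; apply/eqP => IJ.
by move: IJ0 k0; rewrite IJ finset.setIid -cards_eq0 (eqP Jk) => /eqP ->.
Qed.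

End count_clusters.

(** * Measurability of the graph functionals *)

Section measurable_graph.
Context {R : realType} {d : nat}.
Local Notation T := 'rV[R]_d.

Lemma enorm_ge0 (u : T) : 0 <= enorm u.
Proof. exact: sqrtr_ge0. Qed.

Lemma enorm_eq0 (u : T) : (enorm u == 0) = (u == 0).
Proof.
have s0 : 0 <= \sum_(i < d) u 0 i ^+ 2 by apply: sumr_ge0 => i _; exact: sqr_ge0.
rewrite /enorm sqrtr_eq0; apply/idP/eqP => [s|->]; last first.
  by rewrite big1// => i _; rewrite mxE expr0n.
have /eqP : \sum_(i < d) u 0 i ^+ 2 == 0 by rewrite eq_le s.
move=> /psumr_eq0P h; apply/rowP => i; rewrite mxE.
apply/eqP; rewrite -sqrf_eq0; apply/eqP/h => // j _; exact: sqr_ge0.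
Qed.

Lemma measurable_rV_box (B : 'I_d -> set (measurableTypeR R)) : (forall i, measurable
  (B i)) ->
  measurable [set x : T | forall i, B i (x 0 i)].
Proof.
move=> mB; rewrite [X in measurable X](_ : _ = \bigcap_(i in [set: 'I_d])
  (fun x : T => x 0 i) @^-1` B i); last first.
  by apply/seteqP; split => x /= h i; [move=> _|]; exact: h.
apply: fin_bigcap_measurable => [|i _]; first exact: finite_finset.
by rewrite -[X in measurable X]setTI; apply: measurable_rV_coord => //; exact: mB.
Qed.

Lemma rV_set1_box (z : T) : [set z] = [set x | forall i, [set z 0 i] (x 0 i)].
Proof.
apply/seteqP; split => x /= => [-> //|h].
by apply/rowP => i; rewrite h.
Qed.

Lemma measurable_rV_set1 (z : T) : measurable [set z].
Proof.
rewrite rV_set1_box; apply: (measurable_rV_box (B := fun i => [set z 0 i])) => i.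
exact: measurable_set1.
Qed.

Lemma measurable_dist d1 (S : measurableType d1) (g h : S -> T) :
  measurable_fun [set: S] g -> measurable_fun [set: S] h ->
  measurable_fun [set: S] (fun s => enorm (g s - h s)).
Proof.
move=> mg mh; apply: (@measurableT_comp _ _ _ _ _ _ (@Num.sqrt R)).
  by apply: continuous_measurable_fun; exact: sqrt_continuous.
apply: measurable_sum => i; apply: measurable_funX.
rewrite (_ : (fun _ => _) = (fun s => g s 0 i - h s 0 i)).
  apply: measurable_funB.
    exact: (measurableT_comp (measurable_rV_coord i) mg).
  exact: (measurableT_comp (measurable_rV_coord i) mh).
by apply/funext => s; rewrite !mxE.
Qed.

Lemma measurable_coord_dist i l :
  measurable_fun setT (fun x : @seqspace _ T => enorm (x i - x l)).
Proof. by apply: measurable_dist; exact: measurable_seq_coord. Qed.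

Lemma measurable_coord_le r i l :
  measurable_fun setT (fun x : @seqspace _ T => enorm (x i - x l) <= r).
Proof. by apply: measurable_fun_ler => //; exact: measurable_coord_dist. Qed.

Lemma coord_eqE (x : nat -> T) i l : (x i == x l) = (enorm (x i - x l) <= 0).
Proof. by rewrite -(subr_eq0 (x i)) -enorm_eq0 eq_le enorm_ge0 andbT. Qed.

Lemma measurable_coord_eq i l :
  measurable_fun setT (fun x : @seqspace _ T => x i == x l).
Proof.
rewrite (_ : (fun _ => _) = (fun x : @seqspace _ T => enorm (x i - x l) <= 0)).
  exact: measurable_coord_le.
by apply/funext => x; exact: coord_eqE.
Qed.

Lemma measurable_coord_gt r i l :
  measurable_fun setT (fun x : @seqspace _ T => r < enorm (x i - x l)).
Proof. by apply: measurable_fun_ltr => //; exact: measurable_coord_dist. Qed.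

Lemma measurable_adj m r (Q : rel 'I_m -> bool) :
  measurable_fun setT (fun x : @seqspace _ T => Q (adj r x)).
Proof.
apply: (@measurable_fun_finite _ _ _ _ ('I_m * 'I_m)%type
  (fun p (x : @seqspace _ T) => adj r x p.1 p.2) (fun h => Q (fun a b => h (a, b)))).
move=> [i l] /=; rewrite /adj; case: (i != l) => //=.
exact: measurable_coord_le.
Qed.

Lemma measurable_clustered k r :
  measurable_fun setT (fun x : @seqspace _ T => clustered k r x).
Proof. exact: (measurable_adj r (fun e => [forall i, forall l, connect e i l])). Qed.

Lemma measurable_clustered_shift k r :
  measurable_fun setT (fun x : @seqspace _ T => clustered k r (shift_seq k x)).
Proof.
apply: (@measurableT_comp _ _ _ (@seqspace _ T) (@seqspace _ T) bool (clustered k r)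
  setT (shift_seq k) (measurable_clustered k r)).
by apply: measurable_fun_seq => i; exact: measurable_seq_coord.
Qed.

Lemma measurable_isolated j m r :
  measurable_fun setT (fun x : @seqspace _ T => isolated j m r x).
Proof.
apply: measurable_forallb => i; apply: measurable_forallb => l.
by apply: measurable_implyb; exact: measurable_coord_gt.
Qed.

Lemma measurable_num_components k m r :
  measurable_fun setT (fun x : @seqspace _ T => num_components k r (points m x)).
Proof.
have [/= Q QE] : exists Q : (('I_m * 'I_m) * bool -> bool) -> nat,
    forall x : nat -> T, num_components k r (points m x) =
      Q (fun p => if p.2 then enorm (x p.1.1 - x p.1.2) <= 0
                  else enorm (x p.1.1 - x p.1.2) <= r).
  pose D (x : nat -> T) (p : ('I_m * 'I_m) * bool) :=
     if p.2 then enorm (x p.1.1 - x p.1.2) <= 0 else enorm (x p.1.1 - x p.1.2) <= r.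
  (* [Q] evaluates the count at any sequence realizing the pattern [h], with value [0] on
     unrealizable patterns; the choice is harmless by [num_components_eq]. *)
  pose Q h := if pselect (exists x, D x = h) is left e
              then num_components k r (points m (projT1 (cid e))) else 0%N.
  exists Q => x; rewrite /Q -/(D x); case: pselect => [e|]; last first.
    by move=> e; exfalso; apply: e; exists x.
  case: cid => y /= yx; apply: num_components_eq => i l.
    have := congr1 (@^~ ((i, l), true)) yx; rewrite /D/=.
    by rewrite -!coord_eqE.
  by have := congr1 (@^~ ((i, l), false)) yx; rewrite /D/=.
rewrite (_ : (fun _ => _) = (fun x : @seqspace _ T =>
    Q (fun p => if p.2 then enorm (x p.1.1 - x p.1.2) <= 0
                  else enorm (x p.1.1 - x p.1.2) <= r))); last first.
  by apply/funext => x; exact: QE.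
apply: (@measurable_fun_finite _ (@seqspace _ T) _ nat (('I_m * 'I_m) * bool)%type
  (fun p (x : @seqspace _ T) =>
   if p.2 then enorm (x p.1.1 - x p.1.2) <= 0 else enorm (x p.1.1 - x p.1.2) <= r) Q).
by move=> [[i l] []] /=; exact: measurable_coord_le.
Qed.

End measurable_graph.

Section cluster_counts.
Context {R : realType} {d : nat}.
Local Notation T := 'rV[R]_d.
Local Notation X := (@seqspace _ T).
Variables (nu : probability T R) (mu : probability X R).
Hypotheses (mu_iid : iid_law nu mu) (nu_diffuse : forall z, nu [set z] = 0%E).
Local Open Scope ereal_scope.

(** After concatenation at [l], the point of index [l] is the first term of the fresh sequence and
    hits the given [x i] with probability [0]. *)
Lemma coords_distinct i l : (i < l)%N -> mu [set x | x i == x l] = 0.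
Proof.
move=> il.
have mg : measurable_fun setT (fun x : X => x i == x l).
  exact: measurable_coord_eq.
rewrite -integral_bool// (integral_concat mu_iid l); last 2 first.
- exact: measurable_bool_EFin.
- by move=> x; rewrite lee_fin.
apply: integral0_eq => x _; rewrite /=.
have m0 : measurable_fun setT (fun y : X => y 0%N == x i).
  apply: (measurable_fun_bool true).
  rewrite setTI (_ : _ @^-1` _ = (fun y : X => y 0%N : T) @^-1` [set x i]).
    by rewrite -[X in measurable X]setTI; apply: measurable_seq_coord => //;
      exact: measurable_rV_set1.
  by apply/seteqP; split => y /= /eqP.
transitivity (\int[mu]_y (y 0%N == x i)%:R%:E).
  apply: eq_integral => y _; congr (nat_of_bool _)%:R%:E.
  by rewrite /concat_seq il ltnn subnn eq_sym.
rewrite integral_bool//.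
have := iid_law_box 1 mu_iid (B := fun=> [set x i]) => /(_ (fun=> measurable_rV_set1 _)).
rewrite big_ord1 nu_diffuse => <-; congr (mu _).
by apply/seteqP; split => y /= => [/eqP h [|//]|/(_ 0%N erefl) ->].
Qed.

Lemma ae_injective : {ae mu, forall x : X, injective (x : nat -> T)}.
Proof.
have H : {ae mu, forall x : X, forall i l, (i < l)%N -> x i != x l}.
  apply: ae_foralln => i; apply: ae_foralln => l.
  have [il|li] := ltnP i l; last by apply: aeW.
  exists [set x | x i == x l]; split; last 1 first.
  - by move=> x /= /not_implyP[_] /negP; rewrite negbK.
  - apply: measurable_set_bool.
    exact: measurable_coord_eq.
  - exact: coords_distinct.
apply: filterS H => x h i l xil.
have [il|li|//] := ltngtP i l.
  by have := h _ _ il; rewrite xil eqxx.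
by have := h _ _ li; rewrite xil eqxx.
Qed.

Definition outside j (r : R) (x : X) (z : T) : bool :=
  [forall i : 'I_j, r < enorm (x i - z)]%R.

Lemma measurable_outside j r :
  measurable_fun setT (fun p : X * T => outside j r p.1 p.2).
Proof.
apply: measurable_forallb => i; apply: measurable_fun_ltr => //.
apply: measurable_dist => //.
exact: (measurableT_comp (measurable_seq_coord i) (@measurable_fst _ _ X T)).
Qed.

Lemma isolatedE j m r (x : X) : isolated j m r x =
  [forall l : 'I_m, (j <= l)%N ==> outside j r x (x l)].
Proof.
apply/forallP/forallP => h l; [apply/implyP => jl|]; apply/forallP => i.
  by have /forallP/(_ l)/implyP := h i; exact.
by apply/implyP => jl; have /implyP/(_ jl)/forallP := h i; exact.
Qed.

Lemma outside_eq j r (x y : X) : (forall i, (i < j)%N -> x i = y i) ->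
  outside j r x = outside j r y.
Proof.
by move=> xy; apply/funext => z; apply: eq_forallb => i; rewrite xy.
Qed.

Lemma adj_eq j r (x y : X) : (forall i, (i < j)%N -> x i = y i) ->
  adj r x = adj r y :> rel 'I_j.
Proof. by move=> xy; apply/funext => i; apply/funext => l; rewrite /adj !xy. Qed.

Lemma clustered_eq j r (x y : X) : (forall i, (i < j)%N -> x i = y i) ->
  clustered j r x = clustered j r y.
Proof. by move=> xy; rewrite /clustered (adj_eq _ xy). Qed.

(** The part of the condition in [two_comps] that concerns the first [2k] points. *)
Definition two_clusters k r (x : X) := [&& clustered k r x,
  clustered k r (shift_seq k x) & isolated k (k + k) r x].

Lemma measurable_two_clusters k r : measurable_fun setT (two_clusters k r).
Proof.
apply: measurable_and; first exact: measurable_clustered.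
apply: measurable_and; first exact: measurable_clustered_shift.
exact: measurable_isolated.
Qed.

Lemma two_clusters_eq k r (x y : X) : (forall i, (i < k + k)%N -> x i = y i) ->
  two_clusters k r x = two_clusters k r y.
Proof.
move=> xy; rewrite /two_clusters (@clustered_eq _ _ x y); last first.
  by move=> i ik; apply: xy; exact: leq_trans ik (leq_addl _ _).
rewrite (@clustered_eq _ _ (shift_seq k x) (shift_seq k y)); last first.
  by move=> i ik; apply: xy; rewrite ltn_add2l.
congr [&& _, _ & _]; apply: eq_forallb => i; apply: eq_forallb => l.
by rewrite !xy//; exact: leq_trans (ltn_ord i) (leq_addl _ _).
Qed.

Local Notation is_comp r x I := (I \in comps (adj r x : rel 'I__)).
Local Notation count k m r x := (num_components k r (points m x)).

Lemma integral_nat (f g : X -> nat) : measurable_fun setT f ->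
  measurable_fun setT g -> {ae mu, forall x, f x = g x} ->
  \int[mu]_x (f x)%:R%:E = \int[mu]_x (g x)%:R%:E.
Proof.
have m h : measurable_fun setT h -> measurable_fun setT (fun x : X =>
  (h x : nat)%:R%:E : \bar R).
  move=> mh; apply/measurable_EFinP.
  exact: (@measurableT_comp _ _ _ _ _ _ (fun n : nat => n%:R : R)).
move=> /m mf /m mg fg; apply: ge0_ae_eq_integral => //.
by apply: filterS fg => x fgx _ /=; rewrite fgx.
Qed.

Lemma measurable_card_comps k m r : measurable_fun setT
  (fun x : X => #|[set C in comps (adj r x : rel 'I_m) | #|C| == k]%SET|).
Proof.
pose Q (e : rel 'I_m) n := #|[set C in comps e | #|C| == k]%SET| == n.
apply: (@measurable_fun_finite _ X _ nat ('I_m * 'I_m)%type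
  (fun p (x : X) => adj r x p.1 p.2)
  (fun h => #|[set C in comps (fun a b : 'I_m => h (a, b)) | #|C| == k]%SET|)).
by move=> p; exact: (measurable_adj r (fun e => e p.1 p.2)).
Qed.

Lemma ae_count k m r : {ae mu, forall x : X, count k m r x =
  #|[set C in comps (adj r x : rel 'I_m) | #|C| == k]%SET|}.
Proof.
have H := ae_injective; apply: (@filterS _ _
  (ae_filter_ringOfSetsType mu) _ _ _ H) => x xinj; apply: num_components_index.
by move=> i l _ _; exact: xinj.
Qed.

Lemma measurable_is_comp m r (I : {set 'I_m}) :
  measurable_fun setT (fun x : X => is_comp r x I).
Proof. exact: (measurable_adj r (fun e => I \in comps e)). Qed.

(** Exchangeability: it reduces every pair of index sets to two consecutive blocks. *)
Lemma prob_comps_perm m r (s : {perm 'I_m}) (I J : {set 'I_m}) :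
  mu [set x | is_comp r x (s @: I) && is_comp r x (s @: J)] =
  mu [set x | is_comp r x I && is_comp r x J].
Proof.
rewrite -[RHS](iid_law_reindex mu_iid (perm_natK s)); last first.
  apply: measurable_set_bool; apply: measurable_and; exact: measurable_is_comp.
by congr (mu _); apply/seteqP; split => x /=; rewrite -!comps_perm.
Qed.

End cluster_counts.

Lemma integral_sum_bool {disp} {S : measurableType disp} {R : realType}
    (mu : {measure set S -> \bar R}) (I : finType) (A : {pred I})
    (g : I -> S -> bool) (c : \bar R) :
  (forall i, measurable_fun setT (g i)) ->
  (forall i, i \in A -> mu [set x | g i x] = c) ->
  (\int[mu]_x (\sum_(i in A) g i x)%N%:R%:E = #|A|%:R%:E * c)%E.
Proof.
move=> mg gc.
transitivity (\int[mu]_x (\sum_(i <- enum A) (g i x)%:R%:E))%E.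
  by apply: eq_integral => x _; rewrite natr_sum -sumEFin big_enum.
rewrite ge0_integral_sum//; last first.
  by move=> i; exact: measurable_bool_EFin.
rewrite big_enum/= (eq_bigr (fun=> c)); last first.
  by move=> i iA; rewrite integral_bool// gc.
by rewrite sumr_const mule_natl.
Qed.

Section count_moments.
Context {R : realType} {d : nat}.
Local Notation T := 'rV[R]_d.
Local Notation X := (@seqspace _ T).
Variables (nu : probability T R) (mu : probability X R).
Hypotheses (mu_iid : iid_law nu mu) (nu_diffuse : forall z, nu [set z] = 0%E).
Local Open Scope ereal_scope.
Local Notation is_comp r x I := (I \in comps (adj r x : rel 'I__)).
Local Notation count k m r x := (num_components k r (points m x)).
Local Notation prefix m a := ([set i : 'I_m | (i < a)%N]%SET).
Local Notation segment m a b := ([set i : 'I_m | (a <= i < b)%N]%SET).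

Lemma prob_isolated j m r (q : X -> bool) : (j <= m)%N ->
  measurable_fun setT q ->
  (forall x y : X, (forall i, (i < j)%N -> x i = y i) -> q x = q y) ->
  mu [set x | q x && isolated j m r x] =
  \int[mu]_x ((q x)%:R * prob_of nu (outside j r) x ^+ (m - j))%:E.
Proof.
move=> jm mq qj.
rewrite -(@integral_all_later _ _ _ nu mu mu_iid (outside j r) j m (fun x => (q x)%:R))//.
- rewrite -integral_bool; last first.
    by apply: measurable_and => //; exact: measurable_isolated.
  apply: eq_integral => x _; rewrite -isolatedE; congr EFin.
  by case: (q x); case: isolated; rewrite ?(mulr0, mul0r, mulr1).
- exact: measurable_outside.
- by move=> x y xy; exact: outside_eq.
- exact/measurable_EFinP/measurable_bool_EFin.
- by move=> x y /qj ->.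
Qed.

(** By linearity the mean is a sum over the [k]-subsets of indices, all of which have the
    probability of the prefix; [prob_isolated] then integrates out the later points. *)
Lemma integral_count k m r : (0 < k)%N ->
  \int[mu]_x (count k m r x)%:R%:E = 'C(m, k)%:R%:E *
  \int[mu]_x ((clustered k r x)%:R * prob_of nu (outside k r) x ^+ (m - k))%:E.
Proof.
move=> k0; rewrite (integral_nat _ _ (ae_count mu_iid nu_diffuse k m r)); last 2 first.
- exact: measurable_num_components.
- exact: measurable_card_comps.
transitivity (\int[mu]_x
    (\sum_(I in [set I : {set 'I_m} | #|I| == k]%SET) is_comp r x I)%N%:R%:E).
  apply: eq_integral => x _; rewrite -big_mkcondr/= sum1_card.
  by congr (_%:R%:E); apply: eq_card => I; rewrite [RHS]/in_mem/= !inE/= andbC.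
(* For [m < k] the prefix does not have [k] elements, but then there is no [k]-subset either. *)
have [mk|km] := ltnP m k.
  rewrite bin_small// mul0e; apply: integral0_eq => x _.
  rewrite big1// => I; rewrite inE => /eqP Ik.
  by have := max_card (mem I); rewrite card_ord Ik leqNgt mk.
rewrite (integral_sum_bool (c := mu [set x | is_comp r x (prefix m k)])); last 2 first.
- by move=> I; exact: measurable_is_comp.
- move=> I; rewrite inE => /eqP Ik.
  have [s [sI _]] := block_perm (finset.setI0 I); rewrite Ik in sI.
  have := prob_comps_perm mu_iid r s (prefix m k) (prefix m k); rewrite sI.
  have dup J : [set x : X | is_comp r x J && is_comp r x J] = [set x | is_comp r x J].
    by apply/seteqP; split => x /=; rewrite andbb.
  by rewrite !dup.
rewrite card_draws card_ord; congr (_ * _).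
have := prob_isolated r km (measurable_clustered k r)
  (fun x y => @clustered_eq _ _ k r x y).
move=> <-; by congr (mu _); apply/seteqP; split => x /=; rewrite prefix_comps ?k0.
Qed.

(** Same computation with the ordered disjoint pairs of [sqr_card_comps], moved to the first two
    blocks of length [k]. *)
Lemma integral_count_sqr k m r : (0 < k)%N ->
  \int[mu]_x (count k m r x ^ 2)%:R%:E = \int[mu]_x (count k m r x)%:R%:E +
  ('C(m, k) * 'C(m - k, k))%:R%:E * \int[mu]_x
    ((two_clusters k r x)%:R * prob_of nu (outside (k + k) r) x ^+ (m - (k + k)))%:E.
Proof.
move=> k0.
pose K (x : X) := #|[set C in comps (adj r x : rel 'I_m) | #|C| == k]%SET|.
have mK : measurable_fun setT K by exact: measurable_card_comps.
have mpair (p : {set 'I_m} * {set 'I_m}) :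
    measurable_fun setT (fun x : X => is_comp r x p.1 && is_comp r x p.2).
  by apply: measurable_and; exact: measurable_is_comp.
have msq (f : X -> nat) : measurable_fun setT f -> measurable_fun setT (fun x =>
  (f x ^ 2)%N).
  by move=> mf; apply: (@measurableT_comp _ _ _ _ _ _ (fun n : nat => n ^ 2)%N).
have aeK := ae_count mu_iid nu_diffuse k m r.
rewrite (integral_nat (f := fun x => (count k m r x ^ 2)%N) (g := fun x =>
  (K x ^ 2)%N)); last 3 first.
- by apply: msq; exact: measurable_num_components.
- exact: msq.
- by apply: (@filterS _ _ (ae_filter_ringOfSetsType mu) _ _ _ aeK) => x ->.
rewrite (integral_nat _ _ aeK); last 2 first.
- exact: measurable_num_components.
- exact: mK.
transitivity (\int[mu]_x ((K x)%:R%:E + (\sum_(p in disjoint_pairs m k)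
    (is_comp r x p.1 && is_comp r x p.2))%N%:R%:E)).
  apply: eq_integral => x _; rewrite -EFinD -natrD -sqr_card_comps//.
  exact: adj_sym.
have mKE : measurable_fun setT (fun x => (K x)%:R%:E : \bar R).
  apply/measurable_EFinP.
  exact: (@measurableT_comp _ _ _ _ _ _ (fun n : nat => n%:R : R)).
have msum : measurable_fun setT (fun x : X => (\sum_(p in disjoint_pairs m k)
    (is_comp r x p.1 && is_comp r x p.2))%N%:R%:E : \bar R).
  apply/measurable_EFinP.
  rewrite (_ : (fun _ => _) = (fun x : X => \sum_(p <- enum (disjoint_pairs m k))
      (is_comp r x p.1 && is_comp r x p.2)%:R)%R); last first.
    by apply/funext => x; rewrite natr_sum big_enum.
  apply: measurable_sum => p; apply/measurable_EFinP; exact: (measurable_bool_EFin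
    (mpair p)).
rewrite ge0_integralD//; congr (_ + _).
have [mk|km] := ltnP m (k + k).
  rewrite (_ : _ * 'C(m - k, k) = 0)%N; last first.
    have [mk'|km'] := ltnP m k; first by rewrite bin_small.
    by rewrite (@bin_small (m - k)) ?muln0// ltn_subLR.
  rewrite mul0e; apply: integral0_eq => x _.
  rewrite big1// => -[I J]; rewrite inE/= => /and3P[/eqP Ik /eqP Jk /eqP IJ].
  have := max_card (mem (I :|: J)%SET); rewrite card_ord cardsU IJ cards0 subn0 Ik Jk.
  by rewrite leqNgt mk.
rewrite (integral_sum_bool (c := mu [set x | is_comp r x (prefix m k) &&
     is_comp r x (segment m k (k + k))])); last 2 first.
- exact: mpair.
- move=> [I J]; rewrite inE/= => /and3P[/eqP Ik /eqP Jk /eqP IJ].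
  have [s [sI sJ]] := block_perm IJ.
  rewrite Ik in sI sJ; rewrite Jk in sJ.
  have := prob_comps_perm mu_iid r s (prefix m k) (segment m k (k + k)).
  by rewrite sI sJ.
rewrite card_disjoint_pairs; congr (_ * _).
have := prob_isolated r km (measurable_two_clusters k r)
  (fun x y => @two_clusters_eq _ _ k r x y).
move=> <-; congr (mu _); apply/seteqP; split => x /=; rewrite two_comps// /two_clusters.
  by rewrite -!andbA.
by rewrite -!andbA.
Qed.

End count_moments.

(** * The sample of Poisson size *)

Section poisson_sample.
Context {R : realType} {d : nat} {disp : measure_display}
  {Omega : measurableType disp} (P : probability Omega R).
Local Notation T := 'rV[R]_d.
Local Notation S := (@seqspace _ T).
Variables (nu : probability T R) (X : nat -> {RV P >-> T}) (N : {RV P >-> nat})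
  (lam : R).
Hypotheses (X_iid : iid nu X) (lam_gt0 : 0 < lam) (N_poisson : is_poisson lam N)
  (N_indep : independent_of_sequence N X).
Local Open Scope ereal_scope.

Definition seq_of (w : Omega) : S := fun i => X i w.

Lemma measurable_seq_of : measurable_fun setT seq_of.
Proof. by apply: measurable_fun_seq => i; exact: measurable_funP. Qed.

HB.instance Definition _ := isMeasurableFun.Build _ _ _ _ seq_of measurable_seq_of.

Definition seq_law := distribution P (seq_of : {mfun Omega >-> S}).

HB.instance Definition _ := Probability.on seq_law.

Lemma seq_law_iid : iid_law nu seq_law.
Proof.
move=> J B mB; have [indep law] := X_iid.
rewrite /seq_law /distribution /pushforward.
have := indep J B mB; rewrite (eq_bigr (fun j => nu (B j))); last first.
  by move=> j _; exact: law.
by move=> <-; congr (P _); apply/seteqP; split => w /= h j; exact: h.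
Qed.

(** Brings events of the canonical space into the sigma-algebra for which [independent_of_sequence]
    is stated. *)
Lemma sigma_sequence_preimage (E : set S) : measurable E ->
  sigma_sequence X (seq_of @^-1` E).
Proof.
have [s0 sC sU] := smallest_sigma_algebra [set: Omega]
  (\bigcup_i preimage_set_system setT (X i) measurable).
move: E; apply: smallest_sub.
  split => /=; first by rewrite preimage_set0.
  - by move=> A /= /sC; rewrite !setTD preimage_setC.
  - by move=> F /= FE; rewrite preimage_bigcup; exact: sU.
move=> _ [i _ [B mB <-]] /=; apply: sub_sigma_algebra.
by exists i => //; exists B => //; rewrite !setTI.
Qed.

(** By independence the joint law of the size and of the sequence is a product; Tonelli leaves an
    integral against the discrete law of [N]. *)
Lemma integral_poisson_sample (G : nat -> S -> R) :
  (forall m, measurable_fun setT (G m)) -> (forall m x, (0 <= G m x)%R) ->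
  \int[P]_w (G (N w) (seq_of w))%:E =
  \sum_(m <oo) (poisson_pmf lam m)%:E * \int[seq_law]_x (G m x)%:E.
Proof.
move=> mG G0.
pose joint (w : Omega) : nat * S := (N w, seq_of w).
have mjoint : measurable_fun setT joint.
  apply: measurable_fun_pair; [exact: measurable_funP|exact: measurable_seq_of].
pose pN := distribution P N.
pose G' (p : nat * S) := (G p.1 p.2)%:E.
have mG' : measurable_fun setT G'.
  move=> _ Y mY; rewrite setTI.
  rewrite [X in measurable X](_ : _ = \bigcup_m ([set m] `*` ((EFin \o G m) @^-1` Y))).
    apply: bigcup_measurable => m _; apply: measurableX => //.
    rewrite -[X in measurable X]setTI.
    by have /measurable_EFinP := mG m; exact.
  apply/seteqP; split => [[m x] Ymx|[m x] [i _ [/= -> ]]]//.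
  by exists m.
transitivity (\int[(pN \x seq_law)%E]_p G' p).
  transitivity (\int[pushforward P joint]_p G' p).
    rewrite (ge0_integral_pushforward mjoint)//.
    by move=> p; rewrite lee_fin.
  apply: eq_measure_integral => E mE _; symmetry.
  apply: product_measure_unique => // C B mC mB.
  rewrite /pN /distribution /pushforward muleC.
  rewrite -(N_indep _ (sigma_sequence_preimage mB)).
  by congr (P _); apply/seteqP; split => w /= [].
rewrite fubini_tonelli1//=; last by move=> p; rewrite lee_fin.
rewrite /fubini_F /G' /=.
pose h m := \int[seq_law]_x (G m x)%:E.
have h0 m : 0 <= h m by apply: integral_ge0 => x _; rewrite lee_fin.
(* Expanding [h n] over indicators turns the integral against the law of [N] into a series. *)
transitivity (\int[pN]_n (\sum_(m <oo) h m * (n == m)%:R%:E)).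
  apply: eq_integral => n _; rewrite (nneseries_split 0 n.+1); last first.
    by move=> k _; rewrite mule_ge0 ?lee_fin.
  rewrite add0n big_nat_recr//= eqxx mule1 big1_seq ?add0e; last first.
    by move=> i /=; rewrite mem_index_iota => /ltn_eqF; rewrite eq_sym => ->; rewrite mule0.
  rewrite eseries0 ?adde0// => i ni _.
  by rewrite ltn_eqF// mule0.
rewrite integral_nneseries//; last 1 first.
- by move=> m n _; rewrite mule_ge0 ?lee_fin.
apply: eq_eseriesr => m _.
rewrite ge0_integralZl//.
rewrite muleC integral_bool// -/(h m); congr (_ * _).
rewrite /pN /distribution /pushforward -N_poisson; congr (P _).
by apply/seteqP; split => w /= => [/eqP|->].
Qed.

Local Notation count k m r x := (num_components k r (points m x)).

(* [lam ^ k / k! * one_mean] and [lam ^ 2k / k!^2 * two_mean] are the first two factorial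
   moments (Mecke formula): [k] given points form a cluster of the Poisson sample iff
   they are connected and no other point falls within distance [r] of them. *)
Definition one_mean k r := \int[seq_law]_x
  ((clustered k r x)%:R * expR (- (lam * (1 - prob_of nu (outside k r) x))))%:E.

Definition two_mean k r := \int[seq_law]_x
  ((two_clusters k r x)%:R * expR (- (lam * (1 - prob_of nu (outside (k + k) r) x))))%:E.

Hypothesis nu_diffuse : forall z, nu [set z] = 0%E.

Lemma measurable_prob_outside j r : measurable_fun setT (prob_of nu (outside j r)).
Proof. by apply: measurable_prob_of; exact: measurable_outside. Qed.

Lemma measurable_count k m r : measurable_fun setT (fun x : S => (count k m r x)%:R : R).
Proof.
apply: (@measurableT_comp _ _ _ _ _ _ (fun n : nat => n%:R : R)) => //.
exact: measurable_num_components.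
Qed.

Lemma measurable_sample_count k r :
  measurable_fun setT (fun w => (num_components k r (sample X N w))%:R : R).
Proof.
move=> _ Y mY; rewrite setTI.
rewrite [X in measurable X](_ : _ = \bigcup_m (N @^-1` [set m] `&`
  seq_of @^-1` ((fun x : S => (count k m r x)%:R : R) @^-1` Y))).
  apply: bigcup_measurable => m _; apply: measurableI.
    by rewrite -[X in measurable X]setTI; exact: measurable_funP.
  rewrite -[X in measurable X]setTI; apply: measurable_seq_of => //.
  by rewrite -[X in measurable X]setTI; exact: measurable_count.
apply/seteqP; split => [w Yw|w [m _ [/= Nm Yw]]]; first by exists (N w).
by rewrite /preimage /= /sample Nm.
Qed.

Lemma expectation_count k r : (0 < k)%N ->
  \int[P]_w (num_components k r (sample X N w))%:R%:E =
  ((k`!%:R)^-1 * lam ^+ k)%:E * one_mean k r.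
Proof.
move=> k0; rewrite (integral_poisson_sample (G := fun m x => (count k m r x)%:R%R))//;
  last first.
  by move=> m; exact: measurable_count.
(* The constant comes from ['C(m, k) * (m - k)! = m! / k!]. *)
rewrite -(@poisson_mixture _ lam k (k`!%:R)^-1 (fun m => 'C(m, k)%:R))//; last first.
- by move=> x; exact: prob_of_ge0.
- exact: measurable_prob_outside.
- exact: (measurable_bool_real (measurable_clustered k r)).
- move=> m km.
  have f0 : (k`!%:R != 0 :> R)%R by rewrite pnatr_eq0 -lt0n fact_gt0.
  apply: (mulfI f0); rewrite mulVKf// -!natrM -(bin_fact km).
  by congr (_%:R)%R; ring.
- by move=> m mk; rewrite bin_small.
apply: eq_eseriesr => m _; rewrite (integral_count seq_law_iid nu_diffuse)//.
by rewrite EFinM muleA.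
Qed.

Lemma expectation_count_sqr k r : (0 < k)%N ->
  \int[P]_w (num_components k r (sample X N w) ^ 2)%:R%:E =
  \int[P]_w (num_components k r (sample X N w))%:R%:E +
  ((k`!%:R ^+ 2)^-1 * lam ^+ (k + k))%:E * two_mean k r.
Proof.
move=> k0.
rewrite (integral_poisson_sample (G := fun m x => (count k m r x ^ 2)%:R%R))//; last first.
  move=> m; rewrite (_ : (fun _ => _) = (fun x : S => (count k m r x)%:R ^+ 2)%R);
    last first.
    by apply/funext => x; rewrite natrX.
  by apply: measurable_funX; exact: measurable_count.
rewrite (integral_poisson_sample (G := fun m x => (count k m r x)%:R%R))//; last first.
  by move=> m; exact: measurable_count.
(* Here ['C(m, k) * 'C(m - k, k) * (m - 2k)! = m! / k! ^ 2]. *)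
rewrite -(@poisson_mixture _ lam (k + k) (k`!%:R ^+ 2)^-1
  (fun m => ('C(m, k) * 'C(m - k, k))%:R))//; last first.
- by move=> x; exact: prob_of_ge0.
- exact: measurable_prob_outside.
- exact: (measurable_bool_real (measurable_two_clusters k r)).
- move=> m km.
  have km1 : (k <= m)%N := leq_trans (leq_addl k k) km.
  have km2 : (k <= m - k)%N by rewrite leq_subRL.
  have f0 : (k`!%:R ^+ 2 != 0 :> R)%R by rewrite expf_neq0// pnatr_eq0 -lt0n fact_gt0.
  apply: (mulfI f0); rewrite mulVKf// -natrX -!natrM.
  rewrite -(bin_fact km1) -(bin_fact km2) -subnDA.
  by congr (_%:R)%R; ring.
- move=> m mk; case: (ltnP m k) => km; first by rewrite bin_small.
  by rewrite (@bin_small (m - k)) ?muln0// ltn_subLR.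
rewrite -nneseriesD; last 2 first.
- by move=> m _ _; rewrite mule_ge0 ?lee_fin ?poisson_pmf_ge0// integral_ge0// => x _;
  rewrite lee_fin.
- move=> m _ _; rewrite mule_ge0 ?lee_fin ?mulr_ge0 ?poisson_pmf_ge0// integral_ge0//
  => x _.
  by rewrite lee_fin mulr_ge0 ?exprn_ge0// prob_of_ge0.
apply: eq_eseriesr => m _; rewrite (integral_count_sqr seq_law_iid nu_diffuse)//.
rewrite muleDr//; first by rewrite EFinM muleA.
rewrite ge0_adde_def// inE.
  by rewrite integral_ge0// => x _; rewrite lee_fin.
rewrite mule_ge0 ?lee_fin// integral_ge0// => x _.
by rewrite lee_fin mulr_ge0 ?exprn_ge0// prob_of_ge0.
Qed.

End poisson_sample.

(** * Coverage by two nearby clusters *)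

Section euclidean.
Context {R : realType} {d : nat}.
Local Notation T := 'rV[R]_d.
Implicit Types u v w : T.

Definition dot u v : R := \sum_(i < d) u 0 i * v 0 i.

Lemma dotC u v : dot u v = dot v u.
Proof. by apply: eq_bigr => i _; rewrite mulrC. Qed.

Lemma dotDl u v w : dot (u + v) w = dot u w + dot v w.
Proof. by rewrite -big_split; apply: eq_bigr => i _; rewrite mxE mulrDl. Qed.

Lemma dotNl u v : dot (- u) v = - dot u v.
Proof. by rewrite -sumrN; apply: eq_bigr => i _; rewrite mxE mulNr. Qed.

Lemma dotZl a u v : dot (a *: u) v = a * dot u v.
Proof. by rewrite mulr_sumr; apply: eq_bigr => i _; rewrite mxE mulrA. Qed.

Lemma dotDr u v w : dot w (u + v) = dot w u + dot w v.
Proof. by rewrite dotC dotDl !(dotC w). Qed.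

Lemma dotNr u v : dot u (- v) = - dot u v.
Proof. by rewrite dotC dotNl dotC. Qed.

Lemma dotZr a u v : dot u (a *: v) = a * dot u v.
Proof. by rewrite dotC dotZl dotC. Qed.

Lemma dot_ge0 u : 0 <= dot u u.
Proof. by apply: sumr_ge0 => i _; rewrite -expr2 sqr_ge0. Qed.

Lemma enorm_sqr u : enorm u ^+ 2 = dot u u.
Proof.
rewrite /enorm sqr_sqrtr; last by apply: sumr_ge0 => i _; exact: sqr_ge0.
by apply: eq_bigr => i _; rewrite expr2.
Qed.

Lemma cauchy_schwarz u v : dot u v <= enorm u * enorm v.
Proof.
have [v0|v0] := eqVneq (enorm v) 0.
  rewrite v0 mulr0; move/eqP : v0; rewrite enorm_eq0 => /eqP ->.
  by rewrite /dot big1// => i _; rewrite mxE mulr0.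
have vp : 0 < enorm v by rewrite lt_def v0 enorm_ge0.
have [u0|u0] := eqVneq (enorm u) 0.
  rewrite u0 mul0r; move/eqP : u0; rewrite enorm_eq0 => /eqP ->.
  by rewrite /dot big1// => i _; rewrite mxE mul0r.
have up : 0 < enorm u by rewrite lt_def u0 enorm_ge0.
(* This square expands to [2 |u| |v| (|u| |v| - u.v)]. *)
have := dot_ge0 (enorm v *: u - enorm u *: v).
rewrite dotDl !dotDr !dotNl !dotNr !dotZl !dotZr -!enorm_sqr (dotC v u) => h.
have uv : 0 < enorm u * enorm v by exact: mulr_gt0.
by rewrite -subr_ge0 -(pmulr_rge0 _ uv); move: h; set a := enorm u;
  set b := enorm v => h; nra.
Qed.

Lemma enormD u v : enorm (u + v) <= enorm u + enorm v.
Proof.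
rewrite -(@ler_pXn2r _ 2)// ?nnegrE ?addr_ge0 ?enorm_ge0//.
rewrite enorm_sqr dotDl !dotDr -!enorm_sqr (dotC v u) sqrrD.
by have := cauchy_schwarz u v; lra.
Qed.

Lemma enorm_triangle u v w : enorm (u - w) <= enorm (u - v) + enorm (v - w).
Proof. by rewrite (le_trans _ (enormD _ _))// addrA subrK. Qed.

Lemma enormZ a u : enorm (a *: u) = `|a| * enorm u.
Proof.
apply/eqP; rewrite -(@eqrXn2 _ 2)// ?mulr_ge0 ?enorm_ge0//.
by rewrite exprMn !enorm_sqr dotZl dotZr real_normK ?num_real// expr2 mulrA.
Qed.

(** [r / 2 + r / 10 <= r]. The shift [r / 2] is large enough to leave the balls around lower points
    and small enough to stay in the ball around [z]. *)
Lemma cap_inside (r : R) (e z q : T) : 0 < r -> enorm e = 1 -> enorm (q - (z +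
  (r / 2) *: e)) <= r / 10 -> enorm (z - q) <= r.
Proof.
move=> r_gt0 e_unit qz; rewrite enormB (le_trans (enorm_triangle _ (z + (r / 2) *: e) _))//.
rewrite addrAC subrr add0r enormZ e_unit mulr1 ger0_norm; last by lra.
by lra.
Qed.

(* [|z + (r/2)e - y|^2 >= (1 + 1/4) r^2 > (1.1 r)^2] as [e] points away from [y]. *)
Lemma cap_outside (r : R) (e z q y : T) : 0 < r -> enorm e = 1 -> enorm (q - (z +
  (r / 2) *: e)) <= r / 10 ->
  dot e y <= dot e z -> r < enorm (z - y) -> r < enorm (y - q).
Proof.
move=> r_gt0 e_unit qz ez yz.
have far : 11 / 10 * r < enorm (z + (r / 2) *: e - y).
  rewrite -(@ltr_pXn2r _ 2)// ?nnegrE ?enorm_ge0//; last by lra.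
  rewrite enorm_sqr addrAC dotDl !(dotDr (z - y)) dotZl !dotZr -!enorm_sqr.
  rewrite dotZl -enorm_sqr e_unit (dotC _ e) dotDr dotNr.
  have : r ^+ 2 < enorm (z - y) ^+ 2 by rewrite ltr_pXn2r// nnegrE ?enorm_ge0// ltW.
  move: (enorm (z - y)) (dot e z) (dot e y) ez => a b c ez ha; nra.
have := enorm_triangle (z + (r / 2) *: e) q y.
by rewrite (enormB _ q) (enormB q y); lra.
Qed.

End euclidean.

Lemma convex_lt (R : realType) (a b s t : R) : 0 <= t <= 1 -> a < s -> b < s ->
  (1 - t) * a + t * b < s.
Proof.
move=> /andP[t0 t1] as_ bs; have [ab|ba] := leP a b.
  by apply: le_lt_trans bs; nra.
by apply: le_lt_trans as_; nra.
Qed.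

Lemma enorm_convex (R : realType) m (u v u0 : 'rV[R]_m) (s t : R) : 0 <= t <= 1 ->
  enorm (u - u0) < s -> enorm (v - u0) < s -> enorm ((1 - t) *: u + t *: v - u0) < s.
Proof.
move=> t01 us vs; have /andP[t0 t1] := t01.
have -> : (1 - t) *: u + t *: v - u0 = (1 - t) *: (u - u0) + t *: (v - u0).
  by apply/rowP => i; rewrite !mxE; ring.
have := enormD ((1 - t) *: (u - u0)) (t *: (v - u0)).
rewrite !enormZ !ger0_norm ?subr_ge0// => h; apply: (le_lt_trans h).
exact: convex_lt.
Qed.

Lemma enorm0 (R : realType) m : enorm (0 : 'rV[R]_m) = 0.
Proof. by apply/eqP; rewrite enorm_eq0. Qed.


Section cluster_diameter.
Context {R : realType} {d : nat}.
Implicit Types x : nat -> 'rV[R]_d.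

Lemma clustered_diameter k r x : 0 <= r -> clustered k r x ->
  forall i l, (i < k)%N -> (l < k)%N -> enorm (x i - x l) <= k%:R * r.
Proof.
move=> r0 /forallP cx i l ik lk.
have /forallP/(_ (Ordinal lk)) := cx (Ordinal ik).
(* A path without repetition has fewer than [k] edges, each of length at most [r]. *)
move=> /connectP[p ep]; case/shortenP: ep => q eq uq _ lE.
have qk : (size q <= k)%N.
  by have /card_uniqP := uq => cq; rewrite (leq_trans (leqnSn _))// -[X in (X <= _)%N]cq
    (leq_trans (max_card _))// card_ord.
apply: le_trans (_ : (size q)%:R * r <= _); last by rewrite ler_wpM2r// ler_nat.
have -> : x l = x (last (Ordinal ik) q) by rewrite -lE.
have -> : x i = x (Ordinal ik) by [].
elim: q (Ordinal ik) eq {uq lE qk} => [|b q IH] a /=.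
  by rewrite subrr mul0r => _; rewrite le_eqVlt enorm_eq0 eqxx.
move=> /andP[/andP[_ ab] /IH h].
rewrite -natr1 mulrDl mul1r.
by rewrite (le_trans (enorm_triangle _ (x b) _))// [leRHS]addrC lerD.
Qed.

End cluster_diameter.

Section cover.
Context {R : realType} {d : nat}.
Local Notation T := 'rV[R]_d.
Local Notation S := (@seqspace _ T).
Variables (nu : probability T R) (r : R) (k : nat).

(** The exponent of the Mecke weights, in their own form; [coverE] identifies it with the mass of a
    union of balls. *)
Definition cover j (x : S) : R := 1 - prob_of nu (outside j r) x.

Definition covered j (x : S) : set T := [set z | ~~ outside j r x z].

Lemma coveredP j (x : S) z :
  covered j x z <-> exists2 i, (i < j)%N & enorm (x i - z) <= r.
Proof.
rewrite /covered /=; split.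
  by rewrite negb_forall => /existsP[i]; rewrite -leNgt => h; exists i.
move=> [i ij h]; rewrite negb_forall; apply/existsP; exists (Ordinal ij).
by rewrite -leNgt.
Qed.

Lemma measurable_covered j x : measurable (covered j x).
Proof.
apply: (@measurable_set_bool _ _ (fun z => ~~ outside j r x z)).
apply: measurable_neg; apply: measurable_forallb => i.
by apply: measurable_fun_ltr => //; apply: measurable_dist.
Qed.

Lemma coverE j x : (cover j x)%:E = nu (covered j x).
Proof.
rewrite (_ : covered j x = ~` [set z | outside j r x z]); last first.
  by apply/seteqP; split => z /negP.
rewrite probability_setC; last by exact: (measurable_section (measurable_outside j r)).
by rewrite EFinB (prob_ofE nu (measurable_outside j r)).
Qed.

Lemma measurable_cap y s : measurable [set q : T | enorm (q - y) <= s].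
Proof.
apply: (@measurable_set_bool _ _ (fun q : T => enorm (q - y) <= s)).
by apply: measurable_fun_ler => //; apply: measurable_dist.
Qed.

Lemma cover_ge (x : S) j (q : R) (Q : set T) : measurable Q -> Q `<=` covered j x ->
  (q%:E <= nu Q)%E -> q <= cover j x.
Proof.
move=> mQ QC qQ; rewrite -lee_fin coverE (le_trans qQ)// le_measure// inE//.
exact: measurable_covered.
Qed.

Lemma cover_add (x y : S) i j (q : R) (Q : set T) : measurable Q ->
  Q `<=` covered j x -> covered i y `<=` covered j x ->
  (forall z, Q z -> ~ covered i y z) ->
  (q%:E <= nu Q)%E -> cover i y + q <= cover j x.
Proof.
move=> mQ QC CC dQ qQ; rewrite -lee_fin EFinD !coverE.
apply: (@le_trans _ _ (nu (covered i y `|` Q))).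
  rewrite measureU//; first by rewrite leeD2l.
    exact: measurable_covered.
  by apply/seteqP; split => // z [/[swap] /dQ].
rewrite le_measure// ?inE; last by move=> z [/CC|/QC].
- by apply: measurableU => //; exact: measurable_covered.
- exact: measurable_covered.
Qed.

Lemma coveredU (x : S) :
  covered (k + k) x = covered k x `|` covered k (shift_seq k x).
Proof.
apply/seteqP; split => z.
  move=> /coveredP[i ikk h]; have [ik|ki] := ltnP i k.
    by left; apply/coveredP; exists i.
  right; apply/coveredP; exists (i - k)%N; first by rewrite ltn_subLR.
  by rewrite /shift_seq subnKC.
move=> [|] /coveredP[i ik h]; apply/coveredP.
  by exists i => //; exact: leq_trans ik (leq_addl _ _).
by exists (k + i)%N => //; rewrite ltn_add2l.
Qed.

Lemma cover_far (x : S) :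
  (forall i l, (i < k)%N -> (k <= l < k + k)%N -> 2 * r < enorm (x i - x l)) ->
  cover (k + k) x = cover k x + cover k (shift_seq k x).
Proof.
move=> far; apply: EFin_inj; rewrite [RHS]EFinD !coverE coveredU measureU//.
- exact: measurable_covered.
- exact: measurable_covered.
apply/seteqP; split => // z [] /coveredP[i ik h] /coveredP[l lk h'].
have := far i (k + l)%N ik; rewrite leq_addr ltn_add2l lk => /(_ erefl).
have := enorm_triangle (x i) z (x (k + l)%N); rewrite (enormB z).
by move: h h'; rewrite /shift_seq; lra.
Qed.

Variables (A : set T) (q0 : R).
(** Each cluster has diameter at most [k * r] and two close ones have points within [2 * r]: the
    whole configuration has diameter at most [(2k + 2) * r]. At this scale a single direction [e]
    must serve all [2k] points. *)
Let rho := (k + k).+2%:R * r.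
Hypothesis caps : forall x : S, (forall i, (i < k + k)%N -> A (x i)) ->
  (forall i l, (i < k + k)%N -> (l < k + k)%N -> enorm (x i - x l) <= rho) ->
  exists2 e, enorm e = 1 & forall i, (i < k + k)%N ->
    (q0%:E <= nu [set q | enorm (q - (x i + (r / 2) *: e)) <= r / 10]%R)%E.

(** The threshold is [2 * r] and not [r]: beyond it the balls of the two clusters are disjoint. *)
Definition close (x : S) : bool := [exists i : 'I_k, exists l : 'I_(k + k),
  (k <= l)%N && (enorm (x i - x l) <= 2 * r)].

Lemma close_diameter (x : S) : 0 < r -> clustered k r x ->
  clustered k r (shift_seq k x) -> close x ->
  forall i l, (i < k + k)%N -> (l < k + k)%N -> enorm (x i - x l) <= rho.
Proof.
move=> r0 /(clustered_diameter (ltW r0)) c1 /(clustered_diameter (ltW r0)) c2.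
move=> /existsP[a /existsP[b /andP[kb ab]]].
have bk : (b - k < k)%N by rewrite ltn_subLR.
have rk : 0 <= k%:R * r by rewrite mulr_ge0// ltW.
have rhoE : rho = k%:R * r + 2 * r + k%:R * r.
  by rewrite /rho -addn2 natrD natrD; ring.
have c2' i l : (k <= i < k + k)%N -> (k <= l < k + k)%N -> enorm (x i - x l) <= k%:R * r.
  move=> /andP[ki ik] /andP[kl lk].
  have := c2 (i - k)%N (l - k)%N; rewrite !ltn_subLR// => /(_ ik lk).
  by rewrite /shift_seq !subnKC.
have mixed i l : (i < k)%N -> (k <= l < k + k)%N -> enorm (x i - x l) <= rho.
  move=> ik kl; rewrite rhoE.
  apply: le_trans (enorm_triangle _ (x a) _) _; rewrite -addrA lerD//.
    exact: c1.
  apply: le_trans (enorm_triangle _ (x b) _) _; rewrite lerD//.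
  by apply: c2' => //; rewrite kb ltn_ord.
move=> i l ikk lkk; have [ik|ki] := ltnP i k; have [lk|kl] := ltnP l k.
- by rewrite rhoE (le_trans (c1 _ _ ik lk))//; lra.
- by apply: mixed => //; rewrite kl.
- by rewrite enormB; apply: mixed => //; rewrite ki.
- by rewrite rhoE (le_trans (c2' _ _ _ _)) ?ki ?kl//; lra.
Qed.

(* The highest of the [2k] points in the direction [e] sees a cap missed by the
   balls around the other cluster. *)
Lemma cover_close (x : S) : 0 < r -> (0 < k)%N ->
  (forall i, (i < k + k)%N -> A (x i)) ->
  clustered k r x -> clustered k r (shift_seq k x) -> close x ->
  [/\ q0 <= cover k (shift_seq k x) &
     isolated k (k + k) r x ->
     cover k x + q0 <= cover (k + k) x \/
     cover k (shift_seq k x) + q0 <= cover (k + k) x].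
Proof.
move=> r0 k0 xA c1 c2 cx.
have [e e1 capsx] := caps xA (close_diameter r0 c1 c2 cx).
pose Q i : set T := [set q | enorm (q - (x i + (r / 2) *: e)) <= r / 10].
have mQ i : measurable (Q i) by exact: measurable_cap.
have Qcov i j : (i < j)%N -> Q i `<=` covered j x.
  by move=> ij q Qq; apply/coveredP; exists i => //; exact: cap_inside Qq.
split.
  (* Index [k] is the first point of the second cluster, and its cap lies in the ball around it. *)
  have kk : (k < k + k)%N by rewrite -[X in (X < _)%N]addn0 ltn_add2l.
  apply: (cover_ge (mQ k)); last exact: capsx.
  move=> q Qq; apply/coveredP; exists 0%N => //; rewrite /shift_seq addn0.
  exact: cap_inside Qq.
move=> /forallP iso.
have kk0 : (0 < k + k)%N by rewrite addn_gt0 k0.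
have [i _ imax] := @arg_maxP _ _ _ (Ordinal kk0) xpredT
  (fun i : 'I_(k + k) => dot e (x i)) erefl.
have {}imax l : (l < k + k)%N -> dot e (x l) <= dot e (x i).
  by move=> lkk; exact: (imax (Ordinal lkk)).
have kkk : (k <= k + k)%N := leq_addl _ _.
(* The gain is over the cluster that does not contain the highest point. *)
have [ik|ki] := ltnP i k; [right|left]; apply: (cover_add (mQ i) (Qcov i _ (ltn_ord i))).
- by rewrite coveredU; exact: subsetUr.
- move=> q Qq /coveredP[l lk]; apply/negP; rewrite -ltNge /shift_seq.
  have lkk : (k + l < k + k)%N by rewrite ltn_add2l.
  apply: (cap_outside r0 e1 Qq); first exact: imax.
  have /forallP/(_ (Ordinal lkk)) := iso (Ordinal ik).
  by rewrite /= leq_addr.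
- exact: capsx.
- by rewrite coveredU; exact: subsetUl.
- move=> q Qq /coveredP[l lk]; apply/negP; rewrite -ltNge.
  apply: (cap_outside r0 e1 Qq); first by apply: imax; exact: leq_trans lk kkk.
  have /forallP/(_ i) := iso (Ordinal lk).
  by rewrite /= ki enormB.
- exact: capsx.
Qed.

End cover.

(** * Comparison of the two moments *)

(** Used in both directions of [compare_means]; the factor [2] accounts for [G] and its swapped copy
    [G']. *)
Lemma ae_integral_bound {disp} {S : measurableType disp} {R : realType}
    (mu : {measure set S -> \bar R}) (f g G G' : S -> R) (c K : R) (I : \bar R) :
  0 <= c -> measurable_fun setT G -> measurable_fun setT G' ->
  (forall x, 0 <= G x) -> (forall x, 0 <= G' x) ->
  (\int[mu]_x (G' x)%:E = \int[mu]_x (G x)%:E)%E ->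
  (\int[mu]_x (G x)%:E <= K%:E * I)%E ->
  measurable_fun setT f -> measurable_fun setT g ->
  (forall x, 0 <= f x) -> (forall x, 0 <= g x) ->
  {ae mu, forall x, f x <= g x + c * (G x + G' x)} ->
  (\int[mu]_x (f x)%:E <= \int[mu]_x (g x)%:E + (2 * c * K)%:E * I)%E.
Proof.
move=> c0 mG mG' G0 G'0 GG' GI mf mg f0 g0 fg.
have mE (h : S -> R) : measurable_fun setT h -> measurable_fun setT (fun x => (h x)%:E).
  by move=> mh; apply/measurable_EFinP.
have mGG' : measurable_fun setT (fun x => c * (G x + G' x)).
  by apply: measurable_funM => //; exact: measurable_funD.
have GG'0 x : 0 <= c * (G x + G' x) by rewrite mulr_ge0// addr_ge0.
apply: (@le_trans _ _ (\int[mu]_x ((g x)%:E + (c * (G x + G' x))%:E))%E).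
  apply: ae_ge0_le_integral => //.
  - by move=> x _; rewrite lee_fin.
  - exact: mE.
  - by move=> x _; rewrite -EFinD lee_fin addr_ge0.
  - by apply: emeasurable_funD; exact: mE.
  by apply: (@filterS _ _ (ae_filter_ringOfSetsType mu) _ _ _ fg) => x fgx _.
rewrite ge0_integralD//; do ?[exact: mE|by move=> x _; rewrite lee_fin].
rewrite leeD2l//.
rewrite (_ : \int[mu]_x _ = c%:E * \int[mu]_x ((G x)%:E + (G' x)%:E))%E; last first.
  rewrite -ge0_integralZl//.
  - by apply: emeasurable_funD; exact: mE.
  - by move=> x _; rewrite -EFinD lee_fin addr_ge0.
rewrite ge0_integralD//; do ?[exact: mE|by move=> x _; rewrite lee_fin].
rewrite GG' -mule2n -mule_natl muleA -EFinM [X in X%:E](mulrC c) EFinM.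
rewrite [leRHS](_ : _ = (2 * c)%:E * (K%:E * I))%E; last by rewrite muleA -EFinM.
by rewrite -EFinM lee_wpmul2l// lee_fin mulr_ge0.
Qed.

Section blocks.
Context {R : realType} {d : nat}.
Local Notation T := 'rV[R]_d.
Local Notation S := (@seqspace _ T).
Variables (nu : probability T R) (mu : probability S R) (mu_iid : iid_law nu mu).
Variables (k : nat) (phi : S -> R).
Hypotheses (mphi : measurable_fun setT phi) (phi0 : forall x, 0 <= phi x)
  (phi_eq : forall x y : S, (forall i, (i < k)%N -> x i = y i) -> phi x = phi y).

Lemma measurable_shift : measurable_fun setT (shift_seq k : S -> S).
Proof. by apply: measurable_fun_seq => i; exact: measurable_seq_coord. Qed.

(** The blocks [[0, k)] and [[k, 2k)] are independent: after concatenation at [k], the shifted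
    sequence is the fresh one. *)
Lemma integral_block_sqr :
  (\int[mu]_x (phi x * phi (shift_seq k x))%:E = (\int[mu]_x (phi x)%:E) ^+ 2)%E.
Proof.
have mphis : measurable_fun setT (fun x : S => phi (shift_seq k x)).
  exact: (measurableT_comp mphi measurable_shift).
have mE : measurable_fun setT (fun x : S => (phi x)%:E) by apply/measurable_EFinP.
have nonneg : (0 <= \int[mu]_x (phi x)%:E)%E.
  by apply: integral_ge0 => x _; rewrite lee_fin.
rewrite (integral_concat mu_iid k); last 2 first.
- by apply/measurable_EFinP; exact: (measurable_funM mphi mphis).
- by move=> x; rewrite lee_fin mulr_ge0.
rewrite expe2 -ge0_integralZr//; last by move=> x _; rewrite lee_fin.
apply: eq_integral => x _.
transitivity (\int[mu]_y ((phi x)%:E * (phi y)%:E))%E; last first.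
  by rewrite ge0_integralZl// => [y _|]; rewrite lee_fin.
apply: eq_integral => y _; rewrite EFinM.
have -> : phi (concat_seq k (x, y)) = phi x.
  by apply: phi_eq => i ik; rewrite /concat_seq ik.
have -> // : shift_seq k (concat_seq k (x, y)) = y.
apply/funext => i; rewrite /shift_seq /concat_seq.
by rewrite ltnNge leq_addr/= addKn.
Qed.

(** Given the first block, the [k] following points fall independently into the ball around the
    anchor [x 0], each with probability at most [kap]. The integral of [phi] remains as a factor. *)
Lemma integral_block_ball (A : set T) (rho kap : R) : (0 < k)%N -> 0 <= kap ->
  (forall a, A a -> (nu [set z | enorm (a - z) <= rho]%R <= kap%:E)%E) ->
  {ae mu, forall x : S, forall i, A (x i)} ->
  (\int[mu]_x (phi x *
     [forall l : 'I_(k + k), (k <= l)%N ==> (enorm (x 0%N - x l) <= rho)%R]%:R)%:E <=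
   (kap ^+ k)%:E * \int[mu]_x (phi x)%:E)%E.
Proof.
move=> k0 kap0 balls inA.
pose W (x : S) (z : T) := enorm (x 0%N - z) <= rho.
have mW : measurable_fun setT (fun p : S * T => W p.1 p.2).
  apply: measurable_fun_ler => //; apply: measurable_dist => //.
  exact: (measurableT_comp (measurable_seq_coord 0) (@measurable_fst _ _ S T)).
have mpW := measurable_prob_of nu mW.
have W_eq (x y : S) : (forall i, (i < k)%N -> x i = y i) -> W x = W y.
  by move=> xy; apply/funext => z; rewrite /W xy.
have := @integral_all_later _ _ _ nu mu mu_iid W k (k + k) phi (leq_addl _ _) mW
  W_eq mphi phi0 phi_eq.
rewrite /W => ->; rewrite -/W addnK.
have mE : measurable_fun setT (fun x : S => (phi x)%:E) by apply/measurable_EFinP.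
rewrite -ge0_integralZl//; last 2 first.
- by move=> x _; rewrite lee_fin.
- by rewrite lee_fin exprn_ge0.
apply: ae_ge0_le_integral => //.
- by move=> x _; rewrite lee_fin mulr_ge0// exprn_ge0// prob_of_ge0.
- by apply/measurable_EFinP; exact: (measurable_funM mphi (measurable_funX _ mpW)).
- by move=> x _; rewrite -EFinM lee_fin mulr_ge0// exprn_ge0.
- by apply: measurable_funeM.
apply: (@filterS _ _ (ae_filter_ringOfSetsType mu) _ _ _ inA) => x xA _.
rewrite -EFinM lee_fin mulrC ler_wpM2r// lerXn2r// ?nnegrE ?prob_of_ge0//.
by rewrite -lee_fin (prob_ofE nu mW) balls.
Qed.

End blocks.

Lemma cover_eq {R : realType} {d : nat} (nu : probability 'rV[R]_d R) r j
    (x y : @seqspace _ 'rV[R]_d) :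
  (forall i, (i < j)%N -> x i = y i) -> cover nu r j x = cover nu r j y.
Proof. by move=> xy; rewrite /cover /prob_of (outside_eq r xy). Qed.

(** [c1], [c2] and [c] are the covers of the two clusters and of their union, [q] is the mass of a
    cap. Taking the sum of the two possible bounds avoids recording which alternative holds. *)
Lemma exp_compare {R : realType} (lam q c1 c2 c : R) (iso g g' : bool) :
  0 < lam -> g -> g' -> q <= c2 -> (iso -> c1 + q <= c \/ c2 + q <= c) ->
  iso%:R * expR (- (lam * c)) <=
    expR (- (lam * q)) * (expR (- (lam * c1)) * g%:R + expR (- (lam * c2)) * g'%:R) /\
  expR (- (lam * c1)) * expR (- (lam * c2)) <=
    expR (- (lam * q)) * (expR (- (lam * c1)) * g%:R).
Proof.
move=> lam0 -> -> qc2 h; rewrite !mulr1; split; last first.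
  by rewrite mulrC ler_wpM2r ?expR_ge0// ler_expR lerN2 ler_pM2l.
case: iso h => [/(_ isT)|_]; last by rewrite mul0r mulr_ge0 ?addr_ge0 ?expR_ge0.
rewrite mul1r mulrDr -!expRD -!opprD -!mulrDr => -[h|h].
  apply: (@le_trans _ _ (expR (- (lam * (q + c1))))).
    by rewrite ler_expR lerN2 ler_pM2l// addrC.
  by rewrite lerDl expR_ge0.
apply: (@le_trans _ _ (expR (- (lam * (q + c2))))).
  by rewrite ler_expR lerN2 ler_pM2l// addrC.
by rewrite lerDr expR_ge0.
Qed.

Section compare_means.
Context {R : realType} {d : nat}.
Local Notation T := 'rV[R]_d.
Local Notation S := (@seqspace _ T).
Variables (nu : probability T R) (mu : probability S R) (mu_iid : iid_law nu mu).
Variables (lam r : R) (k : nat) (A : set T) (q0 kap : R).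
Hypotheses (lam_gt0 : 0 < lam) (r_gt0 : 0 < r) (k_gt0 : (0 < k)%N)
  (kap_ge0 : 0 <= kap).
Let rho := (k + k).+2%:R * r.
Hypothesis caps : forall x : S, (forall i, (i < k + k)%N -> A (x i)) ->
  (forall i l, (i < k + k)%N -> (l < k + k)%N -> enorm (x i - x l) <= rho) ->
  exists2 e, enorm e = 1 & forall i, (i < k + k)%N ->
    (q0%:E <= nu [set q | enorm (q - (x i + (r / 2) *: e)) <= r / 10]%R)%E.
Hypothesis balls : forall a, A a -> (nu [set z | enorm (a - z) <= rho]%R <= kap%:E)%E.
Hypothesis in_A : {ae mu, forall x : S, forall i, A (x i)}.

(** Integrand of [one_mean], as [weight2] below is that of [two_mean], with the exponent read as a
    [cover]. *)
Definition weight (x : S) : R :=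
  (clustered k r x)%:R * expR (- (lam * cover nu r k x)).

Definition weight2 (x : S) : R :=
  (two_clusters k r x)%:R * expR (- (lam * cover nu r (k + k) x)).

(** Anchored at the single point [x 0] and constraining the second block only, the form that
    [integral_block_ball] can integrate. *)
Definition gather (x : S) : bool :=
  [forall l : 'I_(k + k), (k <= l)%N ==> (enorm (x 0%N - x l) <= rho)].

Lemma weight_ge0 x : 0 <= weight x.
Proof. by rewrite mulr_ge0// expR_ge0. Qed.

Lemma weight2_ge0 x : 0 <= weight2 x.
Proof. by rewrite mulr_ge0// expR_ge0. Qed.

Lemma measurable_exp_cover j :
  measurable_fun setT (fun x : S => expR (- (lam * cover nu r j x))).
Proof.
apply: measurableT_comp => //; apply: measurable_funN; apply: measurable_funM => //.
by apply: measurable_funB => //; exact: measurable_prob_outside.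
Qed.

Lemma measurable_weight : measurable_fun setT weight.
Proof.
apply: measurable_funM; last exact: measurable_exp_cover.
exact: (measurable_bool_real (measurable_clustered k r)).
Qed.

Lemma measurable_weight2 : measurable_fun setT weight2.
Proof.
apply: measurable_funM; last exact: measurable_exp_cover.
exact: (measurable_bool_real (measurable_two_clusters k r)).
Qed.

Lemma measurable_gather : measurable_fun setT gather.
Proof.
apply: measurable_forallb => l; apply: measurable_implyb; exact: measurable_coord_le.
Qed.

Lemma weight_eq (x y : S) : (forall i, (i < k)%N -> x i = y i) -> weight x = weight y.
Proof.
by move=> xy; rewrite /weight (clustered_eq r xy) (cover_eq nu r xy).
Qed.

(** An involution of the indices, hence law preserving; it turns an estimate in the weight of the
    second cluster into one in the weight of the first. *)
Definition swap_block i : nat :=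
  if (i < k)%N then (k + i)%N else if (i < k + k)%N then (i - k)%N else i.

Lemma swap_blockK : involutive swap_block.
Proof.
move=> i; rewrite /swap_block; have [ik|ki] := ltnP i k.
  by rewrite ltnNge leq_addr/= ltn_add2l ik addKn.
have [ikk|kki] := ltnP i (k + k); first by rewrite ltn_subLR// ikk subnKC.
by rewrite ltnNge ki/= ltnNge kki.
Qed.

Lemma weight_swap x : weight (reindex_seq swap_block x) = weight (shift_seq k x).
Proof. by apply: weight_eq => i ik; rewrite /reindex_seq /swap_block ik. Qed.

Lemma weight_clustered (x : S) : clustered k r x ->
  weight x = expR (- (lam * cover nu r k x)).
Proof. by rewrite /weight => ->; rewrite mul1r. Qed.

Lemma weight_not_clustered (x : S) : ~~ clustered k r x -> weight x = 0.
Proof. by rewrite /weight => /negbTE ->; rewrite mul0r. Qed.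

(** Disjoint balls make [cover] additive, and the isolation of the two blocks holds
    automatically. *)
Lemma compare_far (x : S) : ~~ close r k x ->
  weight2 x = weight x * weight (shift_seq k x).
Proof.
move=> xfar.
have far i l : (i < k)%N -> (k <= l < k + k)%N -> 2 * r < enorm (x i - x l).
  move=> ik /andP[kl lk]; move: xfar; rewrite negb_exists => /forallP/(_ (Ordinal ik)).
  rewrite negb_exists => /forallP/(_ (Ordinal lk)).
  by rewrite negb_and /= kl /= -ltNge.
have iso : isolated k (k + k) r x.
  apply/forallP => i; apply/forallP => l; apply/implyP => kl.
  have r2 : r <= 2 * r by move: r_gt0; lra.
  by apply: le_lt_trans r2 (far i l _ _); rewrite // kl ltn_ord.
have cf : cover nu r (k + k) x = cover nu r k x + cover nu r k (shift_seq k x).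
  exact: cover_far far.
rewrite /weight2 /weight /two_clusters iso [in LHS]cf.
move: (clustered k r x) (clustered k r (shift_seq k x)) => c1 c2.
move: (cover nu r k x) (cover nu r k (shift_seq k x)) => a b.
rewrite [in LHS]mulrDr opprD expRD.
by case: c1; case: c2; rewrite ?(mul0r, mulr0, mul1r).
Qed.

(** Both left-hand sides vanish unless the two blocks are clustered; then [cover_close] gives the
    gain and the diameter bound gives [gather]. *)
Lemma compare_close (x : S) : (forall i, A (x i)) -> close r k x ->
  weight2 x <= expR (- (lam * q0)) * (weight x * (gather x)%:R +
    weight (shift_seq k x) * (gather (reindex_seq swap_block x))%:R) /\
  weight x * weight (shift_seq k x) <= expR (- (lam * q0)) * (weight x * (gather x)%:R).
Proof.
move=> xA cx.
have [c1|c1] := boolP (clustered k r x); last first.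
  rewrite /weight2 /two_clusters (negbTE c1) mul0r (weight_not_clustered c1) !mul0r mulr0.
  by rewrite add0r !mulr_ge0 ?weight_ge0 ?expR_ge0.
have [c2|c2] := boolP (clustered k r (shift_seq k x)); last first.
  rewrite /weight2 /two_clusters (negbTE c2) andbF mul0r (weight_not_clustered c2).
  by rewrite mul0r mulr0 addr0 !mulr_ge0 ?weight_ge0 ?expR_ge0.
have diam := close_diameter r_gt0 c1 c2 cx.
have [qc cc] := cover_close caps r_gt0 k_gt0 (fun i _ => xA i) c1 c2 cx.
have kkk : (k < k + k)%N by rewrite -[X in (X < _)%N]addn0 ltn_add2l.
have kk0 : (0 < k + k)%N by exact: ltn_trans kkk.
have gx : gather x.
  by apply/forallP => l; apply/implyP => kl; exact: diam.
have gx' : gather (reindex_seq swap_block x).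
  apply/forallP => l; apply/implyP => kl; rewrite /reindex_seq /swap_block k_gt0 addn0.
  by rewrite ltnNge kl/= ltn_ord; apply: diam => //; rewrite (leq_ltn_trans (leq_subr _ _)).
have w2 : weight2 x = (isolated k (k + k) r x)%:R * expR (- (lam * cover nu r (k + k) x)).
  by rewrite /weight2 /two_clusters c1 c2.
rewrite (weight_clustered c1) (weight_clustered c2) w2.
exact: exp_compare.
Qed.

(** Far configurations contribute equally to both sides, close ones at most [expR (- (lam * q0))]
    times two gathered weights of equal integral. Two inequalities avoid a subtraction of extended
    reals. *)
Lemma compare_means :
  (\int[mu]_x (weight2 x)%:E <= (\int[mu]_x (weight x)%:E) ^+ 2 +
     (2 * expR (- (lam * q0)) * kap ^+ k)%:E * \int[mu]_x (weight x)%:E)%E /\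
  ((\int[mu]_x (weight x)%:E) ^+ 2 <= \int[mu]_x (weight2 x)%:E +
     (2 * expR (- (lam * q0)) * kap ^+ k)%:E * \int[mu]_x (weight x)%:E)%E.
Proof.
have mw := measurable_weight; have mw2 := measurable_weight2.
have mws : measurable_fun setT (fun x : S => weight (shift_seq k x)).
  exact: (measurableT_comp mw (measurable_shift k)).
have mg := measurable_bool_real (R := R) measurable_gather.
have mwg : measurable_fun setT (fun x : S => weight x * (gather x)%:R).
  exact: (measurable_funM mw mg).
pose G (x : S) := weight x * (gather x)%:R.
pose G' (x : S) := weight (shift_seq k x) * (gather (reindex_seq swap_block x))%:R.
have G0 x : 0 <= G x by rewrite mulr_ge0 ?weight_ge0.
have G'0 x : 0 <= G' x by rewrite mulr_ge0 ?weight_ge0.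
have G'E x : G' x = G (reindex_seq swap_block x) by rewrite /G' -weight_swap.
have mG' : measurable_fun setT G'.
  rewrite (_ : G' = G \o reindex_seq swap_block); last by apply/funext => x; exact: G'E.
  exact: (measurableT_comp mwg (measurable_reindex_seq _)).
have intG' : (\int[mu]_x (G' x)%:E = \int[mu]_x (G x)%:E)%E.
  rewrite -(@integral_reindex _ _ _ nu mu mu_iid swap_block swap_block (EFin \o G)
    swap_blockK); last 2 first.
  - by apply/measurable_EFinP; exact: mwg.
  - by move=> x; rewrite lee_fin.
  by apply: eq_integral => x _; rewrite G'E.
have int_gather := integral_block_ball mu_iid mw weight_ge0 weight_eq k_gt0 kap_ge0
  balls in_A.
have mww : measurable_fun setT (fun x : S => weight x * weight (shift_seq k x)).
  exact: (measurable_funM mw mws).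
have ww0 (x : S) : 0 <= weight x * weight (shift_seq k x).
  by rewrite mulr_ge0 ?weight_ge0.
have bound (f g : S -> R) := @ae_integral_bound _ _ _ mu f g G G' _ _ _
  (expR_ge0 (- (lam * q0))) mwg mG' G0 G'0 intG' int_gather.
have sqr := integral_block_sqr mu_iid mw weight_ge0 weight_eq.
split.
  rewrite -[X in (_ <= X + _)%E]sqr; apply: (bound _ _ mw2 mww weight2_ge0 ww0).
  apply: (@filterS _ _ (ae_filter_ringOfSetsType mu) _ _ _ in_A) => x xA.
  have [cx|fx] := boolP (close r k x); first last.
    by rewrite (compare_far fx) lerDl mulr_ge0 ?expR_ge0 ?addr_ge0.
  have [h _] := compare_close xA cx; apply: (le_trans h).
  by rewrite lerDr; exact: ww0.
rewrite -[leLHS]sqr; apply: (bound _ _ mww mw2 ww0 weight2_ge0).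
apply: (@filterS _ _ (ae_filter_ringOfSetsType mu) _ _ _ in_A) => x xA.
have [cx|fx] := boolP (close r k x); last first.
  by rewrite (compare_far fx) lerDl mulr_ge0 ?expR_ge0 ?addr_ge0.
have [_ h] := compare_close xA cx; apply: (le_trans h).
apply: (ler_wpDl (weight2_ge0 x)); apply: ler_wpM2l; first exact: expR_ge0.
by rewrite lerDl; exact: G'0.
Qed.

End compare_means.

(** * Densities and the support *)

Section lebesgue_cubes.
Context {R : realType} {d : nat}.
Local Notation T := 'rV[R]_d.

(** Boxes have an explicit volume; Euclidean balls are compared with them up to factors depending on
    [d], the crude [d] standing for its square root. *)
Definition cube (c : T) (s : R) : set T :=
  [set y | forall i, `[c 0 i - s, c 0 i + s]%classic (y 0 i)].

Lemma measurable_cube c s : measurable (cube c s).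
Proof.
apply: (measurable_rV_box (B := fun i => `[c 0 i - s, c 0 i + s]%classic)) => i.
exact: measurable_itv.
Qed.

Lemma lebesgue_cube c s : 0 <= s ->
  lebesgue_rV d (cube c s) = ((2 * s) ^+ d)%:E.
Proof.
move=> s0; rewrite (@lebesgue_rV_box _ _ (fun i => `[c 0 i - s, c 0 i + s]%classic)).
  rewrite (eq_bigr (fun=> (2 * s)%:E)); last first.
    move=> i _; rewrite lebesgue_measure_itv/= lte_fin ltrBlDr -addrA ltrDl.
    have [ss|ss] := ltP 0 (s + s); first by rewrite -EFinB; congr EFin; ring.
    by congr EFin; lra.
  by rewrite big_const_ord iter_mule mule1 EFin_expe.
by move=> i; exact: measurable_itv.
Qed.

Lemma coord_enorm (y : T) i : `|y 0 i| <= enorm y.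
Proof.
rewrite -(@ler_pXn2r _ 2)// ?nnegrE ?enorm_ge0// enorm_sqr real_normK ?num_real//.
rewrite /dot (bigD1 i)//= -expr2 lerDl; apply: sumr_ge0 => j _.
by rewrite -expr2 sqr_ge0.
Qed.

Lemma enorm_ball_cube c s : [set y : T | enorm (c - y) <= s] `<=` cube c s.
Proof.
move=> y /= ys i; have := le_trans (coord_enorm (c - y) i) ys.
by rewrite !mxE /= in_itv/= ler_norml => /andP[]; lra.
Qed.

Lemma cube_enorm_ball c s : 0 <= s ->
  cube c s `<=` [set y : T | enorm (y - c) <= d%:R * s].
Proof.
move=> s0 y yc /=.
rewrite -(@ler_pXn2r _ 2)// ?nnegrE ?enorm_ge0 ?mulr_ge0// enorm_sqr /dot.
apply: (@le_trans _ _ (\sum_(i < d) s ^+ 2)).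
  apply: ler_sum => i _; rewrite !mxE -expr2 -real_normK ?num_real//.
  rewrite lerXn2r// ?nnegrE// ler_norml; have := yc i; rewrite /= in_itv/= => /andP[].
  by move=> ? ?; apply/andP; split; lra.
rewrite sumr_const card_ord -[leLHS]mulr_natl exprMn ler_wpM2r ?sqr_ge0//.
by rewrite -natrX ler_nat; case: (d) => // n; rewrite leq_pmulr.
Qed.

Lemma lebesgue_set1 (z : T) : (0 < d)%N -> lebesgue_rV d [set z] = 0%E.
Proof.
move=> d0; rewrite (_ : [set z] = cube z 0).
  by rewrite lebesgue_cube// mulr0 expr0n eqn0Ngt d0.
rewrite rV_set1_box; apply/seteqP; split => y /= h i; have := h i.
  by move=> ->; rewrite /= in_itv/= subr0 addr0 lexx.
by rewrite /= in_itv/= subr0 addr0 => /andP[h1 h2]; apply/eqP; rewrite eq_le h1 h2.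
Qed.

End lebesgue_cubes.

Lemma unit_ball_volume_gt0 (R : realType) d : (0 < d)%N -> 0 < unit_ball_volume R d.
Proof.
move=> d0.
have mB : measurable [set x : 'rV[R]_d | enorm x <= 1].
  rewrite (_ : [set _ | _] = [set x | enorm (x - 0) <= 1]); first exact: measurable_cap.
  by apply/seteqP; split => x /=; rewrite subr0.
have dR : 0 < d%:R :> R by rewrite ltr0n.
apply: fine_gt0; apply/andP; split.
  apply: (@lt_le_trans _ _ (lebesgue_rV d (cube 0 (d%:R^-1 : R)))).
    by rewrite lebesgue_cube ?invr_ge0// lte_fin exprn_gt0// mulr_gt0// invr_gt0.
  rewrite le_measure ?inE//; first exact: measurable_cube.
  by move=> x /cube_enorm_ball; rewrite invr_ge0 divff ?gt_eqF//= subr0; apply.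
(* Finiteness matters as well, because [fine] sends an infinite volume to [0]. *)
apply: (@le_lt_trans _ _ (lebesgue_rV d (cube 0 (1 : R)))).
  rewrite le_measure ?inE//; first exact: measurable_cube.
  by move=> x /= x1; apply: enorm_ball_cube; rewrite /= add0r enormN.
by rewrite lebesgue_cube// ltry.
Qed.

Lemma rational_ball (R : realType) d (U : set 'rV[R]_d) (x : 'rV[R]_d) :
  open U -> U x -> exists p : 'rV[rat]_d * nat,
    ball (map_mx ratr p.1 : 'rV[R]_d) (p.2.+1%:R^-1) x /\
    ball (map_mx ratr p.1 : 'rV[R]_d) (p.2.+1%:R^-1) `<=` U.
Proof.
move=> oU Ux; have /nbhs_ballP[e /= e0 xeU] : nbhs x U by exact: open_nbhs_nbhs.
have e2 : 0 < e / 2 by rewrite divr_gt0.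
have [n] := ltr_add_invr e2; rewrite add0r => ne.
have n0 : 0 < n.+1%:R^-1 :> R by rewrite invr_gt0.
have /choice[q qx] i : exists q : rat, `|x 0 i - ratr q| < n.+1%:R^-1.
  have /rat_in_itvoo[q] : x 0 i - n.+1%:R^-1 < x 0 i + n.+1%:R^-1.
    by rewrite ltrD2l gtrN.
  by rewrite in_itv/= => qx; exists q; rewrite distrC ltr_distl.
have cx : ball (map_mx ratr (\row_i q i) : 'rV[R]_d) n.+1%:R^-1 x.
  by split=> // i j; rewrite ord1 !mxE /ball/= distrC; exact: qx.
exists (\row_i q i, n); split => // y cy; apply: xeU.
apply: (@le_ball _ _ _ (n.+1%:R^-1 + n.+1%:R^-1)); first by rewrite [leRHS]splitr ltW//
  ltrD.
exact: ball_triangle (ball_sym cx) cy.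
Qed.

Section density.
Context {R : realType} {d : nat}.
Local Notation T := 'rV[R]_d.
Variables (A : set T) (f : T -> R) (nu : probability T R).
Hypotheses (d_gt0 : (0 < d)%N) (A_compact : compact A) (nu_density : has_density nu f)
  (nu_support : measure_support nu = A) (f_cont : {within A, continuous f})
  (f0_gt0 : 0 < inf (f @` A)).

Lemma compact_rV_measurable : measurable A.
Proof.
rewrite -(setCK A); apply: measurableC; apply: open_rV_measurable.
apply: closed_openC; apply: compact_closed => //; exact: norm_hausdorff.
Qed.

Lemma density_diffuse z : nu [set z] = 0%E.
Proof.
have [mf f0 ->] := nu_density; last exact: measurable_rV_set1.
apply: null_set_integral; first exact: measurable_rV_set1.
  by apply/measurable_EFinP; exact: measurable_funTS.
exact: lebesgue_set1.
Qed.

(** Every point outside the support has a null neighbourhood, which can be taken among countably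
    many rational balls. *)
Lemma density_support : nu (~` A) = 0%E.
Proof.
pose B (p : 'rV[rat]_d * nat) : set T := ball (map_mx ratr p.1 : T) (p.2.+1%:R^-1).
have oB p : open (B p) by apply: ball_open; rewrite invr_gt0.
(* Null rational balls listed by the code of their centre and radius; other codes give the empty
   set. *)
pose F n : set T := if choice.unpickle n is Some p then
  if nu (B p) == 0%E then B p else set0 else set0.
have nF n : nu.-negligible (F n).
  rewrite /F; case: choice.unpickle => [p|]; last exact: negligible_set0.
  case: eqP => [Bp|_]; last exact: negligible_set0.
  by apply/negligibleP => //; exact: open_rV_measurable.
apply/negligibleP; first exact: measurableC compact_rV_measurable.
apply: negligibleS (negligible_bigcup nF) => x Ax.
have [U [oU Ux U0]] : exists U, [/\ open U, U x & nu U = 0%E].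
  apply: contrapT => h; apply: Ax; rewrite -nu_support => U oU Ux.
  by rewrite lt0e measure_ge0 andbT; apply/eqP => U0; apply: h; exists U.
have [p [px pU]] := rational_ball oU Ux.
exists (choice.pickle p) => //; rewrite /F choice.pickleK ifT//.
by rewrite -measure_le0 -U0 le_measure// inE; exact: open_rV_measurable.
Qed.

Lemma density_bounds : exists2 M, 0 < M &
  (forall Q, measurable Q -> (nu Q <= M%:E * lebesgue_rV d Q)%E) /\
  (forall Q, measurable Q -> Q `<=` A -> ((inf (f @` A))%:E * lebesgue_rV d Q <= nu Q)%E).
Proof.
have [mf f0 nuE] := nu_density.
have mA := compact_rV_measurable.
have A0 : A !=set0.
  apply/set0P/negP => /eqP A0; move: density_support.
  by rewrite A0 setC0 probability_setT => /eqP; rewrite onee_eq0.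
have [a /set_mem Aa amax] := EVT_max_rV A0 A_compact f_cont.
have lb : has_lbound (f @` A) by exists 0 => _ [x _ <-].
have finf x : A x -> inf (f @` A) <= f x by move=> Ax; apply: ge_inf => //; exists x.
exists (f a); first exact: lt_le_trans f0_gt0 (finf _ Aa).
have mfE B : measurable_fun B (fun x => (f x)%:E).
  by apply/measurable_EFinP; exact: measurable_funTS.
split=> [Q mQ|Q mQ QA].
  have mQA : measurable (Q `&` A) by exact: measurableI.
  (* [f] is bounded by its maximum on [A] only, but [nu] does not charge the complement. *)
  have nuQ : nu Q = nu (Q `&` A).
    apply/eqP; rewrite eq_le; apply/andP; split; last first.
      by apply: le_measure; rewrite ?inE//; exact: subIsetl.
    rewrite -[leRHS]adde0 -density_support.
    apply: (@le_trans _ _ (nu ((Q `&` A) `|` ~` A))).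
      apply: le_measure; rewrite ?inE//.
        by apply: measurableU => //; exact: measurableC.
      by move=> x Qx; have [Ax|Ax] := pselect (A x); [left|right].
    by apply: measureU2 => //; exact: measurableC.
  rewrite nuQ nuE//; apply: (@le_trans _ _ (\int[lebesgue_rV d]_(x in Q `&` A) (f a)%:E)%E).
    apply: ge0_le_integral => //.
    - by move=> x _; rewrite lee_fin.
    - by move=> x [_ Ax]; rewrite lee_fin amax// inE.
  rewrite integral_cst// lee_wpmul2l ?lee_fin//.
  by apply: le_measure; rewrite ?inE//; exact: subIsetl.
rewrite nuE// -integral_cst//; apply: ge0_le_integral => //.
- by move=> x _; rewrite lee_fin ltW.
- by move=> x /QA Ax; rewrite lee_fin finf.
Qed.

End density.

(** * Null transversals *)

Lemma lebesgue_translation (R : realType) (c : R) (A : set (measurableTypeR R)) :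
  measurable A -> lebesgue_measure ((fun x => x + c) @^-1` A) = lebesgue_measure A.
Proof.
have mc : measurable_fun setT (fun x : measurableTypeR R => x + c : measurableTypeR R).
  by apply: measurable_funD.
move=> mA.
rewrite -[LHS]/(pushforward lebesgue_measure
  ((fun x : R => x + c) : _ -> measurableTypeR R) A).
apply/esym/lebesgue_measure_unique => //= _ [[a b]] _ <-.
rewrite /pushforward (_ : _ @^-1` _ = `]a - c, b - c]%classic).
  rewrite !lebesgue_measure_itv/= !lte_fin ltrD2r.
  by case: ifPn => // _; rewrite -!EFinB; congr EFin; ring.
by apply/seteqP; split => x /=; rewrite !in_itv/= ltrBlDr lerBrDr.
Qed.

Section translation.
Context {R : realType} {d : nat}.
Local Notation T := 'rV[R]_d.

Lemma measurable_addv (v : T) : measurable_fun setT (fun x : T => x + v).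
Proof.
apply: measurable_fun_rV => i.
rewrite (_ : (fun _ => _) = (fun x : T => x 0 i + v 0 i)).
  by apply: measurable_funD => //; exact: measurable_rV_coord.
by apply/funext => x; rewrite mxE.
Qed.

(** Both measures agree on boxes by invariance in each coordinate, and boxes form a generating
    pi-system. *)
Lemma lebesgue_rV_translation (v : T) (E : set T) : measurable E ->
  lebesgue_rV d ((fun x => x + v) @^-1` E) = lebesgue_rV d E.
Proof.
pose G : set (set T) := [set E | exists B : 'I_d -> set (measurableTypeR R),
  (forall i, measurable (B i)) /\ E = [set x : T | forall i, B i (x 0 i)]].
move=> mE; symmetry.
pose g n : set T := cube 0 n%:R.
apply: (@g_sigma_algebra_measure_unique _ R T G _ g _ _ (lebesgue_rV d)
  (pushforward (lebesgue_rV d) (fun x => x + v))) => //.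
- by move=> _ [B [mB ->]]; exact: measurable_rV_box.
- move=> n; exists (fun i => `[0 - n%:R, 0 + n%:R]%classic); split.
    by move=> i; exact: measurable_itv.
  by apply/seteqP; split => x /= h i; have := h i; rewrite mxE.
- apply/seteqP; split => // x _.
  have [n xn] : exists n : nat, \sum_(i < d) `|x 0 i| <= n%:R.
    exists (Num.bound (\sum_(i < d) `|x 0 i|)).
    by rewrite ltW// archi_boundP// sumr_ge0.
  exists n => // i; rewrite /= in_itv/= mxE sub0r add0r -ler_norml.
  apply: le_trans xn; rewrite (bigD1 i)//= lerDl.
  exact: sumr_ge0.
- exact: measurable_addv.
- move=> _ _ [B [mB ->]] [B' [mB' ->]]; exists (fun i => B i `&` B' i); split.
    by move=> i; exact: measurableI.
  apply/seteqP; split => x /=; first by move=> [h h'] i; split.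
  by move=> h; split => i; have [] := h i.
- move=> ? _ [B [mB ->]]; apply: (etrans (lebesgue_rV_box mB)).
  have mB' i : measurable ((fun y : measurableTypeR R => y + v 0 i) @^-1` B i).
    rewrite -[X in measurable X]setTI.
    have mc : measurable_fun setT
      (fun x : measurableTypeR R => x + v 0 i : measurableTypeR R).
      by apply: measurable_funD.
    by apply: mc => //; exact: mB.
  rewrite [RHS](_ : _ = lebesgue_rV d
     [set x : T | forall i, ((fun y => y + v 0 i) @^-1` B i) (x 0 i)]); last first.
    congr (lebesgue_rV d _).
    by apply/seteqP; split => x /= h i; have := h i; rewrite mxE.
  apply/esym; apply: (etrans (lebesgue_rV_box mB')).
  by apply: eq_bigr => i _; exact: lebesgue_translation.
- move=> n; have gn := lebesgue_cube 0 (ler0n R n).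
  by apply: (@le_lt_trans _ _ ((2 * n%:R) ^+ d)%:E); rewrite ?ltry// -gn.
- move: E mE; apply: smallest_sub; first exact: smallest_sigma_algebra.
  move=> E; rewrite -bigcup_seq => -[i _ [B mB <-]]; apply: sub_sigma_algebra.
  exists (fun j => if j == i then B else setT); split; first by move=> j; case: ifP.
  apply/seteqP; split => x /=.
    by move=> [_ Bx] j; case: eqP => // ->.
  by move=> /(_ i); rewrite eqxx.
Qed.

(* Infinitely many disjoint translates of [G] by multiples of [e] fit in a bounded set. *)
Lemma null_transversal (G : set T) (e c : T) (s : R) : measurable G ->
  G `<=` cube c s ->
  (forall x y t, G x -> G y -> y = x + t *: e -> t = 0) -> lebesgue_rV d G = 0%E.
Proof.
move=> mG Gc tr.
(* Distinct steps of size at most [1]: all translates stay in one cube, of half-side [|s| + |e|]. *)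
pose tau n : R := n.+1%:R^-1.
pose F n : set T := (fun x => x + tau n *: e) @^-1` G.
have mF n : measurable (F n).
  by rewrite -[X in measurable X]setTI; apply: measurable_addv.
pose s' := `|s| + enorm e.
have s'0 : 0 <= s' by rewrite addr_ge0// enorm_ge0.
have Fc n : F n `<=` cube c s'.
  move=> x /Gc h i; have := h i; rewrite /= !in_itv/= !mxE.
  have : `|tau n * e 0 i| <= enorm e.
    rewrite normrM ger0_norm ?invr_ge0// (le_trans _ (coord_enorm e i))//.
    by rewrite ler_piMl// invf_le1// ler1n.
  rewrite ler_norml /s' => /andP[]; have := ler_norm s.
  move: (tau n * e 0 i) (enorm e) (x 0 i) (c 0 i) `|s| => a b x' c' s1.
  by move=> ? ? ? /andP[? ?]; apply/andP; split; lra.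
have tF : trivIset setT F.
  apply/trivIsetP => i j _ _ ij; apply/seteqP; split => // x [/= Fi Fj].
  have /(tr _ _ _ Fi Fj) /eqP : x + tau j *: e = x + tau i *: e + (tau j - tau i) *: e.
    by rewrite scalerBl addrCA -addrA subrr addr0 addrC.
  rewrite subr_eq0 => /eqP /invr_inj /eqP; rewrite eqr_nat eqSS => /eqP ji.
  by move/eqP : ij; rewrite ji.
have FG n : lebesgue_rV d (F n) = lebesgue_rV d G by exact: lebesgue_rV_translation.
have le n : (n%:R%:E * lebesgue_rV d G <= ((2 * s') ^+ d)%:E)%E.
  rewrite -(lebesgue_cube c s'0).
  apply: (@le_trans _ _ (lebesgue_rV d (\big[setU/set0]_(i < n) F i))).
    rewrite measure_bigsetU// (eq_bigr (fun=> lebesgue_rV d G)); last by move=> i _;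
      exact: FG.
    by rewrite sumr_const card_ord mule_natl.
  apply: le_measure; rewrite ?inE; [exact: bigsetU_measurable|exact: measurable_cube|].
  by rewrite -bigcup_mkord => x [i _ /Fc].
have fin : lebesgue_rV d G \is a fin_num.
  by rewrite ge0_fin_numE// (le_lt_trans (y := ((2 * s') ^+ d)%:E))// ?ltry//
    -[leLHS]mul1e; exact: (le 1%N).
move: le; rewrite -(fineK fin) => le.
have m0 : 0 <= fine (lebesgue_rV d G) by exact: fine_ge0.
congr EFin; apply/eqP; rewrite eq_le m0 andbT leNgt; apply/negP => mp.
set m := fine _ in le mp; set C := (2 * s') ^+ d in le.
have := le (Num.bound (C / m)); rewrite -EFinM lee_fin leNgt => /negP; apply.
by rewrite -ltr_pdivrMr// archi_boundP// divr_ge0 ?exprn_ge0 ?mulr_ge0// ltW.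
Qed.

End translation.

(** * Interior cones *)

Section lipschitz.
Context {R : realType} {m : nat}.
Local Notation T := 'rV[R]_m.
Variables (V : set T) (phi : T -> R) (u0 : T).
Hypotheses (oV : open V) (Vu0 : V u0) (phiC11 : C11_on V phi).

Lemma enorm_ball (U : set T) (x : T) : nbhs x U ->
  exists2 s, 0 < s & forall y, enorm (y - x) < s -> U y.
Proof.
move=> /nbhs_ballP[s /= s0 xsU]; exists s => // y xy; apply: xsU.
split => // i j; rewrite ord1 /ball/=.
by have := le_lt_trans (coord_enorm (y - x) j) xy; rewrite !mxE distrC.
Qed.

Lemma ball_enorm (x : T) (s : R) : 0 < s -> nbhs x [set y | enorm (y - x) < s].
Proof.
move=> s0; apply/nbhs_ballP; exists (s / m.+1%:R) => /=; first by rewrite divr_gt0.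
move=> y [_ xy] /=.
have y_cube : cube x (s / m.+1%:R) y.
  move=> i; have := xy 0 i; rewrite /ball/= in_itv/= distrC ltr_norml.
  by move: (s / m.+1%:R) => e /andP[h1 h2]; apply/andP; split; lra.
have := cube_enorm_ball (divr_ge0 (ltW s0) (ler0n R m.+1)) y_cube => /= h.
apply: le_lt_trans h _; by rewrite mulrCA gtr_pMr// ltr_pdivrMr// mul1r ltr_nat.
Qed.

Lemma enorm_le_norm (x : T) (s : R) : enorm x < s -> `|x| <= s.
Proof.
move=> xs; have s0 : 0 <= s by rewrite (le_trans (enorm_ge0 x))// ltW.
have : ball (0 : T) s x.
  split; first exact: le_lt_trans (enorm_ge0 x) xs.
  by move=> i j; rewrite ord1 /ball/= mxE sub0r normrN (le_lt_trans (coord_enorm x j)).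
by rewrite -ball_normE/= sub0r normrN => /ltW.
Qed.

(** Lipschitz partial derivatives vary boundedly on a small ball, and each is compared with its
    value at [u0]. *)
Lemma partial_bound : exists2 s, 0 < s & exists2 K, 0 <= K &
  forall u, enorm (u - u0) < s -> V u /\ forall i, `|'D_(delta_mx 0 i) phi u| <= K.
Proof.
have [_ lip] := phiC11.
have [s s0 sV] := enorm_ball (open_nbhs_nbhs (conj oV Vu0)).
have /choice[M MP] i : exists M, 0 <= M /\ forall u, V u ->
    `|'D_(delta_mx 0 i) phi u - 'D_(delta_mx 0 i) phi u0| <= M * `|u - u0|.
  have [M0 [_ MP]] := lip i.
  (* The Lipschitz property holds for every constant above some [M0]; this one is also
     nonnegative. *)
  exists (`|M0| + 1); split; first by rewrite addr_ge0.
  move=> u Vu; have /MP : M0 < `|M0| + 1 by rewrite ltr_pwDr// ler_norm.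
  by move=> /(_ (u, u0)); apply; split.
exists s => //; exists (\sum_i (`|'D_(delta_mx 0 i) phi u0| + M i * s)).
  by apply: sumr_ge0 => i _; have [Mi0 _] := MP i; rewrite addr_ge0// mulr_ge0// ltW.
move=> u us; have Vu := sV _ us; split => // i.
have [Mi0 Mi] := MP i.
rewrite (bigD1 i)//= -[leLHS]addr0 lerD//; last first.
  apply: sumr_ge0 => j _; have [Mj0 _] := MP j.
  by rewrite addr_ge0// mulr_ge0// ltW.
have tri (x y : R) : `|x| <= `|y| + `|x - y|.
  by rewrite (le_trans _ (ler_normD _ _))// addrC subrK.
apply: le_trans (tri _ ('D_(delta_mx 0 i) phi u0)) _; rewrite lerD2l.
apply: (le_trans (Mi _ Vu)); apply: ler_wpM2l => //; exact: enorm_le_norm.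
Qed.

Lemma derive_line (u w : T) (s : R) : differentiable phi (u + s *: w) ->
  is_derive s 1 (fun t : R => phi (u + t *: w)) ('D_w phi (u + s *: w)).
Proof.
move=> dphi.
have E : (fun h : R => h^-1 *: (((fun t : R => phi (u + t *: w)) \o shift s) (h *:
  (1 : R)) -
            phi (u + s *: w))) =
         (fun h : R => h^-1 *: ((phi \o shift (u + s *: w)) (h *: w) - phi (u + s *: w))).
  apply/funext => h /=; congr (_ *: (phi _ - _)).
  by rewrite (_ : h *: (1 : R) = h); [rewrite scalerDl addrCA|exact: mulr1].
split.
  rewrite /derivable E; exact: diff_derivable.
by rewrite /derive E.
Qed.

(** Mean value theorem along the segment, which stays in the ball by convexity; the constant sums
    the [m] partial bounds. *)
Lemma local_lipschitz : exists2 s, 0 < s & exists2 L, 0 <= L &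
  (forall u, enorm (u - u0) < s -> V u) /\
  forall u v, enorm (u - u0) < s -> enorm (v - u0) < s ->
  `|phi v - phi u| <= L * enorm (v - u).
Proof.
have [s s0 [K K0 sK]] := partial_bound.
exists s => //; exists (m%:R * K); first by rewrite mulr_ge0.
split=> [u /sK[]//|u v us vs].
pose w := v - u.
have seg (t : R) : 0 <= t <= 1 -> enorm (u + t *: w - u0) < s.
  move=> t01; have -> : u + t *: w = (1 - t) *: u + t *: v.
    by apply/rowP => i; rewrite /w !mxE; ring.
  exact: enorm_convex.
have [dphi _] := phiC11.
have der (t : R) : 0 <= t <= 1 -> is_derive t 1 (fun t : R => phi (u + t *: w))
  ('D_w phi (u + t *: w)).
  by move=> /seg/sK[Vt _]; apply: derive_line; exact: dphi.
have [t tin] : exists2 t : R, t \in `[0, 1] & phi (u + 1 *: w) - phi (u + 0 *: w) =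
    'D_w phi (u + t *: w) * (1 - 0).
  apply: (@MVT_segment R (fun t : R => phi (u + t *: w)) (fun t => 'D_w phi
    (u + t *: w))) => //.
    by move=> t; rewrite in_itv/= => /andP[t0 t1]; apply: der; rewrite !ltW.
  apply: derivable_within_continuous => t; rewrite in_itv/= => /der.
  by move=> /@ex_derive.
rewrite in_itv/= in tin.
rewrite scale1r scale0r addr0 addrCA subrr addr0 subr0 mulr1 => ->.
have [Vt Dt] := sK _ (seg _ tin).
have wE : w = \sum_i w 0 i *: delta_mx 0 i by exact: row_sum_delta.
rewrite deriveE; last exact: dphi.
rewrite wE linear_sum -wE; apply: le_trans (ler_norm_sum _ _ _) _.
rewrite -mulrA -[m in m%:R]card_ord mulr_natl -sumr_const; apply: ler_sum => i _.
rewrite linearZ/= normrM mulrC; apply: ler_pM => //; last exact: coord_enorm.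
by rewrite -deriveE//; exact: dphi.
Qed.

End lipschitz.

(** * Coordinates adapted to a boundary chart *)

Section rotated_coordinates.
Context {R : realType} {d : nat}.
Local Notation T := 'rV[R]_d.
Variables (Q : 'M[R]_d) (l : 'I_d).
Hypothesis Qrot : rotation Q.

Definition base (x : T) : 'rV[R]_d.-1 := col' l (x *m Q).
Definition height (x : T) : R := (x *m Q) 0 l.
Definition unrotate (u : 'rV[R]_d.-1) (t : R) : T :=
  (\row_j if unlift l j is Some j' then u 0 j' else t) *m Q^T.

Lemma baseD x y : base (x + y) = base x + base y.
Proof. by apply/rowP => j; rewrite /base mulmxDl !mxE. Qed.

Lemma baseZ a x : base (a *: x) = a *: base x.
Proof. by apply/rowP => j; rewrite /base -scalemxAl !mxE. Qed.

Lemma baseN x : base (- x) = - base x.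
Proof. by rewrite -scaleN1r baseZ scaleN1r. Qed.

Lemma heightD x y : height (x + y) = height x + height y.
Proof. by rewrite /height mulmxDl !mxE. Qed.

Lemma heightZ a x : height (a *: x) = a * height x.
Proof. by rewrite /height -scalemxAl !mxE. Qed.

Lemma heightN x : height (- x) = - height x.
Proof. by rewrite -scaleN1r heightZ mulN1r. Qed.

Lemma unrotateK u t : unrotate u t *m Q = \row_j if unlift l j is Some j' then u 0 j'
  else t.
Proof. by rewrite /unrotate -mulmxA (mulmx1C Qrot.1) mulmx1. Qed.

Lemma base_unrotate u t : base (unrotate u t) = u.
Proof. by apply/rowP => j; rewrite /base unrotateK !mxE liftK. Qed.

Lemma height_unrotate u t : height (unrotate u t) = t.
Proof. by rewrite /height unrotateK mxE unlift_none. Qed.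

Lemma rotate_inj (x y : T) : base x = base y -> height x = height y -> x = y.
Proof.
move=> bxy hxy; suff E : x *m Q = y *m Q.
  by rewrite -[x]mulmx1 -[y]mulmx1 -Qrot.1 !mulmxA E.
apply/rowP => j; case: (unliftP l j) => [j' ->|-> //].
by have := congr1 (fun u : 'rV_d.-1 => u 0 j') bxy; rewrite !mxE.
Qed.

Lemma enorm_split (x : T) : enorm x ^+ 2 = enorm (base x) ^+ 2 + height x ^+ 2.
Proof.
have rot : dot (x *m Q) (x *m Q) = dot x x.
  have dotE (y z : T) : dot y z = (y *m z^T) 0 0.
    by rewrite mxE; apply: eq_bigr => i _; rewrite mxE.
  by rewrite !dotE trmx_mul mulmxA -(mulmxA x) Qrot.1 mulmx1.
rewrite enorm_sqr -rot /dot (bigD1_ord l)//= addrC -expr2; congr (_ + _).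
rewrite enorm_sqr; apply: eq_bigr => j _.
by rewrite /base [in RHS]mxE.
Qed.

Lemma enorm_base x : enorm (base x) <= enorm x.
Proof.
rewrite -(@ler_pXn2r _ 2)// ?nnegrE ?enorm_ge0//.
by rewrite [leRHS]enorm_split lerDl sqr_ge0.
Qed.

Lemma abs_height x : `|height x| <= enorm x.
Proof.
rewrite -(@ler_pXn2r _ 2)// ?nnegrE ?enorm_ge0//.
by rewrite [leRHS]enorm_split real_normK ?num_real// lerDr sqr_ge0.
Qed.

Lemma enorm_le_split x : enorm x <= enorm (base x) + `|height x|.
Proof.
rewrite -(@ler_pXn2r _ 2)// ?nnegrE ?addr_ge0 ?enorm_ge0//.
rewrite enorm_split sqrrD real_normK ?num_real// -addrA lerD2l lerDr.
by rewrite mulrn_wge0// mulr_ge0// enorm_ge0.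
Qed.

End rotated_coordinates.

(** On [K] the closed set [A] coincides with its interior, so its trace is open and closed in
    [K]. *)
Lemma connected_avoid (R : realType) m (K A : set 'rV[R]_m) x y :
  connected K -> closed A -> (forall z, K z -> ~ boundary A z) ->
  K x -> K y -> A x -> A y.
Proof.
move=> cK cA KA Kx Ky Ax; suff KAK : K `&` A = K.
  by have : K y by []; rewrite -KAK => -[].
apply: cK; first by exists x.
- exists (interior A); first exact: open_interior.
  apply/seteqP; split => z [Kz Az]; split => //; last exact: interior_subset.
  apply: contrapT => nAz; apply: (KA _ Kz); split => //.
  exact: subset_closure.
- by exists A.
Qed.

Lemma lipschitz_path (R : realType) m (g : R -> 'rV[R]_m) (C : R) :
  (forall s t, 0 <= s <= 1 -> 0 <= t <= 1 -> enorm (g t - g s) <= C * `|t - s|) ->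
  connected [set g t | t in `[0, 1]%classic].
Proof.
move=> gC; apply: connected_continuous_connected; first exact: segment_connected.
apply/subspace_continuousP => s; rewrite /= in_itv/= => s01.
move=> U /enorm_ball[e e0 eU]; rewrite /= nbhs_filterE.
have C0 : 0 < `|C| + 1 by rewrite ltr_pwDr.
apply/nbhs_ballP; exists (e / (`|C| + 1)) => /=; first by rewrite divr_gt0.
move=> t st; rewrite /= in_itv/= => t01; apply: eU.
apply: le_lt_trans (gC _ _ s01 t01) _.
move: st; rewrite /ball/= distrC ltr_pdivlMr// mulrC => h; apply: le_lt_trans h.
by rewrite ler_wpM2r// (le_trans (ler_norm C))// lerDl.
Qed.

Section boundary_chart.
Context {R : realType} {d : nat}.
Local Notation T := 'rV[R]_d.
Variables (A U : set T) (Q : 'M[R]_d) (l : 'I_d) (V : set 'rV[R]_d.-1)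
  (phi : 'rV[R]_d.-1 -> R) (a : T).
Hypotheses (A_closed : closed A) (bd_a : boundary A a) (Ua : nbhs a U)
  (Qrot : rotation Q) (oV : open V) (phiC11 : C11_on V phi)
  (chart : [set y *m Q | y in boundary A `&` U] = graph_over l V phi).
Local Notation base := (base Q l).
Local Notation height := (height Q l).

(** Signed vertical distance to the graph; its sign tells the two sides of the boundary apart. *)
Definition gap x := height x - phi (base x).

Lemma chart_center : V (base a) /\ gap a = 0.
Proof.
have : graph_over l V phi (a *m Q).
  by rewrite -chart; exists a => //; split => //; exact: nbhs_singleton.
by move=> [Va ha]; split => //; rewrite /gap /height ha subrr.
Qed.

(** Near [a] the boundary is the zero set of [gap]. Each side is path connected and misses the
    boundary, hence lies entirely in [A] or entirely outside. *)
Lemma chart_sides : exists2 rho, 0 < rho & exists2 L, 0 <= L &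
  [/\ forall u v, enorm (u - base a) < rho -> enorm (v - base a) < rho ->
       `|phi v - phi u| <= L * enorm (v - u),
     forall x, enorm (base x - base a) < rho -> `|gap x| < rho ->
       (boundary A x <-> gap x = 0) &
     forall c, c = 1 \/ c = -1 ->
       let side x := [/\ enorm (base x - base a) < rho, `|gap x| < rho & 0 < c * gap x] in
       (side `<=` A) \/ (forall x, side x -> ~ A x)].
Proof.
have [Va gap_a] := chart_center.
have [s0 s00 [L L0 [sV lip]]] := local_lipschitz oV Va phiC11.
have [s1 s10 sU] := enorm_ball Ua.
(* Being in [U] costs [rho] for the base, [rho] for the gap and [L * rho] for the variation of
   [phi]. *)
pose rho := Num.min s0 (s1 / (L + 2)).
have L2 : 0 < L + 2 by rewrite ltr_wpDl.
have rho0 : 0 < rho by rewrite lt_min s00 divr_gt0.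
have rs0 : rho <= s0 by rewrite ge_min lexx.
have rs1 : rho * (L + 2) <= s1 by rewrite -ler_pdivlMr// ge_min lexx orbT.
have inU x : enorm (base x - base a) < rho -> `|gap x| < rho -> U x.
  move=> bx gx; apply: sU; apply: le_lt_trans (enorm_le_split l Qrot _) _.
  rewrite baseD baseN heightD heightN.
  have ha : height a = phi (base a) by apply/eqP; rewrite -subr_eq0; apply/eqP.
  have lx := lip (base a) (base x) _ (lt_le_trans bx rs0).
  have {}lx : `|phi (base x) - phi (base a)| <= L * enorm (base x - base a).
    by apply: lx; rewrite subrr enorm0.
  have -> : height x - height a = gap x + (phi (base x) - phi (base a)).
    by rewrite /gap ha; ring.
  have tri := ler_normD (gap x) (phi (base x) - phi (base a)).
  have Lb : L * enorm (base x - base a) <= L * rho by rewrite ler_wpM2l// ltW.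
  have rs1' : rho * L + rho * 2 <= s1 by rewrite -mulrDr.
  by move: tri Lb rs1' bx gx lx; rewrite (mulrC rho L); lra.
have bdE x : enorm (base x - base a) < rho -> `|gap x| < rho ->
    (boundary A x <-> gap x = 0).
  move=> bx gx; have Ux := inU x bx gx; split.
    move=> bdx; have [_ hx] : graph_over l V phi (x *m Q).
      by rewrite -chart; exists x.
    by rewrite /gap /height hx subrr.
  move=> g0; have : graph_over l V phi (x *m Q).
    split; first by apply: sV; exact: lt_le_trans bx rs0.
    by apply/eqP; rewrite -subr_eq0; apply/eqP.
  rewrite -chart => -[y [bdy _] yx]; suff <- : y = x by [].
  by rewrite -[y]mulmx1 -[x]mulmx1 -Qrot.1 !mulmxA yx.
exists rho => //; exists L => //; split => //.
  by move=> u v us vs; apply: lip; [exact: lt_le_trans us rs0|exact: lt_le_trans vs rs0].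
move=> c c1 side.
have [[x0 [sx0 Ax0]]|none] := pselect (exists x, side x /\ A x); last first.
  by right => x sx Ax; apply: none; exists x.
left => y sy; case: (sx0) => bx gx cx; case: (sy) => by_ gy cy.
(* Base and gap, rather than base and height, are interpolated linearly: the path follows the graph
   and its gap keeps its sign. *)
pose u (t : R) := (1 - t) *: base x0 + t *: base y.
pose g (t : R) := (1 - t) * gap x0 + t * gap y.
pose path (t : R) := unrotate Q l (u t) (phi (u t) + g t).
have bpath t : base (path t) = u t by exact: base_unrotate.
have hpath t : height (path t) = phi (u t) + g t by exact: height_unrotate.
have gpath t : gap (path t) = g t by rewrite /gap bpath hpath; ring.
have u_in t : 0 <= t <= 1 -> enorm (u t - base a) < rho.
  by move=> t01; exact: enorm_convex.
have side_path t : 0 <= t <= 1 -> side (path t).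
  move=> t01; rewrite /side bpath gpath; split; first exact: u_in.
    move: gx gy; rewrite !ltr_norml => /andP[x1 x2] /andP[y1 y2].
    apply/andP; split; last exact: convex_lt.
    rewrite ltrNl opprD -!mulrN; apply: convex_lt => //; by rewrite ltrNl.
  rewrite -oppr_lt0 /g mulrDr opprD !(mulrCA c) -!mulrN.
  by apply: convex_lt => //; rewrite mulrN oppr_lt0.
have path0 : path 0 = x0.
  apply: (rotate_inj (l := l) Qrot); rewrite ?bpath ?hpath /u /g !(subr0, scale1r,
    scale0r, addr0) //.
  by rewrite mul1r mul0r addr0 /gap addrC subrK.
have path1 : path 1 = y.
  apply: (rotate_inj (l := l) Qrot); rewrite ?bpath ?hpath /u /g !(subrr, scale1r,
    scale0r, add0r) //.
  by rewrite mul1r mul0r add0r /gap addrC subrK.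
have path_lip s t : 0 <= s <= 1 -> 0 <= t <= 1 -> enorm (path t - path s) <=
   (enorm (base y - base x0) + (L * enorm
     (base y - base x0) + `|gap y - gap x0|)) * `|t - s|.
  move=> s01 t01; apply: le_trans (enorm_le_split l Qrot _) _.
  rewrite baseD baseN heightD heightN !bpath !hpath.
  have uE : u t - u s = (t - s) *: (base y - base x0).
    by apply/rowP => i; rewrite !mxE; ring.
  have -> : phi (u t) + g t - (phi (u s) + g s) =
      (phi (u t) - phi (u s)) + (t - s) * (gap y - gap x0) by rewrite /g; ring.
  rewrite [leRHS]mulrDl; apply: lerD; first by rewrite uE enormZ mulrC.
  apply: le_trans (ler_normD _ _) _; rewrite [leRHS]mulrDl lerD//;
    last by rewrite normrM mulrC.
  have := lip (u s) (u t) (lt_le_trans (u_in _ s01) rs0) (lt_le_trans (u_in _ t01) rs0).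
  by rewrite uE enormZ mulrCA mulrC.
apply: (connected_avoid (lipschitz_path path_lip) A_closed _ _ _ Ax0).
- move=> z [t] /=; rewrite in_itv/= => t01 <-.
  have [bt gt ct] := side_path _ t01.
  by move=> /(bdE _ bt gt) g0; move: ct; rewrite g0 mulr0 ltxx.
- by exists 0 => //; rewrite /= in_itv/= lexx ler01.
- by exists 1 => //; rewrite /= in_itv/= lexx ler01.
Qed.

End boundary_chart.

(** * Inner directions of the support *)

Section interior_cones.
Context {R : realType} {d : nat}.
Local Notation T := 'rV[R]_d.
Variables (A : set T) (f : T -> R) (nu : probability T R).
Hypotheses (d_gt0 : (0 < d)%N) (A_compact : compact A) (nu_density : has_density nu f)
  (nu_support : measure_support nu = A) (f_cont : {within A, continuous f})
  (f0_gt0 : 0 < inf (f @` A)) (A_C11 : (2 <= d)%N -> C11_boundary A)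
  (A_itv : d = 1%N -> forall i : 'I_d, is_interval [set x 0 i | x in A]).

(** One direction for all points of [A] near [a] and all scales [r <= eps]; the shift [r / 2] is the
    one of [cap_inside] and [cap_outside]. *)
Definition cone_at (eps : R) (a : T) : Prop :=
  exists2 e, enorm e = 1 & forall z, A z -> enorm (z - a) <= eps ->
    forall r, 0 < r <= eps -> forall y, enorm (y - (z + (r / 2) *: e)) <= eps * r -> A y.

Lemma unit_vector (i : 'I_d) : enorm (delta_mx 0 i : T) = 1.
Proof.
apply/eqP; rewrite -(@eqrXn2 _ 2)// ?enorm_ge0//.
rewrite enorm_sqr /dot (bigD1 i)//= big1 ?addr0.
  by rewrite mxE !eqxx.
by move=> j /negbTE ji; rewrite mxE ji andbF mul0r.
Qed.

Lemma cone_step (a z y e : T) (r eps : R) : enorm e = 1 -> 0 < r <= eps -> eps <= 1 ->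
  enorm (z - a) <= eps -> enorm (y - (z + (r / 2) *: e)) <= eps * r ->
  enorm (y - a) <= 3 * eps.
Proof.
move=> e1 /andP[r0 re] eps1 za yz.
have h1 := enorm_triangle y (z + (r / 2) *: e) a.
have h2 : enorm (z + (r / 2) *: e - a) <= enorm (z - a) + r / 2.
  rewrite addrAC (le_trans (enormD _ _))// enormZ e1 mulr1 ger0_norm//.
  by rewrite divr_ge0// ltW.
by nra.
Qed.

Lemma cone_interior a : nbhs a A -> exists2 eps, 0 < eps & cone_at eps a.
Proof.
move=> /enorm_ball[s s0 sA].
pose eps := Num.min 1 (s / 4).
have eps0 : 0 < eps by rewrite lt_min ltr01 divr_gt0.
have eps1 : eps <= 1 by rewrite ge_min lexx.
have eps4 : eps <= s / 4 by rewrite ge_min lexx orbT.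
exists eps => //; exists (delta_mx 0 (Ordinal d_gt0)); first exact: unit_vector.
move=> z Az za r r0 y yz; apply: sA.
apply: le_lt_trans (cone_step (unit_vector _) r0 eps1 za yz) _.
by move: (eps) eps4 => e; move: s0; lra.
Qed.

(** The interval is not a single point, as points are null for [nu]. The direction goes from [a]
    towards another point [b] of [A], and the small ball lies between [z] and [b]. *)
Lemma cone_line a : d = 1%N -> A a -> exists2 eps, 0 < eps & cone_at eps a.
Proof.
move=> d1 Aa; pose i0 := Ordinal d_gt0.
have only (i : 'I_d) : i = i0 by apply/val_inj; case: i => m /=; rewrite d1; case: m.
have coordE (x : T) : enorm x = `|x 0 i0|.
  apply/eqP; rewrite -(@eqrXn2 _ 2)// ?enorm_ge0// enorm_sqr /dot (bigD1 i0)//=.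
  rewrite big1 ?addr0; first by rewrite real_normK ?num_real// expr2.
  by move=> i; rewrite (only i) eqxx.
have itv := @A_itv d1 i0.
have inA (x : T) : [set x 0 i0 | x in A] (x 0 i0) -> A x.
  by move=> [y Ay yx]; suff <- : y = x by []; apply/rowP => i; rewrite (only i).
have [b [Ab ab]] : exists b, A b /\ b 0 i0 != a 0 i0.
  apply: contrapT => none.
  have sub : A `<=` [set a].
    move=> x Ax; apply/rowP => i; rewrite (only i); apply: contrapT => xa.
    by apply: none; exists x; split => //; apply/eqP.
  have : nu (A `|` ~` A) = 1%E by rewrite setUv probability_setT.
  have mA := compact_rV_measurable A_compact.
  move=> nu1; have : (nu (A `|` ~` A) <= nu [set a] + nu (~` A))%E.
    apply: le_trans (measureU2 _ _ _) _ => //; first exact: measurableC.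
    by rewrite leeD2r// le_measure ?inE//; exact: measurable_rV_set1.
  rewrite nu1 (density_diffuse d_gt0 nu_density) add0e.
  rewrite (density_support A_compact nu_support).
  by rewrite lee_fin ler10.
pose s := `|b 0 i0 - a 0 i0|.
have s0 : 0 < s by rewrite normr_gt0 subr_eq0.
pose eps := Num.min (1 / 4) (s / 4).
have eps0 : 0 < eps by rewrite lt_min !divr_gt0.
have eps1 : eps <= 1 / 4 by rewrite ge_min lexx.
have eps4 : eps <= s / 4 by rewrite ge_min lexx orbT.
exists eps => //; exists (Num.sg (b 0 i0 - a 0 i0) *: delta_mx 0 i0).
  by rewrite enormZ unit_vector mulr1 normr_sg subr_eq0 ab.
move=> z Az; rewrite coordE !mxE => za r /andP[r0 re] y;
  rewrite coordE !mxE !eqxx mulr1 => yz.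
apply: inA.
have [zI bI] : [set x 0 i0 | x in A] (z 0 i0) /\ [set x 0 i0 | x in A] (b 0 i0).
  by split; [exists z|exists b].
have er : eps * r <= r / 4 by rewrite mulrC ler_pM2l// (le_trans eps1)// div1r.
have [ba|ba|/eqP] := ltgtP (b 0 i0) (a 0 i0); last by rewrite (negbTE ab).
  have sE : s = a 0 i0 - b 0 i0 by rewrite /s ltr0_norm ?subr_lt0// opprB.
  apply: (itv _ _ bI zI _); move: yz za s0 eps4; rewrite sE ltr0_sg ?subr_lt0//.
  rewrite !ler_norml => /andP[y1 y2] /andP[z1 z2] s0 eps4.
  by apply/andP; split; lra.
have sE : s = b 0 i0 - a 0 i0 by rewrite /s gtr0_norm ?subr_gt0.
apply: (itv _ _ zI bI _); move: yz za s0 eps4; rewrite sE gtr0_sg ?subr_gt0//.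
rewrite !ler_norml => /andP[y1 y2] /andP[z1 z2] s0 eps4.
by apply/andP; split; lra.
Qed.

Lemma compact_rV_closed : closed A.
Proof. by apply: compact_closed => //; exact: norm_hausdorff. Qed.

Lemma closed_boundary x : boundary A x -> A x.
Proof. by move=> [+ _]; rewrite -((closure_id A).1 compact_rV_closed). Qed.

(* A neighbourhood where [A] is a graph would be null, but every point of the
   support has neighbourhoods of positive probability. *)
Lemma not_a_graph (Q : 'M[R]_d) (l : 'I_d) (phi : 'rV[R]_d.-1 -> R) (a : T) (s : R) :
  rotation Q -> A a -> 0 < s ->
  (forall x, A x -> enorm (x - a) <= s -> gap Q l phi x = 0) -> False.
Proof.
move=> Qrot Aa s0 gr.
pose B := [set x : T | enorm (x - a) <= s].
have mB : measurable B by exact: measurable_cap.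
have mA := compact_rV_measurable A_compact.
have leb0 : lebesgue_rV d (A `&` B) = 0%E.
  apply: (@null_transversal _ _ _ (unrotate Q l 0 1) a s); first exact: measurableI.
    by move=> x [_ Bx]; apply: enorm_ball_cube; rewrite /= enormB.
  move=> x y t [Ax Bx] [Ay By] yx; have gx := gr _ Ax Bx; have := gr _ Ay By.
  rewrite yx /gap baseD heightD baseZ heightZ base_unrotate// height_unrotate//.
  by rewrite scaler0 addr0 mulr1; move: gx; rewrite /gap; lra.
have [M M0 [Mle _]] := density_bounds A_compact nu_density nu_support f_cont f0_gt0.
have nu0 : nu (A `&` B) = 0%E.
  have := Mle _ (measurableI _ _ mA mB); rewrite leb0 mule0 => h.
  by apply/eqP; rewrite eq_le h measure_ge0.
have Ba : nbhs a B.
  by apply: filterS (ball_enorm a s0) => x /= /ltW.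
have : (0 < nu (interior B))%E.
  have : measure_support nu a by rewrite nu_support.
  by apply; [exact: open_interior|exact: Ba].
rewrite ltNge => /negP; apply.
apply: (@le_trans _ _ (nu ((A `&` B) `|` ~` A))).
  apply: le_measure; rewrite ?inE.
  - by apply: open_rV_measurable; exact: open_interior.
  - by apply: measurableU; [exact: measurableI|exact: measurableC].
  - move=> x /interior_subset Bx.
    by have [Ax|nAx] := pselect (A x); [left|right].
apply: le_trans (measureU2 _ _ _) _; [exact: measurableI|exact: measurableC|].
have nuC := density_support A_compact nu_support.
have h1 : (nu (A `&` B) <= 0)%E by rewrite nu0.
have h2 : (nu (~` A) <= 0)%E by rewrite nuC.
by rewrite -[leRHS]adde0; exact: leeD h1 h2.
Qed.

(** The inner direction is the vertical of the chart, pointing to a side contained in [A]. The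
    argument does not require exactly one such side: two give a neighbourhood of [a] in [A], none is
    ruled out by [not_a_graph]. *)
Lemma cone_boundary a : (2 <= d)%N -> boundary A a ->
  exists2 eps, 0 < eps & cone_at eps a.
Proof.
move=> d2 bd_a; have Aa := closed_boundary bd_a.
have [U nU [Q [l [V [phi [Qrot _ oV C11 chart]]]]]] := A_C11 d2 bd_a.
have [_ gap_a] := chart_center bd_a nU chart.
have [rho rho0 [L L0 [lip bdE sides]]] :=
  chart_sides compact_rV_closed bd_a nU Qrot oV C11 chart.
pose m := Num.min 1 rho.
have m0 : 0 < m by rewrite lt_min ltr01.
have m1 : m <= 1 by rewrite ge_min lexx.
have mrho : m <= rho by rewrite ge_min lexx orbT.
(* Points within [3 * eps] of [a] stay in the chart, and since [eps * (1 + L) <= 1 / 10] a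
   displacement of size [eps * r] changes the gap by at most [r / 10]. *)
pose eps := m / (10 * (1 + L)).
have L1 : 0 < 1 + L by rewrite ltr_pwDl.
have eps0 : 0 < eps by rewrite divr_gt0// mulr_gt0.
have epsL : eps * (1 + L) = m / 10 by rewrite /eps; field; rewrite gt_eqF.
have epsL0 : 0 <= eps * L by rewrite mulr_ge0// ltW.
have eps10 : eps <= m / 10 by rewrite -epsL mulrDr mulr1 lerDl.
have base_a : enorm (base Q l a - base Q l a) < rho by rewrite subrr enorm0.
have gapB x z : enorm (base Q l x - base Q l a) < rho -> enorm
  (base Q l z - base Q l a) < rho ->
    `|gap Q l phi z - gap Q l phi x - (height Q l z - height Q l x)| <= L * enorm (z - x).
  move=> bx bz; have := lip _ _ bx bz.
  have -> : gap Q l phi z - gap Q l phi x - (height Q l z - height Q l x) =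
    - (phi (base Q l z) - phi (base Q l x)) by rewrite /gap; ring.
  rewrite normrN => h; apply: le_trans h _; rewrite ler_wpM2l//.
  by rewrite -baseN -baseD enorm_base.
have box x : enorm (x - a) <= 3 * eps ->
    enorm (base Q l x - base Q l a) < rho /\ `|gap Q l phi x| < rho.
  move=> xa; have bx : enorm (base Q l x - base Q l a) < rho.
    rewrite -baseN -baseD (le_lt_trans (enorm_base l Qrot _))// (le_lt_trans xa)//.
    by move: eps10 mrho rho0 m0; lra.
  split => //; have := gapB _ _ base_a bx; rewrite gap_a subr0 => g.
  have h : `|height Q l x - height Q l a| <= 3 * eps.
    by rewrite -heightN -heightD (le_trans (abs_height l Qrot _)).
  have Lx : L * enorm (x - a) <= 3 * (eps * L) by rewrite [leRHS](_ : _ = L *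
    (3 * eps)); [exact: ler_wpM2l|ring].
  have e1 : eps + eps * L = m / 10 by rewrite -epsL; ring.
  have tri := ler_normD (gap Q l phi x - (height Q l x - height Q l a))
    (height Q l x - height Q l a).
  rewrite subrK in tri.
  apply: le_lt_trans tri _; apply: le_lt_trans (lerD g h) _.
  apply: le_lt_trans (lerD Lx (lexx _)) _.
  by move: e1 mrho m0; lra.
have one_side c : c = 1 \/ c = -1 ->
    (forall x, [/\ enorm (base Q l x - base Q l a) < rho, `|gap Q l phi x| < rho &
       0 < c * gap Q l phi x] -> A x) ->
    (forall x, [/\ enorm (base Q l x - base Q l a) < rho, `|gap Q l phi x| < rho &
       0 < - c * gap Q l phi x] -> ~ A x) -> cone_at eps a.
  move=> c1 inA outA.
  have cc : c * c = 1 by case: c1 => ->; rewrite ?mulr1// mulrNN mulr1.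
  have cn : `|c| = 1 by case: c1 => ->; rewrite ?normrN normr1.
  have e1 : enorm (c *: unrotate Q l 0 1) = 1.
    rewrite enormZ cn mul1r; apply/eqP; rewrite -(@eqrXn2 _ 2)// ?enorm_ge0//.
    rewrite (enorm_split l Qrot) base_unrotate// height_unrotate// enorm0.
    by rewrite expr0n add0r.
  exists (c *: unrotate Q l 0 1) => // z Az za r rr y yz; have /andP[r0 re] := rr.
  have eps1 : eps <= 1 by move: eps10 m1; lra.
  have ya := cone_step e1 rr eps1 za yz.
  have [by_ gy] := box _ ya.
  have z3 : enorm (z - a) <= 3 * eps by move: za eps0; lra.
  have [bz gz] := box _ z3.
  have cz : 0 <= c * gap Q l phi z.
    rewrite leNgt; apply/negP => cz; apply: outA Az; split => //.
    by rewrite mulNr oppr_gt0.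
  apply: inA; split => //.
  pose w := y - (z + (r / 2) *: (c *: unrotate Q l 0 1)).
  have yE : y = z + (r / 2) *: (c *: unrotate Q l 0 1) + w by rewrite /w addrC subrK.
  have hy : height Q l y = height Q l z + r / 2 * c + height Q l w.
    by rewrite yE !heightD !heightZ height_unrotate// mulr1.
  have byE : base Q l y = base Q l z + base Q l w.
    by rewrite yE !baseD !baseZ base_unrotate// !scaler0 addr0.
  have pw : `|phi (base Q l y) - phi (base Q l z)| <= L * enorm w.
    rewrite (le_trans (lip _ _ bz by_))// ler_wpM2l// byE addrAC subrr add0r.
    exact: enorm_base.
  have hw := abs_height l Qrot w.
  have Lw : L * enorm w <= L * (eps * r) by rewrite ler_wpM2l.
  have tot : `|height Q l w - (phi (base Q l y) - phi (base Q l z))| <= r / 10.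
    apply: le_trans (ler_normB _ _) _; apply: le_trans (lerD hw pw) _.
    apply: le_trans (lerD yz Lw) _.
    have -> : eps * r + L * (eps * r) = (eps * (1 + L)) * r by ring.
    by rewrite epsL mulrAC ler_wpM2r// ler_piMl// ltW.
  (* The vertical shift adds [r / 2] to a nonnegative signed gap, and the displacement [w] removes
     at most [r / 10]. *)
  have -> : c * gap Q l phi y = c * gap Q l phi z + r / 2 * (c * c) +
      c * (height Q l w - (phi (base Q l y) - phi (base Q l z))) by rewrite /gap hy; ring.
  have : `|c * (height Q l w - (phi (base Q l y) - phi (base Q l z)))| <= r / 10.
    by rewrite normrM cn mul1r.
  rewrite cc ler_norml => /andP[t _].
  move: t cz r0; set q := c * (_ - _); set q' := c * gap _ _ _ _; lra.
have [inP|outP] := sides 1 (or_introl erefl); have [inN|outN] := sides (-1)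
  (or_intror erefl).
- apply: cone_interior; have e3 : 0 < 3 * eps by rewrite mulr_gt0.
  apply: filterS (ball_enorm a e3) => x /= /ltW /box[bx gx].
  have [g0|g0|g0] := ltgtP (gap Q l phi x) 0.
  + by apply: inN; split => //; rewrite mulN1r oppr_gt0.
  + by apply: inP; split => //; rewrite mul1r.
  + by apply: closed_boundary; apply/(bdE _ bx gx).
- by exists eps => //; apply: (one_side 1) => //; left.
- exists eps => //; apply: (one_side (-1)) => //; first by right.
  by move=> x; rewrite opprK; exact: outP.
- exfalso; have e3 : 0 < 3 * eps by rewrite mulr_gt0.
  apply: (@not_a_graph Q l phi a (3 * eps) Qrot Aa e3) => x Ax /box[bx gx].
  apply/eqP; rewrite eq_le !leNgt; apply/andP; split; apply/negP => g0.
    by apply: (outP x) Ax; split => //; rewrite mul1r.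
  by apply: (outN x) Ax; split => //; rewrite mulN1r oppr_gt0.
Qed.

Lemma cone_everywhere a : A a -> exists2 eps, 0 < eps & cone_at eps a.
Proof.
move=> Aa; have [d2|d1] := leqP 2 d; last first.
  by apply: cone_line => //; apply/eqP; rewrite eqn_leq d_gt0 andbT.
have [ia|ia] := pselect (interior A a); first exact: cone_interior.
by apply: cone_boundary => //; split => //; exact: subset_closure.
Qed.

(** A direction valid at [a] stays valid at nearby points for smaller [eps], and [A] is compact. *)
Lemma uniform_cone : exists2 eps, 0 < eps & forall a, A a -> cone_at eps a.
Proof.
have /compact_near_coveringP cov := A_compact.
have : \forall eps \near (0 : R)^'+, A `<=` cone_at eps.
  apply: cov => a Aa; have [eps eps0 [e e1 ce]] := cone_everywhere Aa.
  have eps2 : 0 < eps / 2 by rewrite divr_gt0.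
  (* Halving leaves room for the change of centre: [eps / 2 + eps / 2 <= eps]. *)
  exists ([set y | enorm (y - a) < eps / 2], [set t | t <= eps / 2]).
    by split; [exact: ball_enorm|exact: nbhs_right_le].
  move=> [a' t] [/= a'a t2]; exists e => // z Az za' r /andP[r0 rt] y yz.
  apply: (ce z Az _ r).
  - have := enorm_triangle z a' a; move: a'a t2 za'; lra.
  - by rewrite r0/=; move: rt t2 eps0; lra.
  - apply: le_trans yz _; rewrite ler_pM2r//; move: t2 eps0; lra.
move=> near_cone; near (0 : R)^'+ => eps.
exists eps; first by near: eps; exact: nbhs_right_gt.
by near: eps.
Unshelve. all: by end_near. Qed.

End interior_cones.

(** * Asymptotics *)

Section asymptotics.
Context {R : realType}.

Lemma exp_ge_monomial (t : R) (k : nat) : 0 <= t -> t ^+ k / k`!%:R <= expR t.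
Proof.
move=> t0; have nd : nondecreasing_seq (series (exp_coeff t)).
  by apply: nondecreasing_series => i _ _; exact: exp_coeff_ge0.
have := nondecreasing_cvgn_le nd (is_cvg_series_exp_coeff t) k.+1.
rewrite -[limn _]/(expR t); apply: le_trans.
rewrite seriesSr lerDr; apply: sumr_ge0 => i _; exact: exp_coeff_ge0.
Qed.

(** Half of the exponent absorbs the power, by [(c / 2 * y) ^ k / k! <= expR (c / 2 * y)]. *)
Lemma monomial_exp_bound (c : R) (k : nat) : 0 < c -> exists2 C, 0 <= C &
  forall y, 0 <= y -> y ^+ k * expR (- (c * y)) <= C * expR (- (c / 2 * y)).
Proof.
move=> c0; exists (k`!%:R * (2 / c) ^+ k).
  by rewrite mulr_ge0// exprn_ge0// divr_ge0// ltW.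
move=> y y0; have cy0 : 0 <= c / 2 * y by rewrite mulr_ge0// divr_ge0// ltW.
have := exp_ge_monomial k cy0.
rewrite ler_pdivrMr ?ltr0n ?fact_gt0// => h.
have -> : y ^+ k = (2 / c) ^+ k * (c / 2 * y) ^+ k.
  by rewrite -exprMn; congr (_ ^+ k); field; rewrite gt_eqF.
have -> : expR (- (c * y)) = expR (- (c / 2 * y)) * expR (- (c / 2 * y)).
  by rewrite -expRD; congr expR; field.
have p0 : 0 <= (2 / c) ^+ k by rewrite exprn_ge0// divr_ge0// ltW.
move: h p0 (expR_ge0 (- (c / 2 * y))); set t := _ ^+ k; set p := _ ^+ k.
have : expR (c / 2 * y) * expR (- (c / 2 * y)) = 1 by rewrite -expRD subrr expR0.
set E := expR (c / 2 * y); set E' := expR _; set q := k`!%:R => EE h p0 E0.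
have h' : t * E' <= q.
  apply: le_trans (ler_wpM2r E0 h) _.
  by rewrite mulrAC EE mul1r.
rewrite mulrA ler_wpM2r// -mulrA [leRHS]mulrC; exact: ler_wpM2l.
Qed.

(** Eventually [theta * n * r n ^ d < B * ln n], while [ln n] is negligible against [n]. *)
Lemma radius_vanishes (d : nat) (theta B : R) (r : R -> R) : (0 < d)%N -> 0 < theta ->
  (forall n, 0 < n -> 0 < r n) ->
  (limf_esup (fun n : R => (theta * n * r n ^+ d / ln n)%:E) +oo%R < B%:E)%E ->
  forall del, 0 < del -> \forall n \near +oo, r n <= del.
Proof.
move=> d0 th0 r0 /ereal_inf_lt[_ [V Vinf <-] supV] del del0.
have del_d : 0 < del ^+ d by exact: exprn_gt0.
have nrd n : V n -> theta * n * r n ^+ d / ln n < B.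
  move=> Vn; rewrite -lte_fin; apply: le_lt_trans supV.
  by apply: ereal_sup_ubound; exists n.
near=> n.
have n1 : 1 < n by near: n; exact: nbhs_pinfty_gt.
have n0 : 0 < n := lt_trans ltr01 n1.
have nB : expR (2 * B / (theta * del ^+ d)) < n by near: n; apply: nbhs_pinfty_gt;
  exact: num_real.
have ln0 : 0 < ln n by rewrite ln_gt0.
have lnB : 2 * B / (theta * del ^+ d) < ln n by rewrite -ltr_expR lnK.
(* From [t ^ 2 / 2 <= expR t] at [t = ln n]. If [r n > del], then [theta * del ^ d * ln n < 2 * B],
   against [lnB]. *)
have ln2 : ln n ^+ 2 <= 2 * n.
  have := exp_ge_monomial 2 (ltW ln0); rewrite lnK ?posrE//.
  by rewrite ler_pdivrMr// mulrC.
have : theta * n * r n ^+ d / ln n < B by apply: nrd; near: n.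
rewrite ltr_pdivrMr// => hB.
have rn0 : 0 < r n by exact: r0.
suff : r n ^+ d <= del ^+ d by rewrite ler_pXn2r// nnegrE ltW.
rewrite leNgt; apply/negP => rdel.
move: lnB; rewrite ltr_pdivrMr ?mulr_gt0// => lnB.
have h1 : theta * n * del ^+ d < B * ln n.
  by apply: le_lt_trans hB; rewrite ler_pM2l ?mulr_gt0// ltW.
have h2 : theta * n * del ^+ d * ln n < B * ln n ^+ 2.
  by rewrite expr2 mulrA ltr_pM2r.
have B0 : 0 < B.
  rewrite -(pmulr_lgt0 _ ln0); apply: le_lt_trans hB.
  by apply: mulr_ge0; [exact/ltW/mulr_gt0|exact/exprn_ge0/ltW].
have h3 : B * ln n ^+ 2 <= B * (2 * n) by rewrite ler_pM2l.
have : n * (theta * del ^+ d * ln n) < n * (2 * B).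
  by move: h2 h3; rewrite (_ : n * (2 * B) = B * (2 * n)); [|ring];
    rewrite (_ : theta * n * _ * _ = n * (theta * del ^+ d * ln n)); [|ring];
    exact: lt_le_trans.
rewrite ltr_pM2l// => h4; have := lt_trans h4 lnB.
by rewrite mulrC ltxx.
Unshelve. all: by end_near. Qed.

End asymptotics.

Section moments.
Context {R : realType} {disp : measure_display} {Omega : measurableType disp}
  (P : probability Omega R).
Local Open Scope ereal_scope.

(* [S] counts, [mu1] and [mu2] are the rescaled factorial moments of [S]. *)
Lemma variance_near_mean (S : Omega -> nat) (c1 K : R) (mu1 mu2 : \bar R) :
  measurable_fun setT (fun w => (S w)%:R : R) ->
  (0 <= c1)%R -> (0 <= K)%R -> mu1 \is a fin_num -> 0 <= mu1 -> 0 <= mu2 ->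
  \int[P]_w (S w)%:R%:E = c1%:E * mu1 ->
  \int[P]_w (S w ^ 2)%:R%:E = \int[P]_w (S w)%:R%:E + (c1 ^+ 2)%:E * mu2 ->
  mu2 <= mu1 ^+ 2 + K%:E * mu1 -> mu1 ^+ 2 <= mu2 + K%:E * mu1 ->
  exists g : R, (`|g| <= c1 * K)%R /\
    'V_P[fun w => (S w)%:R] = 'E_P[fun w => (S w)%:R] * (1 + g)%:E.
Proof.
move=> mS c10 K0 fin1 mu10 mu20 ES ES2 le1 le2.
move: fin1 mu10 mu20 ES ES2 le1 le2; case: mu1 => // a _.
rewrite -EFin_expe -!EFinM -!EFinD; case: mu2 => // b.
rewrite !lee_fin => a0 b0 ES ES2 le1 le2.
rewrite ES -EFinM -EFinD in ES2.
have norm_id (h : Omega -> nat) : (fun w => `|(h w)%:R%:E : \bar R|) = (fun w =>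
  (h w)%:R%:E).
  by apply/funext => w; rewrite gee0_abs ?lee_fin.
have S1 : (fun w => (S w)%:R : R) \in Lfun P 1.
  apply/Lfun1_integrable/integrableP; split; first exact/measurable_EFinP.
  by rewrite norm_id ES ltry.
have S2 : ((fun w => (S w)%:R : R) * (fun w => (S w)%:R : R))%R \in Lfun P 1.
  have E : (EFin \o ((fun w => (S w)%:R : R) * (fun w => (S w)%:R : R))%R) =
     (fun w => (S w ^ 2)%:R%:E).
    by apply/funext => w /=; rewrite natrX expr2.
  apply/Lfun1_integrable/integrableP; split.
    by apply/measurable_EFinP; exact: measurable_funM.
  by rewrite E norm_id ES2 ltry.
have EE : 'E_P[fun w => (S w)%:R] = (c1 * a)%:E by rewrite unlock.
have VE : 'V_P[fun w => (S w)%:R] = (c1 * a + c1 ^+ 2 * b - (c1 * a) * (c1 * a))%:E.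
  rewrite /variance covarianceE// EE -EFinM EFinB; congr (_ - _).
  rewrite unlock -ES2; apply: eq_integral => w _.
  by rewrite natrX expr2.
rewrite EE VE.
(* The left-hand side is variance minus mean; the comparisons of [a ^ 2] and [b] are multiplied by
   [c1 ^ 2]. *)
have bound : (`|c1 ^+ 2 * b - (c1 * a) * (c1 * a)| <= c1 * K * (c1 * a))%R.
  rewrite ler_norml; have c2 : (0 <= c1 ^+ 2)%R by rewrite sqr_ge0.
  have h1 := ler_wpM2l c2 le1; have h2 := ler_wpM2l c2 le2.
  by apply/andP; split; lra.
(* If the mean is zero, [bound] forces a zero variance and [g = 0] works; otherwise [g] is the
   relative error. *)
have [e0|e0] := eqVneq (c1 * a)%R 0%R.
  exists 0%R; split; first by rewrite normr0 mulr_ge0.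
  congr EFin; move: bound; rewrite e0 !mulr0 normr_le0 mul0r add0r subr0.
  by move=> /eqP; lra.
have ep : (0 < c1 * a)%R by rewrite lt_def e0 mulr_ge0.
exists ((c1 ^+ 2 * b - (c1 * a) * (c1 * a)) / (c1 * a))%R; split.
  by rewrite normrM normfV (ger0_norm (ltW ep)) ler_pdivrMr.
by rewrite -EFinM; congr EFin; rewrite [RHS]mulrDr mulr1 [X in
  (_ = _ + X)%R]mulrC divfK// addrA.
Qed.

End moments.

(** * Uniform constants and the variance estimate *)

Section cluster_variance.
Context {R : realType} {d : nat}.
Local Notation T := 'rV[R]_d.
Variables (A : set T) (f : T -> R) (nu : probability T R).
Hypotheses (d_gt0 : (0 < d)%N) (A_compact : compact A) (nu_density : has_density nu f)
  (nu_support : measure_support nu = A) (f_cont : {within A, continuous f})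
  (f0_gt0 : 0 < inf (f @` A)) (A_C11 : (2 <= d)%N -> C11_boundary A)
  (A_itv : d = 1%N -> forall i : 'I_d, is_interval [set x 0 i | x in A]).

Lemma cap_probability : exists2 kap, 0 < kap & exists2 r0, 0 < r0 &
  forall a, A a -> exists2 e, enorm e = 1 & forall r, 0 < r <= r0 ->
    forall z, A z -> enorm (z - a) <= r0 ->
    ((kap * r ^+ d)%:E <= nu [set q | enorm (q - (z + (r / 2) *: e)) <= r / 10]%R)%E.
Proof.
have [eps0 eps00 cone] := uniform_cone d_gt0 A_compact nu_density nu_support f_cont
  f0_gt0 A_C11 A_itv.
have [M M0 [_ Mge]] := density_bounds A_compact nu_density nu_support f_cont f0_gt0.
pose eps := Num.min eps0 (1 / 10).
have eps_gt0 : 0 < eps by rewrite lt_min eps00 divr_gt0.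
have eps_le : eps <= eps0 by rewrite ge_min lexx.
have eps10 : eps <= 1 / 10 by rewrite ge_min lexx orbT.
have dR : 0 < d%:R :> R by rewrite ltr0n.
exists (inf (f @` A) * (2 * eps / d%:R) ^+ d).
  by rewrite mulr_gt0// exprn_gt0// divr_gt0// mulr_gt0.
exists eps0 => // a Aa; have [e e1 ce] := cone a Aa.
exists e => // r rr z Az za; have /andP[r0 re] := rr.
(* The cube of half-side [s] lies in the ball of radius [eps * r], hence in [A] by the cone property
   and in the cap as [eps <= 1 / 10]; on [A] the density is at least its infimum. *)
pose c := z + (r / 2) *: e; pose s := eps * r / d%:R.
have s0 : 0 <= s by rewrite divr_ge0 ?mulr_ge0// ltW.
have sub q : cube c s q -> enorm (q - c) <= eps * r.
  by move=> /(cube_enorm_ball s0)/=; rewrite /s mulrC divfK// gt_eqF.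
have QA : cube c s `<=` A.
  move=> q /sub qc; apply: (ce z Az za r rr q).
  by apply: le_trans qc _; rewrite ler_pM2r.
have Qcap : cube c s `<=` [set q | enorm (q - c) <= r / 10].
  move=> q /sub qc /=; apply: le_trans qc _.
  by rewrite mulrC ler_pM2l// (le_trans eps10)// div1r.
have := Mge _ (measurable_cube c s) QA; rewrite lebesgue_cube// -EFinM => h.
have -> : inf (f @` A) * (2 * eps / d%:R) ^+ d * r ^+ d = inf (f @` A) * (2 * s) ^+ d.
  by rewrite -mulrA -exprMn; congr (_ * _ ^+ _); rewrite /s; ring.
apply: le_trans h _; apply: le_measure; rewrite ?inE//; first exact: measurable_cube.
exact: measurable_cap.
Qed.

Lemma ball_probability : exists2 M, 0 < M & forall (a : T) (s : R), 0 <= s ->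
  (nu [set z | enorm (a - z) <= s]%R <= (M * s ^+ d)%:E)%E.
Proof.
have [M M0 [Mle _]] := density_bounds A_compact nu_density nu_support f_cont f0_gt0.
exists (M * 2 ^+ d); first by rewrite mulr_gt0// exprn_gt0.
move=> a s s0; have mB : measurable [set z | enorm (a - z) <= s].
  rewrite (_ : [set _ | _] = [set z | enorm (z - a) <= s]); first exact: measurable_cap.
  by apply/seteqP; split => z /=; rewrite enormB.
apply: le_trans (le_measure nu _ _ (@enorm_ball_cube _ _ a s)) _; rewrite ?inE//.
  exact: measurable_cube.
by have := Mle _ (measurable_cube a s); rewrite lebesgue_cube// -EFinM exprMn mulrA.
Qed.

Lemma ae_in_support (mu : probability (@seqspace _ T) R) : iid_law nu mu ->
  {ae mu, forall x : @seqspace _ T, forall i, A (x i)}.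
Proof.
move=> H; apply: ae_foralln => i.
have mAC : measurable (~` A) by apply: measurableC; exact: compact_rV_measurable.
exists [set x : @seqspace _ T | (~` A) (x i)]; split => //.
  by rewrite -[X in measurable X]setTI; exact: measurable_seq_coord.
have := H [fset i]%fset (fun=> ~` A) (fun=> mAC).
rewrite big_seq_fset1 (density_support A_compact nu_support) => <-; congr (mu _).
apply/seteqP; split => x /= h; last by apply: h; rewrite inE.
by move=> j; rewrite inE => /eqP ->.
Qed.

(** The constants precede the probability space, the intensity and the radius, so they do not vary
    with [n]. *)
Lemma cluster_variance (k : nat) : (0 < k)%N ->
  exists c C r0 : R, [/\ 0 < c, 0 < r0 & forall (disp : measure_display)
    (Omega : measurableType disp) (P : probability Omega R)
    (X : nat -> {RV P >-> T}) (N : {RV P >-> nat}) (lam r : R),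
    iid nu X -> 0 < lam -> is_poisson lam N -> independent_of_sequence N X ->
    0 < r <= r0 ->
    exists g, `|g| <= C * expR (- (c * lam * r ^+ d)) /\
      ('V_P[fun w => (num_components k r (sample X N w))%:R] =
       'E_P[fun w => (num_components k r (sample X N w))%:R] * (1 + g)%:E)%E].
Proof.
move=> k0; have [kap kap0 [r0 r00 caps]] := cap_probability.
have [M M0 balls] := ball_probability.
have [C C0 expC] := monomial_exp_bound k kap0.
(* Ratio of the diameter bound of two close clusters to [r]; [r <= r0 / fac] puts them within reach
   of one inner direction. *)
pose fac := (k + k).+2%:R : R.
have fac0 : 0 < fac by rewrite ltr0n.
pose C' := 2 * k`!%:R^-1 * (M * fac ^+ d) ^+ k * C.
exists (kap / 2), C', (r0 / fac); split; [by rewrite divr_gt0|by rewrite divr_gt0|].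
move=> disp Omega P X N lam r Xiid lam0 Npois Nind /andP[r_gt0 rr0].
have rfac : fac * r <= r0 by rewrite mulrC -ler_pdivlMr.
have fac1 : 1 <= fac by rewrite ler1n.
have r_le : r <= r0 by rewrite (le_trans _ rfac)// ler_peMl// ltW.
have rd0 : 0 <= r ^+ d by rewrite exprn_ge0// ltW.
pose mu := seq_law X.
have mu_iid : iid_law nu mu := seq_law_iid Xiid.
pose kapr := M * (fac * r) ^+ d.
have kapr0 : 0 <= kapr by rewrite mulr_ge0 ?exprn_ge0 ?mulr_ge0// ltW.
have capsr (x : @seqspace _ T) : (forall i, (i < k + k)%N -> A (x i)) ->
    (forall i l, (i < k + k)%N -> (l < k + k)%N ->
       enorm (x i - x l) <= (k + k).+2%:R * r) ->
    exists2 e, enorm e = 1 & forall i, (i < k + k)%N ->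
      ((kap * r ^+ d)%:E <= nu [set q | enorm (q - (x i + (r / 2) *: e)) <= r / 10]%R)%E.
  have kk0 : (0 < k + k)%N by rewrite addn_gt0 k0.
  move=> xA diam; have [e e1 ce] := caps _ (xA 0%N kk0).
  exists e => // i ikk; apply: ce; first by rewrite r_gt0.
    exact: xA.
  by rewrite (le_trans (diam _ _ ikk kk0)).
have ballsr a : A a -> (nu [set z | enorm (a - z) <= (k + k).+2%:R * r]%R <= kapr%:E)%E.
  by move=> _; apply: balls; rewrite mulr_ge0// ltW.
have [le1 le2] := compare_means mu_iid lam0 r_gt0 k0 kapr0 capsr ballsr
  (ae_in_support mu_iid).
have mw := measurable_weight nu lam r k.
have w0 := weight_ge0 nu lam r k.
have w1 x : weight nu lam r k x <= 1.
  rewrite /weight -[leRHS]mulr1 ler_pM ?expR_ge0//; first by case: clustered.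
  rewrite -expR0 ler_expR oppr_le0; apply: mulr_ge0; first exact: ltW.
  by rewrite /cover subr_ge0; apply: prob_of_le1; exact: measurable_outside.
have mean0 : (0 <= one_mean nu X lam k r)%E.
  by apply: integral_ge0 => x _; rewrite lee_fin; exact: w0.
have mean20 : (0 <= two_mean nu X lam k r)%E.
  by apply: integral_ge0 => x _; rewrite lee_fin; exact: (weight2_ge0 nu lam r k x).
have le_one : (\int[mu]_x (weight nu lam r k x)%:E <= 1)%E.
  apply: (@le_trans _ _ (\int[mu]_x (1 : R)%:E)%E).
    apply: ge0_le_integral; first exact: measurableT.
    - by move=> x _; rewrite lee_fin; exact: w0.
    - by apply/measurable_EFinP; exact: mw.
    - by apply/measurable_EFinP; exact: measurable_cst.
    - by move=> x _; rewrite lee_fin; exact: w1.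
  by rewrite integral_cst// mul1e; exact: probability_le1.
have fin1 : one_mean nu X lam k r \is a fin_num.
  rewrite (ge0_fin_numE mean0); exact: le_lt_trans le_one (ltry 1).
have nu_diff := density_diffuse d_gt0 nu_density.
have mS := measurable_sample_count X N k r.
have ES := expectation_count Xiid lam0 Npois Nind nu_diff r k0.
have ES2 := expectation_count_sqr Xiid lam0 Npois Nind nu_diff r k0.
have kf0 : 0 <= k`!%:R^-1 :> R by rewrite invr_ge0.
have c10 : 0 <= k`!%:R^-1 * lam ^+ k by rewrite mulr_ge0 ?exprn_ge0// ltW.
have sq : (k`!%:R ^+ 2)^-1 * lam ^+ (k + k) = (k`!%:R^-1 * lam ^+ k) ^+ 2.
  by rewrite exprMn exprVn -exprM muln2 addnn.
rewrite sq in ES2.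
pose K := 2 * expR (- (lam * (kap * r ^+ d))) * kapr ^+ k.
have K0 : 0 <= K by rewrite !mulr_ge0 ?expR_ge0 ?exprn_ge0.
have [g [gK gV]] := variance_near_mean mS c10 K0 fin1 mean0 mean20 ES ES2 le1 le2.
exists g; split => //; apply: le_trans gK _.
have y0 : 0 <= lam * r ^+ d by rewrite mulr_ge0// ltW.
have := expC _ y0; move: (expR_ge0 (- (kap / 2 * (lam * r ^+ d)))).
(* The factor [lam ^ k] of the rescaling meets the [r ^ (d * k)] contained in [kapr ^ k], which
   leaves the expression bounded by [expC]. *)
have -> : k`!%:R^-1 * lam ^+ k * K =
    (2 * k`!%:R^-1 * (M * fac ^+ d) ^+ k) *
    ((lam * r ^+ d) ^+ k * expR (- (kap * (lam * r ^+ d)))).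
  rewrite /K.
  have -> : kapr = M * fac ^+ d * r ^+ d by rewrite /kapr exprMn mulrA.
  have -> : lam * (kap * r ^+ d) = kap * (lam * r ^+ d) by ring.
  set E := expR _; set u := M * fac ^+ d; set v := r ^+ d; set q := k`!%:R^-1.
  by rewrite !exprMn; ring.
move=> e0 h; rewrite /C' (_ : kap / 2 * lam * r ^+ d = kap / 2 * (lam * r ^+ d));
  last by ring.
rewrite -[leRHS]mulrA; apply: ler_wpM2l => //.
by rewrite !mulr_ge0 ?exprn_ge0 ?mulr_ge0 ?exprn_ge0// ltW.
Qed.

End cluster_variance.

Theorem proposition4p1 (R : realType) (d : nat) (d_gt0 : (0 < d)%N)
  (A : set 'rV[R]_d) (A_compact : compact A)
  (A_vol_gt0 : (0 < lebesgue_rV d A)%E)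
  (A_C11 : (2 <= d)%N -> C11_boundary A)
  (A_itv : d = 1%N -> forall i : 'I_d, is_interval [set x 0 i | x in A])
  (f : 'rV[R]_d -> R) (nu : probability 'rV[R]_d R)
  (nu_density : has_density nu f) (nu_support : measure_support nu = A)
  (f_cont : {within A, continuous f})
  (f0_gt0 : 0 < inf (f @` A))
  (disp : measure_display) (Omega : measurableType disp)
  (P : probability Omega R)
  (X : nat -> {RV P >-> 'rV[R]_d}) (X_iid : iid nu X)
  (Z : R -> {RV P >-> nat})
  (Z_poisson : forall n : R, 0 < n -> is_poisson n (Z n))
  (Z_indep : forall n : R, 0 < n -> independent_of_sequence (Z n) X)
  (r : R -> R) (r_gt0 : forall n : R, 0 < n -> 0 < r n)
  (nrd_infty : n * r n ^+ d @[n --> +oo%R] --> +oo)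
  (nrd_limsup :
    (limf_esup (fun n : R => (unit_ball_volume R d * n * r n ^+ d / ln n)%:E)
       +oo%R
     < (Num.max (inf (f @` A))
          (d%:R * (inf (f @` A) - inf (f @` boundary A) / 2)))^-1%:E)%E)
  (k : nat) (k_gt0 : (0 < k)%N) :
  exists2 c : R, 0 < c &
  exists2 g : R -> R,
    (exists C : R, \forall n \near +oo,
      `|g n| <= C * expR (- (c * n * r n ^+ d))) &
    \forall n \near +oo,
      ('V_P[cluster_count X Z r k n] =
         'E_P[cluster_count X Z r k n] * (1 + g n)%:E)%E /\
      ('E_P[cluster_count X Z r k n] * (1 + g n)%:E =
         mean_cluster_count X Z r k n * (1 + g n)%:E)%E.

Proof.
have [c [C [r0 [c0 r00 var]]]] := cluster_variance d_gt0 A_compact nu_density nu_support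
  f_cont f0_gt0 A_C11 A_itv k_gt0.
have small := radius_vanishes d_gt0 (unit_ball_volume_gt0 R d_gt0) r_gt0 nrd_limsup r00.
(* [g] must be a function on all of [R]: it takes the value [0] where [n] or [r n] is out of range,
   which is eventually excluded. *)
have /choice[g gP] n : exists g : R, 0 < n -> r n <= r0 ->
    `|g| <= C * expR (- (c * n * r n ^+ d)) /\
    ('V_P[cluster_count X Z r k n] = 'E_P[cluster_count X Z r k n] * (1 + g)%:E)%E.
  have [n0|n0] := pselect (0 < n); last by exists 0 => n0'.
  have [rn|rn] := pselect (r n <= r0); last by exists 0 => _ rn'.
  have rr : 0 < r n <= r0 by rewrite r_gt0.
  have [g [gC gV]] := var _ _ P X (Z n) n (r n) X_iid n0 (Z_poisson n n0) (Z_indep n n0) rr.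
  by exists g.
have pos : \forall n \near +oo, (0 : R) < n by exact: nbhs_pinfty_gt.
exists c => //; exists g.
  exists C; near=> n; apply: (gP n _ _).1; first by near: n.
  by near: n.
near=> n; split; last by [].
apply: (gP n _ _).2; first by near: n.
by near: n.
Unshelve. all: by end_near. Qed.
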